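(* Let $M^5\subset\mathbb{C}^4$ be a local real analytic $5$-dimensional CR-generic submanifold passing through the origin, $0\in M^5$, which belongs to the General Class $\mathsf{III}_{\mathsf 1}$, i.e. such that for any local vector field generator $\mathcal{L}$ of $T^{1,0}M$, the five fields $$\Big\{\mathcal{L},\ \overline{\mathcal{L}},\ [\mathcal{L},\overline{\mathcal{L}}],\ \big[\mathcal{L},[\mathcal{L},\overline{\mathcal{L}}]\big],\ \big[\overline{\mathcal{L}},[\mathcal{L},\overline{\mathcal{L}}]\big]\Big\}$$ constitute a frame for $\mathbb{C}\otimes_{\mathbb{R}}TM$. Then $M$ may always be represented near the origin, in suitable local holomorphic coordinates $(z,w_1,w_2,w_3)\in\mathbb{C}^4$ (centered at the origin) with $w_j=u_j+\sqrt{-1}\,v_j$, by three real analytic equations of the form $$\begin{aligned} v_1&=z\overline{z}+z\overline{z}\,\mathrm{O}_2(z,\overline{z})+z\overline{z}\,\mathrm{O}_1(u_1)+z\overline{z}\,\mathrm{O}_1(u_2)+z\overline{z}\,\mathrm{O}_1(u_3),\\ v_2&=z^2\overline{z}+z\overline{z}^2+z\overline{z}\,\mathrm{O}_2(z,\overline{z})+z\overline{z}\,\mathrm{O}_1(u_1)+z\overline{z}\,\mathrm{O}_1(u_2)+z\overline{z}\,\mathrm{O}_1(u_3),\\ v_3&=\sqrt{-1}\,\big(z^2\overline{z}-z\overline{z}^2\big)+z\overline{z}\,\mathrm{O}_2(z,\overline{z})+z\overline{z}\,\mathrm{O}_1(u_1)+z\overline{z}\,\mathrm{O}_1(u_2)+z\overline{z}\,\mathrm{O}_1(u_3).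 \end{aligned}$$
   Context: A real submanifold $M\subset\mathbb{C}^{N}$ is CR-generic if $T_pM+J\,T_pM=T_p\mathbb{C}^{N}$ for every $p\in M$, where $J$ is the standard complex structure. $T^{1,0}M$ denotes the bundle $T^{1,0}\mathbb{C}^4|_M\cap(\mathbb{C}\otimes_{\mathbb{R}}TM)$, here of complex rank $1$; $\overline{\mathcal{L}}$ is the conjugate field and $[\cdot,\cdot]$ the Lie bracket. ''Frame'' means a basis of the fiber at every point of the (local) manifold $M$. Remainder notation: $\mathrm{O}_k(t_1,\dots,t_N)$ denotes an unspecified convergent power series (with complex coefficients) in $t_1,\dots,t_N$ all of whose monomials have total degree $\geqslant k$. By convention $z\overline{z}\,\mathrm{O}_1(u_j)$ is shorthand for $z\overline{z}\,u_j\,\mathrm{O}_0(z,\overline{z},u_1,u_2,u_3)$. Different occurrences of a remainder symbol may denote different series. The right-hand sides of the graphing equations are real-valued convergent power series in $(z,\overline{z},u_1,u_2,u_3)$. *)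

(* Defs.v *)
From HB Require Import structures.
From mathcomp Require Import all_boot all_order all_algebra.
From mathcomp Require Import complex.
From mathcomp Require Import all_classical all_reals all_analysis.

Set Implicit Arguments.
Unset Strict Implicit.
Unset Printing Implicit Defensive.

Import Order.TTheory GRing.Theory Num.Theory.
Import numFieldNormedType.Exports.

Local Open Scope classical_set_scope.
Local Open Scope ring_scope.

(* The complex numbers over R. Packaging R[i] as a numClosedFieldType is what
   makes the topology of numFieldNormedType available on it. *)
Definition Cplx (R : realType) : numClosedFieldType := R[i].

Definition ReC (R : realType) (z : Cplx R) : R := complex.Re z.
Definition ImC (R : realType) (z : Cplx R) : R := complex.Im z.
Definition RtoC (R : realType) (x : R) : Cplx R := real_complex R x.

Section PowerSeries.
Variables (R : realType) (n : nat).
Local Notation C := (Cplx R).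
Local Notation mindex := {ffun 'I_n -> nat}.

Definition mdegree (m : mindex) : nat := (\sum_(i < n) m i)%N.

Definition monomial (h : 'rV[C]_n) (m : mindex) : C :=
  \prod_(i < n) h 0 i ^+ m i.

(* The multi-indices whose entries are all < N are the elements of
   {ffun 'I_n -> 'I_N}. *)
Definition box_index (N : nat) (b : {ffun 'I_n -> 'I_N}) : mindex :=
  [ffun i => b i : nat].

Definition ps_partial_sum (a : mindex -> C) (h : 'rV[C]_n) (N : nat) : C :=
  \sum_(b : {ffun 'I_n -> 'I_N}) a (box_index b) * monomial h (box_index b).

Definition ps_partial_norm_sum (a : mindex -> C) (h : 'rV[C]_n) (N : nat) : C :=
  \sum_(b : {ffun 'I_n -> 'I_N}) `|a (box_index b) * monomial h (box_index b)|.

(* \sum_m a_m h^m converges absolutely, with sum s; absolute convergence makes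
   s independent of the exhaustion of the multi-indices by boxes. *)
Definition is_ps_sum (a : mindex -> C) (h : 'rV[C]_n) (s : C) : Prop :=
  (exists B : C, forall N, ps_partial_norm_sum a h N <= B) /\
  ps_partial_sum a h N @[N --> \oo] --> s.

(* g is, near the origin of C^n, the sum of a convergent power series all of
   whose monomials have total degree >= k. *)
Definition bigO_series (k : nat) (g : 'rV[C]_n -> C) : Prop :=
  exists a : mindex -> C,
    (forall m, (mdegree m < k)%N -> a m = 0) /\
    \forall h \near (0 : 'rV[C]_n), is_ps_sum a h (g h).

Definition holomorphic_at (g : 'rV[C]_n -> C) (p : 'rV[C]_n) : Prop :=
  exists a : mindex -> C,
    \forall h \near (0 : 'rV[C]_n), is_ps_sum a h (g (p + h)).

Definition real_analytic_at (g : 'rV[R]_n -> C) (p : 'rV[R]_n) : Prop :=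
  exists a : mindex -> C,
    \forall h \near (0 : 'rV[R]_n), is_ps_sum a (map_mx (@RtoC R) h) (g (p + h)).

End PowerSeries.

(* The point (x, y) of R^(N+N) stands for the point x + i y of C^N; the basis
   of the tangent spaces is (d/dx_1, .., d/dx_N, d/dy_1, .., d/dy_N). *)
Definition complex_point (R : realType) (N : nat) (t : 'rV[R]_(N + N)) :
    'rV[Cplx R]_N :=
  \row_j (Complex (lsubmx t 0 j) (rsubmx t 0 j) : Cplx R).

(* J maps d/dx_j to d/dy_j and d/dy_j to - d/dx_j; over K = C this is the
   C-linear extension of J to the complexified tangent space. *)
Definition Jmx (K : nzRingType) (N : nat) (t : 'rV[K]_(N + N)) :
    'rV[K]_(N + N) :=
  row_mx (- rsubmx t) (lsubmx t).

(* A local real analytic submanifold of C^N of real dimension d, given in the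
   open set chart_dom by 2N - d real analytic equations with linearly
   independent differentials. *)
Record local_submanifold (R : realType) (N d : nat) := LocalSubmanifold {
  chart_dom : set 'rV[R]_(N + N);
  def_fun : 'I_(N + N - d) -> 'rV[R]_(N + N) -> R;
  chart_dom_open : open chart_dom;
  def_fun_analytic : forall j p, chart_dom p ->
    real_analytic_at (fun t => RtoC (def_fun j t)) p;
  def_fun_submersion : forall p, chart_dom p -> (forall j, def_fun j p = 0) ->
    row_free (\matrix_(j < N + N - d, k < N + N)
                'D_(delta_mx 0 k) (def_fun j) p)
}.

Section Geometry.
Variables (R : realType) (N d : nat) (M : local_submanifold R N d).
Local Notation C := (Cplx R).
Local Notation E := 'rV[R]_(N + N).
Local Notation CE := 'rV[C]_(N + N).

Definition points : set E := [set p | chart_dom M p /\ forall j, def_fun M j p = 0].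

Definition tangent (p : E) : set E :=
  [set v | forall j, 'D_v (def_fun M j) p = 0].

Definition CR_generic : Prop :=
  forall p, points p ->
  forall v : E, exists a b, [/\ tangent p a, tangent p b & v = a + Jmx b].

(* The fibre at p of C (x) TM, inside C (x) T_p(C^N) = C^(N+N). *)
Definition ctangent (p : E) : set CE :=
  [set Z | exists X Y : E, [/\ tangent p X, tangent p Y &
     Z = map_mx (@RtoC R) X + ('i : C) *: map_mx (@RtoC R) Y]].

Definition T10 (p : E) : set CE :=
  [set Z | ctangent p Z /\ Jmx Z = ('i : C) *: Z].

Definition cpartial (k : 'I_(N + N)) (f : E -> C) (p : E) : C :=
  Complex ('D_(delta_mx 0 k) (fun t => ReC (f t)) p)
          ('D_(delta_mx 0 k) (fun t => ImC (f t)) p).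

Definition lie_bracket (X Y : E -> CE) (p : E) : CE :=
  \row_j \sum_(k < N + N)
     (X p 0 k * cpartial k (fun t => Y t 0 j) p
      - Y p 0 k * cpartial k (fun t => X t 0 j) p).

Definition conj_field (X : E -> CE) (p : E) : CE := map_mx Num.conj (X p).

(* A local generator of T^{1,0}M over M `&` V, extended analytically to the
   open set V of the ambient space. Along M, the iterated brackets of L and its
   conjugate do not depend on the extension, since L is tangent to M. *)
Definition T10_generator (V : set E) (L : E -> CE) : Prop :=
  (forall p, V p -> forall k, real_analytic_at (fun t => L t 0 k) p) /\
  (forall p, V p -> points p ->
     L p <> 0 /\ forall Z, T10 p Z <-> exists c : C, Z = c *: L p).

Definition class_III1_fields (L : E -> CE) (p : E) : 'M[C]_(5, N + N) :=
  let Lb := conj_field L in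
  let T := lie_bracket L Lb in
  \matrix_(i < 5)
    [:: L p; Lb p; T p; lie_bracket L T p; lie_bracket Lb T p]`_i.

Definition class_III1 : Prop :=
  forall (V : set E) (L : E -> CE),
    open V -> V `<=` chart_dom M -> T10_generator V L ->
    forall p, V p -> points p ->
      row_free (class_III1_fields L p) /\
      forall Z : CE, ctangent p Z <-> (Z <= class_III1_fields L p)%MS.

End Geometry.

(* F is a biholomorphism from a neighbourhood of 0 onto a neighbourhood of 0,
   fixing 0. *)
Definition local_holomorphic_coordinates (R : realType) (N : nat)
    (F : 'rV[Cplx R]_N -> 'rV[Cplx R]_N) : Prop :=
  exists (U V : set 'rV[Cplx R]_N) (G : 'rV[Cplx R]_N -> 'rV[Cplx R]_N),
    [/\ open U /\ open V, U 0 /\ F 0 = 0,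
        (forall p, U p -> V (F p) /\ G (F p) = p),
        (forall q, V q -> U (G q) /\ F (G q) = q) &
        (forall p, U p -> forall j, holomorphic_at (fun x => F x 0 j) p) /\
        (forall q, V q -> forall j, holomorphic_at (fun x => G x 0 j) q)].

Section Graph.
Variable R : realType.
Local Notation C := (Cplx R).

(* The coordinates (z, w_1, w_2, w_3) of q, with w_j = u_j + i v_j, have indices
   shifted by one: j : 'I_3 stands for j + 1. *)
Definition zc (q : 'rV[C]_4) : C := q 0 0.
Definition uc (j : 'I_3) (q : 'rV[C]_4) : R := ReC (q 0 (lift 0 j)).
Definition vc (j : 'I_3) (q : 'rV[C]_4) : R := ImC (q 0 (lift 0 j)).

Definition zzbar (q : 'rV[C]_4) : 'rV[C]_2 :=
  \row_(k < 2) [:: zc q; (zc q)^*]`_k.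

Definition zzbaru (q : 'rV[C]_4) : 'rV[C]_5 :=
  \row_(k < 5) [:: zc q; (zc q)^*; RtoC (uc 0 q); RtoC (uc 1 q);
                   RtoC (uc 2 q)]`_k.

Definition leading_part (j : 'I_3) (z : C) : C :=
  [:: z * z^*;
      z ^+ 2 * z^* + z * z^* ^+ 2;
      'i * (z ^+ 2 * z^* - z * z^* ^+ 2)]`_j.

(* A is the remainder O_2(z, zbar), and B k the factor O_0(z, zbar, u) in
   O_1(u_k) = u_k O_0(z, zbar, u). *)
Definition graph_rhs (j : 'I_3) (A : 'rV[C]_2 -> C)
    (B : 'I_3 -> 'rV[C]_5 -> C) (q : 'rV[C]_4) : C :=
  let z := zc q in
  leading_part j z + z * z^* * A (zzbar q)
  + \sum_(k < 3) z * z^* * (RtoC (uc k q) * B k (zzbaru q)).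

End Graph.

(* Main.v *)
Require Import Defs.
Set Warnings "-all".
From mathcomp Require Import all_boot all_order all_algebra.
From mathcomp Require Import complex cyclic separable cyclotomic.
From mathcomp Require Import all_classical all_reals all_analysis.
From mathcomp Require Import ring lra zify.

Import Order.TTheory GRing.Theory Num.Theory.
Import numFieldNormedType.Exports.

Set Implicit Arguments.
Unset Strict Implicit.
Unset Printing Implicit Defensive.

Local Open Scope classical_set_scope.
Local Open Scope ring_scope.

(** The submanifold is the zero set of a real analytic map rho. Its holomorphic
extension is an equation between a point (z, w) and an independent copy
(chi, tau) of its conjugate. Solving it for v, by an implicit function theorem
for analytic germs ([implicit_function]), writes the submanifold as a graph
v = phi (z, chi, u), with chi = conj z; a holomorphic change of w then makes
phi vanish for z = 0 and for chi = 0 ([normal_coordinates], [normal_form]).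
Consequently phi_j = z chi H_j, where
H_j = a_j + b_j z + conj b_j chi + O_2 (z, chi) + sum_k u_k O_0 (z, chi, u)
and a_j is real ([quotient_expansion], [expansion_real]).

The normal form asks for (a_j, b_j) = (1, 0), (0, 1), (0, i). A real linear
change of w brings them there as soon as the real 3 x 3 matrix with rows
(a_j, Re b_j, Im b_j) is invertible ([normalized_graph]), and this is where the
hypothesis on brackets enters ([coefficients_independent]). Suppose that real
numbers lam_j satisfy sum lam_j a_j = 0 and sum lam_j b_j = 0, and let f be
sum lam_j w_j. Measure functions by the number of derivatives along L and
conj L that vanish at 0 ([weight]), modulo functions vanishing on the
submanifold, which tangent fields preserve ([weight_vanishes]). The functions z
and conj z have weight 1 and, since w_j - conj w_j = 2 i z conj z H_j, the u_k
have weight 2; so f - conj f = 2 i z conj z sum lam_j H_j has weight 4. Here f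
is killed by conj L and conj f by L, hence f itself has weight 4
([skew_weight]). A bracket of length at most 3 of L and conj L is a combination
of compositions of at most 3 of these fields, so it kills f at 0. By hypothesis
the five fields span the complexified tangent space, which together with its
image under J spans everything; as f is holomorphic, its differential at 0 is
therefore 0. But f is the linear function sum lam_j w_j in holomorphic
coordinates, so lam = 0.

Analytic germs are handled as uniform limits of polynomials on polydiscs
([apx]), a class that is visibly closed under algebraic operations, composition
and geometric limits. Cauchy's inequality, obtained by averaging over roots of
unity ([cauchy_estimate]), gives division by coordinates ([apx_div]) and
identifies this class with sums of convergent power series ([apx_ps],
[real_analytic_ext]). *)

(** * Real-valued norms on complex numbers and vectors *)

Section Modulus.
Variable R : realType.
Local Notation C := (Cplx R).

(** The norm of C is valued in C; as an element of R, where the order is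
total, it can be handled by linear arithmetic. *)
Definition nm (x : C) : R := complex.Re `|x|.

Lemma nmE (x : C) : RtoC (nm x) = `|x|.
Proof. by rewrite /nm /RtoC normc_def. Qed.

Lemma RtoC_le (x y : R) : (RtoC x <= RtoC y) = (x <= y).
Proof. by rewrite /RtoC lecR. Qed.
Lemma RtoC_lt (x y : R) : (RtoC x < RtoC y) = (x < y).
Proof. by rewrite /RtoC ltcR. Qed.
Lemma RtoC_inj : injective (@RtoC R).
Proof. by move=> x y []. Qed.
Lemma RtoCD (x y : R) : RtoC (x + y) = RtoC x + RtoC y.
Proof. by rewrite /RtoC rmorphD. Qed.
Lemma RtoCM (x y : R) : RtoC (x * y) = RtoC x * RtoC y.
Proof. by rewrite /RtoC rmorphM. Qed.
Lemma RtoCN (x : R) : RtoC (- x) = - RtoC x.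
Proof. by rewrite /RtoC rmorphN. Qed.
Lemma RtoCX (x : R) k : RtoC (x ^+ k) = RtoC x ^+ k.
Proof. by rewrite /RtoC rmorphXn. Qed.
Lemma RtoC0 : RtoC (0 : R) = 0. Proof. by []. Qed.
Lemma RtoC1 : RtoC (1 : R) = 1. Proof. by []. Qed.
Lemma RtoC_sum (I : Type) (s : seq I) (P : pred I) (F : I -> R) :
  RtoC (\sum_(i <- s | P i) F i) = \sum_(i <- s | P i) RtoC (F i).
Proof. by rewrite /RtoC rmorph_sum. Qed.

Lemma nm_ge0 x : 0 <= nm x.
Proof. by rewrite -RtoC_le nmE RtoC0. Qed.
Lemma nm0 : nm 0 = 0.
Proof. by apply: RtoC_inj; rewrite nmE normr0. Qed.
Lemma nm1 : nm 1 = 1.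
Proof. by apply: RtoC_inj; rewrite nmE normr1. Qed.
Lemma nm_eq0 x : (nm x == 0) = (x == 0).
Proof.
rewrite -[RHS]normr_eq0 -nmE; apply/eqP/eqP => [->//|h]; exact: RtoC_inj.
Qed.
Lemma nmM x y : nm (x * y) = nm x * nm y.
Proof. by apply: RtoC_inj; rewrite RtoCM !nmE normrM. Qed.
Lemma nmX x k : nm (x ^+ k) = nm x ^+ k.
Proof. by apply: RtoC_inj; rewrite RtoCX !nmE normrX. Qed.
Lemma nmN x : nm (- x) = nm x.
Proof. by apply: RtoC_inj; rewrite !nmE normrN. Qed.
Lemma nmD x y : nm (x + y) <= nm x + nm y.
Proof. by rewrite -RtoC_le RtoCD !nmE ler_normD. Qed.
Lemma nmB x y : nm (x - y) <= nm x + nm y.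
Proof. by rewrite -(nmN y) nmD. Qed.
Lemma nmBC x y : nm (x - y) = nm (y - x).
Proof. by rewrite -nmN opprB. Qed.
Lemma nmB3 y x z : nm (x - z) <= nm (x - y) + nm (y - z).
Proof. have -> : x - z = (x - y) + (y - z) by ring.
exact: nmD. Qed.
Lemma nmV x : nm x^-1 = (nm x)^-1.
Proof.
have [->|x0] := eqVneq x 0; first by rewrite invr0 nm0 invr0.
have nx0 : nm x != 0 by rewrite nm_eq0.
by apply: (mulfI nx0); rewrite -nmM !divff // nm1.
Qed.
Lemma nm_conj (x : C) : nm (Num.conj x) = nm x.
Proof. by apply: RtoC_inj; rewrite !nmE norm_conjC. Qed.
Lemma nm_real (x : R) : nm (RtoC x) = `|x|.
Proof. by rewrite /nm normc_def /= expr0n addr0 sqrtr_sqr. Qed.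
Lemma nm_i : nm ('i : C) = 1.
Proof. by apply: RtoC_inj; rewrite nmE normCi. Qed.
Lemma nm_sum (I : Type) (s : seq I) (P : pred I) (F : I -> C) :
  nm (\sum_(i <- s | P i) F i) <= \sum_(i <- s | P i) nm (F i).
Proof.
rewrite -RtoC_le nmE RtoC_sum.
under [X in _ <= X]eq_bigr do rewrite nmE.
exact: ler_norm_sum.
Qed.
Lemma nm_prod (I : Type) (s : seq I) (P : pred I) (F : I -> C) :
  nm (\prod_(i <- s | P i) F i) = \prod_(i <- s | P i) nm (F i).
Proof.
apply: (big_morph nm nmM nm1).
Qed.
Lemma nm_Re x : `|ReC x| <= nm x.
Proof.
rewrite -RtoC_le nmE; exact: normc_ge_Re.
Qed.
Lemma iE : ('i : C) = Complex 0 1.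
Proof. by []. Qed.
Lemma CE (x : C) : x = RtoC (ReC x) + 'i * RtoC (ImC x).
Proof.
case: x => a b; rewrite /RtoC /ReC /ImC iE /=.
apply/eqP; rewrite eq_complex /=; apply/andP; split; apply/eqP; ring.
Qed.
Lemma nm_Im x : `|ImC x| <= nm x.
Proof.
have -> : ImC x = - ReC ('i * x).
  case: x => a b; rewrite /ReC /ImC iE /=; ring.
by rewrite normrN (le_trans (nm_Re _)) // nmM nm_i mul1r.
Qed.
Lemma nm_le_ReIm x : nm x <= `|ReC x| + `|ImC x|.
Proof.
by rewrite {1}[x]CE (le_trans (nmD _ _)) // nmM nm_i mul1r !nm_real.
Qed.
Lemma nm_nat k : nm k%:R = k%:R.
Proof. by apply: RtoC_inj; rewrite nmE normr_nat /RtoC rmorph_nat. Qed.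

Lemma eq0_small (x : C) : (forall e : R, 0 < e -> nm x <= e) -> x = 0.
Proof.
move=> h; apply/eqP; rewrite -nm_eq0 eq_le nm_ge0 andbT leNgt; apply/negP => x0.
by have := h (nm x / 2) ltac:(lra); lra.
Qed.

Lemma ImCD (x y : C) : ImC (x + y) = ImC x + ImC y.
Proof. by case: x y => [? ?] [? ?]. Qed.
Lemma ReCD (x y : C) : ReC (x + y) = ReC x + ReC y.
Proof. by case: x y => [? ?] [? ?]. Qed.
Lemma conj_RtoC (t : R) : Num.conj (RtoC t) = RtoC t.
Proof. by apply: conj_Creal; rewrite complex_real. Qed.
Lemma conjE (x : C) : Num.conj x = Complex (ReC x) (- ImC x).
Proof.
rewrite {1}[x]CE rmorphD rmorphM /= conjCi !conj_RtoC.
apply/eqP; rewrite eq_complex /=; apply/andP; split; apply/eqP; rewrite /ReC /ImC /=; ring.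
Qed.
Lemma Im_real (x : C) : Num.conj x = x -> ImC x = 0.
Proof. by rewrite conjE => /(congr1 (@ImC R)) /=; rewrite /ImC /=; lra. Qed.

Section VN.
Variable n : nat.
Implicit Types h k : 'rV[C]_n.

(** The maximum norm, whose balls are polydiscs. *)
Definition vn h : R := \big[Num.max/0]_i nm (h 0 i).

Lemma vn_ge0 h : 0 <= vn h.
Proof. by rewrite /vn; elim/big_rec: _ => // i x _ hx; rewrite le_max hx orbT. Qed.
Lemma le_vn h i : nm (h 0 i) <= vn h.
Proof. by rewrite /vn (bigD1 i) //= le_max lexx. Qed.
Lemma vn_le h d : 0 <= d -> (forall i, nm (h 0 i) <= d) -> vn h <= d.
Proof.
move=> d0 H; rewrite /vn; elim/big_rec: _ => // i x _ hx.
by rewrite ge_max hx H.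
Qed.
Lemma vn0 : vn 0 = 0.
Proof.
apply/eqP; rewrite eq_le vn_ge0 andbT; apply: vn_le => // i.
by rewrite mxE nm0.
Qed.
Lemma vnD h k : vn (h + k) <= vn h + vn k.
Proof.
apply: vn_le => [|i]; first by rewrite addr_ge0 // vn_ge0.
by rewrite mxE (le_trans (nmD _ _)) // lerD // le_vn.
Qed.
Lemma vnN h : vn (- h) = vn h.
Proof. by rewrite /vn; apply: eq_bigr => i _; rewrite mxE nmN. Qed.
Lemma vnB h k : vn (h - k) <= vn h + vn k.
Proof. by rewrite -(vnN k) vnD. Qed.
Lemma vnBC h k : vn (h - k) = vn (k - h).
Proof. by rewrite -vnN opprB. Qed.
Lemma vnZ c h : vn (c *: h) <= nm c * vn h.
Proof.
apply: vn_le => [|i]; first by rewrite mulr_ge0 ?nm_ge0 ?vn_ge0.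
by rewrite mxE nmM ler_wpM2l ?nm_ge0 ?le_vn.
Qed.
Lemma vn_conj h : vn (map_mx Num.conj h) = vn h.
Proof. by rewrite /vn; apply: eq_bigr => i _; rewrite mxE nm_conj. Qed.
Lemma vn_eq0 h : vn h <= 0 -> h = 0.
Proof.
move=> h0; apply/rowP => i; rewrite mxE; apply/eqP; rewrite -nm_eq0 eq_le nm_ge0.
by rewrite andbT (le_trans (le_vn _ _)).
Qed.

End VN.

Lemma vn_row_mx m n (h : 'rV[C]_m) (k : 'rV[C]_n) d :
  vn h <= d -> vn k <= d -> vn (row_mx h k) <= d.
Proof.
move=> hd kd; apply: vn_le => [|i]; first by rewrite (le_trans _ hd) // vn_ge0.
by rewrite mxE; case: (fintype.split i) => j; rewrite (le_trans (le_vn _ _)).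
Qed.
Lemma vn_lsub m n (h : 'rV[C]_(m + n)) : vn (lsubmx h) <= vn h.
Proof. by apply: vn_le => [|i]; rewrite ?vn_ge0 // mxE le_vn. Qed.
Lemma vn_rsub m n (h : 'rV[C]_(m + n)) : vn (rsubmx h) <= vn h.
Proof. by apply: vn_le => [|i]; rewrite ?vn_ge0 // mxE le_vn. Qed.

End Modulus.

(** * Uniform limits of polynomials on polydiscs *)

Section Polys.
Variable R : realType.
Local Notation C := (Cplx R).

(** Polynomials as unordered lists of terms (coefficient, exponent), with
repetitions; only the value [peval] and the coefficients [pcoef] matter. *)
Definition poly_list n := seq (C * {ffun 'I_n -> nat}).
Definition peval n (s : poly_list n) (h : 'rV[C]_n) : C :=
  \sum_(p <- s) p.1 * monomial h p.2.

Lemma peval_cat n (s t : poly_list n) h : peval (s ++ t) h = peval s h + peval t h.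
Proof. by rewrite /peval big_cat. Qed.
Definition pneg n (s : poly_list n) : poly_list n := [seq (- p.1, p.2) | p <- s].
Lemma peval_neg n (s : poly_list n) h : peval (pneg s) h = - peval s h.
Proof. by rewrite /peval /pneg big_map /= -sumrN; apply: eq_bigr => p _; rewrite mulNr. Qed.
Definition pmul n (s t : poly_list n) : poly_list n :=
  [seq (p.1 * q.1, [ffun i => (p.2 i + q.2 i)%N]) |
     p : C * {ffun 'I_n -> nat} <- s, q : C * {ffun 'I_n -> nat} <- t].
Lemma monomialD n (h : 'rV[C]_n) (a b : {ffun 'I_n -> nat}) :
  monomial h [ffun i => (a i + b i)%N] = monomial h a * monomial h b.
Proof.
by rewrite /monomial -big_split /=; apply: eq_bigr => i _; rewrite ffunE exprD.
Qed.
Lemma peval_mul n (s t : poly_list n) h : peval (pmul s t) h = peval s h * peval t h.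
Proof.
rewrite /peval /pmul big_allpairs_dep /= mulr_suml; apply: eq_bigr => p _.
rewrite mulr_sumr; apply: eq_bigr => q _ /=; rewrite monomialD; ring.
Qed.
Definition pcst n (c : C) : poly_list n := [:: (c, [ffun=> 0%N])].
Lemma peval_cst n c (h : 'rV[C]_n) : peval (pcst n c) h = c.
Proof.
rewrite /peval /pcst big_seq1 /= /monomial big1 ?mulr1 // => i _.
by rewrite ffunE expr0.
Qed.
Definition pX n (i : 'I_n) : poly_list n := [:: (1, [ffun j => (j == i : nat)])].
Lemma peval_X n i (h : 'rV[C]_n) : peval (pX i) h = h 0 i.
Proof.
rewrite /peval /pX big_seq1 /= mul1r /monomial (bigD1 i) //= ffunE eqxx expr1.
rewrite big1 ?mulr1 // => j /negbTE; rewrite ffunE => ->.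
by rewrite expr0.
Qed.

(** The uniform limits of polynomials on the closed polydisc of radius r.
Such functions are sums of convergent power series and conversely, with a loss
of radius, by [apx_ps] and [ps_apx]. *)
Definition apx n (r : R) (f : 'rV[C]_n -> C) : Prop :=
  forall e : R, 0 < e -> exists s : poly_list n,
    forall h, vn h <= r -> nm (f h - peval s h) <= e.

Lemma apx_peval n r (s : poly_list n) : apx r (peval s).
Proof. by move=> e e0; exists s => h _; rewrite subrr nm0 ltW. Qed.
Lemma apx_ext n r (f g : 'rV[C]_n -> C) :
  apx r f -> (forall h, vn h <= r -> f h = g h) -> apx r g.
Proof.
move=> hf fg e /hf[s hs]; exists s => h hr; rewrite -fg //; exact: hs.
Qed.
Lemma apx_cst n r (c : C) : apx r (fun _ : 'rV[C]_n => c).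
Proof. by apply: (apx_ext (apx_peval r (pcst n c))) => h _; rewrite peval_cst. Qed.
Lemma apx_X n r i : apx r (fun h : 'rV[C]_n => h 0 i).
Proof. by apply: (apx_ext (apx_peval r (pX i))) => h _; rewrite peval_X. Qed.
Lemma apx_le n r r' (f : 'rV[C]_n -> C) : r' <= r -> apx r f -> apx r' f.
Proof.
move=> rr hf e /hf[s hs]; exists s => h hr; apply: hs; exact: le_trans hr rr.
Qed.

Lemma monomial_bd n (h : 'rV[C]_n) m r : vn h <= r ->
  nm (monomial h m) <= r ^+ mdegree m.
Proof.
move=> hr; rewrite /monomial nm_prod /mdegree expr_sum.
apply: ler_prod => i _; rewrite nm_ge0 /= nmX lerXn2r ?nnegrE ?nm_ge0 //.
  by rewrite (le_trans (vn_ge0 h)).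
by rewrite (le_trans (le_vn _ _)).
Qed.

Lemma peval_bd n r (s : poly_list n) : exists2 B : R, 0 < B &
  forall h, vn h <= r -> nm (peval s h) <= B.
Proof.
exists (1 + \sum_(p <- s) nm p.1 * `|r| ^+ mdegree p.2).
  rewrite ltr_pwDl // sumr_ge0 // => p _.
  by rewrite mulr_ge0 ?nm_ge0 ?exprn_ge0.
move=> h hr; rewrite ler_wpDl // (le_trans (nm_sum _ _ _)) // ler_sum // => p _.
rewrite nmM ler_wpM2l ?nm_ge0 // monomial_bd // (le_trans hr) //.
exact: ler_norm.
Qed.

Lemma apx_bd n r (f : 'rV[C]_n -> C) : apx r f ->
  exists2 B : R, 0 < B & forall h, vn h <= r -> nm (f h) <= B.
Proof.
move=> /(_ 1 ltr01)[s hs]; have [B B0 hB] := peval_bd r s.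
exists (B + 1); first by lra.
move=> h hr; have -> : f h = peval s h + (f h - peval s h) by ring.
by rewrite (le_trans (nmD _ _)) // lerD // ?hB // hs.
Qed.

Lemma apxD n r (f g : 'rV[C]_n -> C) : apx r f -> apx r g ->
  apx r (fun h => f h + g h).
Proof.
move=> hf hg e e0; have [s hs] := hf (e / 2) ltac:(lra).
have [t ht] := hg (e / 2) ltac:(lra); exists (s ++ t) => h hr.
have -> : f h + g h - peval (s ++ t) h = (f h - peval s h) + (g h - peval t h).
  by rewrite peval_cat; ring.
by rewrite (le_trans (nmD _ _)) //; have := hs h hr; have := ht h hr; lra.
Qed.

Lemma apxM n r (f g : 'rV[C]_n -> C) : apx r f -> apx r g ->
  apx r (fun h => f h * g h).
Proof.
move=> hf hg e e0; have [B B0 hB] := apx_bd hf.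
have [t ht] := hg (e / 2 / B) ltac:(by rewrite !divr_gt0).
have [B' B'0 hB'] := peval_bd r t.
have [s hs] := hf (e / 2 / B') ltac:(by rewrite !divr_gt0).
exists (pmul s t) => h hr.
have -> : f h * g h - peval (pmul s t) h =
  f h * (g h - peval t h) + (f h - peval s h) * peval t h.
  by rewrite peval_mul; ring.
rewrite (le_trans (nmD _ _)) // !nmM.
have -> : e = B * (e / 2 / B) + (e / 2 / B') * B'.
  by rewrite mulrC !divfK ?gt_eqF // -splitr.
by rewrite lerD // ler_pM ?nm_ge0 ?hB ?hs ?ht ?hB'.
Qed.

Lemma apxN n r (f : 'rV[C]_n -> C) : apx r f -> apx r (fun h => - f h).
Proof.
move=> hf; apply: (apx_ext (apxM (apx_cst _ r (-1)) hf)) => h _; ring.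
Qed.
Lemma apxB n r (f g : 'rV[C]_n -> C) : apx r f -> apx r g ->
  apx r (fun h => f h - g h).
Proof. by move=> hf hg; apply: apxD => //; exact: apxN. Qed.
Lemma apxX n r (f : 'rV[C]_n -> C) k : apx r f -> apx r (fun h => f h ^+ k).
Proof.
move=> hf; elim: k => [|k IH].
  by apply: (apx_ext (apx_cst _ r 1)) => h _; rewrite expr0.
by apply: (apx_ext (apxM hf IH)) => h _; rewrite exprS.
Qed.
Lemma apx_sum n r (I : Type) (s : seq I) (P : pred I) (F : I -> 'rV[C]_n -> C) :
  (forall i, P i -> apx r (F i)) -> apx r (fun h => \sum_(i <- s | P i) F i h).
Proof.
move=> hF; elim: s => [|i s IH].
  by apply: (apx_ext (apx_cst _ r 0)) => h _; rewrite big_nil.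
case Pi: (P i).
  by apply: (apx_ext (apxD (hF _ Pi) IH)) => h _; rewrite big_cons Pi.
by apply: (apx_ext IH) => h _; rewrite big_cons Pi.
Qed.
Lemma apx_prod n r (I : Type) (s : seq I) (P : pred I) (F : I -> 'rV[C]_n -> C) :
  (forall i, P i -> apx r (F i)) -> apx r (fun h => \prod_(i <- s | P i) F i h).
Proof.
move=> hF; elim: s => [|i s IH].
  by apply: (apx_ext (apx_cst _ r 1)) => h _; rewrite big_nil.
case Pi: (P i).
  by apply: (apx_ext (apxM (hF _ Pi) IH)) => h _; rewrite big_cons Pi.
by apply: (apx_ext IH) => h _; rewrite big_cons Pi.
Qed.

Lemma apx_comp n m r r' (f : 'rV[C]_n -> C) (g : 'rV[C]_m -> 'rV[C]_n) :
  apx r f -> (forall i, apx r' (fun h => g h 0 i)) ->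
  (forall h, vn h <= r' -> vn (g h) <= r) -> apx r' (fun h => f (g h)).
Proof.
move=> hf hg gr e e0; have [s hs] := hf (e / 2) ltac:(lra).
have : apx r' (fun h => peval s (g h)).
  apply: apx_sum => p _; apply: apxM; first exact: apx_cst.
  by apply: apx_prod => i _; exact: apxX.
move=> /(_ (e / 2) ltac:(lra))[t ht]; exists t => h hr.
rewrite (le_trans (nmB3 (peval s (g h)) _ _)) //.
by have := hs _ (gr _ hr); have := ht h hr; lra.
Qed.

Lemma apx_conj n r (f : 'rV[C]_n -> C) : apx r f ->
  apx r (fun h => Num.conj (f (map_mx Num.conj h))).
Proof.
move=> hf e /hf[s hs]; exists [seq (Num.conj p.1, p.2) | p <- s] => h hr.
have -> : peval [seq (Num.conj p.1, p.2) | p <- s] h =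
  Num.conj (peval s (map_mx Num.conj h)).
  rewrite /peval rmorph_sum big_map; apply: eq_bigr => p _ /=.
  rewrite rmorphM /monomial rmorph_prod; congr (_ * _).
  by apply: eq_bigr => i _; rewrite rmorphXn /= mxE conjCK.
by rewrite -rmorphB nm_conj hs // vn_conj.
Qed.

End Polys.

(** * Cauchy's inequality and division by a coordinate *)

Section Coefficients.
Variable R : realType.
Local Notation C := (Cplx R).
Local Notation half := (2^-1 : R).

Lemma half_ge0 k : 0 <= half ^+ k. Proof. by rewrite exprn_ge0 // invr_ge0. Qed.
Lemma half_gt0 k : 0 < half ^+ k. Proof. by rewrite exprn_gt0 // invr_gt0. Qed.
Lemma halfS k : half ^+ k = half ^+ k.+1 + half ^+ k.+1.
Proof. by rewrite exprS; lra. Qed.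

Lemma half_small (c e : R) : 0 < e -> exists k, c * half ^+ k <= e.
Proof.
move=> e0; have [c0|c0] := leP c 0.
  by exists 0%N; rewrite expr0 mulr1 (le_trans c0) // ltW.
pose m := Num.Def.archi_bound (c / e); exists m.
have hm : c / e < m%:R by apply: archi_boundP; rewrite divr_ge0 // ltW.
have h2 : m%:R <= 2 ^+ m :> R by rewrite -natrX ler_nat ltnW // ltn_expl.
rewrite exprVn ler_pdivrMr ?exprn_gt0 // mulrC -ler_pdivrMr //.
by rewrite (le_trans (ltW hm)).
Qed.

Lemma le_half_lim (x y c : R) : (forall k, x <= y + c * half ^+ k) -> x <= y.
Proof.
move=> h; rewrite leNgt; apply/negP => xy.
have [k hk] := half_small c (e := (x - y) / 2) ltac:(lra).
by have := h k; lra.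
Qed.

Lemma cauchyR (a : nat -> R) (c : R) :
  (forall k, `|a k - a k.+1| <= c * half ^+ k) ->
  exists l, forall k, `|a k - l| <= 2 * c * half ^+ k.
Proof.
move=> h.
have c0 : 0 <= c by have := h 0%N; rewrite expr0 mulr1; apply: le_trans.
have up k j : a (k + j)%N <= a k + 2 * c * (half ^+ k - half ^+ (k + j)) /\
              a k - 2 * c * (half ^+ k - half ^+ (k + j)) <= a (k + j)%N.
  elim: j => [|j [IH1 IH2]]; first by rewrite addn0; lra.
  have := h (k + j)%N; rewrite ler_norml addnS => /andP[h1 h2].
  have e := halfS (k + j).
  have e' : c * half ^+ (k + j) = c * half ^+ (k + j).+1 + c * half ^+ (k + j).+1.
    by rewrite e mulrDr.
  by lra.
pose S := [set a k - 2 * c * half ^+ k | k in @setT nat].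
have ub k : ubound S (a k + 2 * c * half ^+ k).
  move=> _ [j _ <-].
  have pos i : 0 <= c * half ^+ i by rewrite mulr_ge0 ?half_ge0.
  have [kj|/ltnW jk] := leqP k j.
    by have := (up k (j - k)%N).1; rewrite subnKC //; have := pos j; have := pos k; nra.
  by have := (up j (k - j)%N).2; rewrite subnKC //; have := pos j; have := pos k; nra.
have hS : has_sup S.
  by split; [exists (a 0%N - 2 * c * half ^+ 0); exists 0%N | exists (a 0%N + 2 * c * half ^+ 0)].
exists (sup S) => k; rewrite ler_norml; apply/andP; split.
  have : sup S <= a k + 2 * c * half ^+ k by apply: ge_sup => //; exact: hS.1.
  by lra.
have : a k - 2 * c * half ^+ k <= sup S.
  by apply: sup_upper_bound => //; exists k.
by lra.
Qed.

Lemma cauchyC (a : nat -> C) (c : R) :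
  (forall k, nm (a k - a k.+1) <= c * half ^+ k) ->
  exists l, forall k, nm (a k - l) <= 4 * c * half ^+ k.
Proof.
move=> h.
have ReB (x y : C) : ReC (x - y) = ReC x - ReC y by case: x y => [? ?] [? ?].
have ImB (x y : C) : ImC (x - y) = ImC x - ImC y by case: x y => [? ?] [? ?].
have [l1 h1] : exists l, forall k, `|ReC (a k) - l| <= 2 * c * half ^+ k.
  by apply: cauchyR => k; rewrite -ReB (le_trans (nm_Re _)).
have [l2 h2] : exists l, forall k, `|ImC (a k) - l| <= 2 * c * half ^+ k.
  by apply: cauchyR => k; rewrite -ImB (le_trans (nm_Im _)).
exists (Complex l1 l2) => k; rewrite (le_trans (nm_le_ReIm _)) // ReB ImB /=.
by have := h1 k; have := h2 k; rewrite /ReC /ImC /=; lra.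
Qed.

(** Geometric convergence yields an explicit error bound for the
limit, which is what the constructions below consume. *)
Lemma uniform_limit n r (f : nat -> 'rV[C]_n -> C) c :
  (forall k, apx r (f k)) ->
  (forall k h, vn h <= r -> nm (f k h - f k.+1 h) <= c * half ^+ k) ->
  exists g, apx r g /\
    forall k h, vn h <= r -> nm (f k h - g h) <= 4 * c * half ^+ k.
Proof.
move=> hf hc.
have /choice[g hg] : forall h : 'rV[C]_n, exists l,
    vn h <= r -> forall k, nm (f k h - l) <= 4 * c * half ^+ k.
  move=> h; have [hr|_] := boolP (vn h <= r); last by exists 0.
  have [l hl] := cauchyC (fun k => hc k h hr).
  by exists l.
exists g; split=> [e e0|k h hr]; last exact: hg.
have [k hk] := half_small (4 * c) (e := e / 2) ltac:(lra).
have [s hs] := hf k (e / 2) ltac:(lra).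
exists s => h hr; rewrite (le_trans (nmB3 (f k h) _ _)) // nmBC.
by have := hg h hr k; have := hs h hr; lra.
Qed.

(** The N roots of X^N - 1 are distinct. *)
Lemma primitive_root_exists N : (0 < N)%N -> exists w : C, N.-primitive_root w.
Proof.
move=> N0; pose p : {poly C} := 'X^N - 1.
have [rs hrs] := closed_field_poly_normal p.
have lp : lead_coef p = 1 by rewrite lead_coefXnsubC.
move: hrs; rewrite lp scale1r => hrs.
have urs : uniq rs.
  rewrite -separable_prod_XsubC -hrs; apply: separable_Xn_sub_1.
  by rewrite pnatr_eq0 -lt0n.
have srs : size rs = N.
  by have := size_prod_XsubC rs id; rewrite -hrs size_XnsubC // => -[].
have : has N.-primitive_root rs.
  apply: has_prim_root => //; last by rewrite srs.
  apply/allP => x xrs.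
  by rewrite -[N.-unity_root x]/(root p x) hrs root_prod_XsubC.
by move=> /hasP[w _ hw]; exists w.
Qed.

Definition pcoef n (s : poly_list R n) (m : {ffun 'I_n -> nat}) : C :=
  \sum_(p <- s | p.2 == m) p.1.

Lemma pcoef_cat n (s t : poly_list R n) m : pcoef (s ++ t) m = pcoef s m + pcoef t m.
Proof. by rewrite /pcoef big_cat. Qed.
Lemma pcoef_neg n (s : poly_list R n) m : pcoef (pneg s) m = - pcoef s m.
Proof. by rewrite /pcoef /pneg big_map /= -sumrN. Qed.

(** Orthogonality of the characters of Z/N. *)
Lemma root_sum N (w : C) (a b : nat) : N.-primitive_root w ->
  (a < N)%N -> (b < N)%N ->
  \sum_(t < N) w ^+ (t * a) / w ^+ (t * b) = (N * (a == b))%:R.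
Proof.
move=> hw aN bN; have N0 : (0 < N)%N by exact: leq_ltn_trans aN.
have w0 : w != 0 by rewrite (prim_root_eq0 hw) -lt0n.
have [->|ab] := eqVneq a b.
  rewrite muln1; under eq_bigr => t _ do rewrite divff ?expf_neq0 //.
  by rewrite sumr_const card_ord.
rewrite muln0; set x := w ^+ a / w ^+ b.
have -> : \sum_(t < N) w ^+ (t * a) / w ^+ (t * b) = \sum_(t < N) x ^+ t.
  by apply: eq_bigr => t _; rewrite /x exprMn exprVn -!exprM !(mulnC t).
have x1 : x - 1 != 0.
  rewrite subr_eq0; apply/eqP => /(congr1 (fun y => y * w ^+ b)).
  rewrite /x divfK ?expf_neq0 // mul1r => /eqP.
  by rewrite (eq_prim_root_expr hw) !modn_small // (negbTE ab).
have xN : x ^+ N = 1.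
  by rewrite /x exprMn exprVn -!exprM !(mulnC _ N) !exprM (prim_expr_order hw) !expr1n divr1.
by apply: (mulfI x1); rewrite mulr0 -subrX1 xN subrr.
Qed.

Lemma nm_root N (w : C) : N.-primitive_root w -> nm w = 1.
Proof.
move=> hw; have N0 := prim_order_gt0 hw.
have : nm w ^+ N = 1 by rewrite -nmX (prim_expr_order hw) nm1.
by move=> /eqP; rewrite pexpr_eq1 // ?nm_ge0 // => /eqP.
Qed.

(** Cauchy's inequality without integrals. Average s (pt) / pt^m
over the points pt whose coordinates are r times N-th roots of unity: when N
exceeds all the exponents involved, only the coefficient of exponent m is left. *)
Lemma cauchy_estimate n r (s : poly_list R n) B : 0 <= r ->
  (forall h, vn h <= r -> nm (peval s h) <= B) ->
  forall m, nm (pcoef s m) * r ^+ mdegree m <= B.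
Proof.
move=> r0 hB m.
(* N exceeds the exponents of m and of all the terms of s *)
pose N := (1 + \sum_i m i + \sum_(p <- s) \sum_i p.2 i)%N.
have N0 : (0 < N)%N by rewrite /N -addnA.
have mN i : (m i < N)%N.
  by rewrite /N -addnA add1n ltnS (bigD1 i) //= -!addnA leq_addr.
have pN p i : p \in s -> (p.2 i < N)%N.
  move=> ps; rewrite /N (big_rem p) //=.
  have : (p.2 i <= \sum_j p.2 j)%N by rewrite (bigD1 i) //= leq_addr.
  move=> h1; rewrite add1n addSn ltnS; apply: leq_trans (leq_addl _ _).
  exact: leq_trans h1 (leq_addr _ _).
have [w hw] := primitive_root_exists N0.
have w0 : w != 0 by rewrite (prim_root_eq0 hw) -lt0n.
pose pt (j : {ffun 'I_n -> 'I_N}) : 'rV[C]_n := \row_i (RtoC r * w ^+ j i).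
have ptr j : vn (pt j) <= r.
  apply: vn_le => // i; rewrite mxE nmM nmX (nm_root hw) expr1n mulr1 nm_real.
  by rewrite ger0_norm.
pose ch (j : {ffun 'I_n -> 'I_N}) := \prod_i (w ^+ (j i * m i))^-1.
have nch j : nm (ch j) = 1.
  rewrite /ch nm_prod big1 // => i _.
  by rewrite nmV nmX (nm_root hw) expr1n invr1.
have key : \sum_j peval s (pt j) * ch j =
    (N%:R ^+ n) * (pcoef s m * RtoC r ^+ mdegree m).
  transitivity (\sum_(p <- s) p.1 * \sum_j monomial (pt j) p.2 * ch j).
    under eq_bigr => j _ do rewrite /peval mulr_suml.
    rewrite exchange_big /=; apply: eq_bigr => p _; rewrite mulr_sumr.
    by apply: eq_bigr => j _; rewrite mulrA.
  have E p : p \in s -> \sum_j monomial (pt j) p.2 * ch j =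
     (N%:R ^+ n * RtoC r ^+ mdegree m) * (p.2 == m)%:R.
    move=> ps.
    transitivity (\prod_(i < n) \sum_(t < N)
      (RtoC r ^+ p.2 i * (w ^+ (t * p.2 i) / w ^+ (t * m i)))).
      rewrite bigA_distr_bigA /=; apply: eq_bigr => j _.
      rewrite /monomial /ch -big_split /=; apply: eq_bigr => i _.
      by rewrite mxE exprMn -exprM mulrA.
    under eq_bigr => i _.
      rewrite -mulr_sumr (root_sum hw (pN _ i ps) (mN i)) natrM mulrCA; over.
    rewrite big_split /= prodr_const card_ord -mulrA; congr (_ * _).
    have [<-|pm] := eqVneq p.2 m.
      under eq_bigr do rewrite eqxx mulr1.
      by rewrite mulr1 /mdegree expr_sum.
    rewrite mulr0; have /existsP[i hi] : [exists i, p.2 i != m i].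
      rewrite -negb_forall; apply: contra pm => /forallP hh.
      by apply/eqP/ffunP => i; exact/eqP/hh.
    by rewrite (bigD1 i) //= (negbTE hi) mulr0 mul0r.
  rewrite big_seq (eq_bigr _ (fun p ps => congr1 (fun x => p.1 * x) (E p ps))) -big_seq.
  under eq_bigr do rewrite mulrCA.
  rewrite -mulr_sumr /pcoef -mulrA; congr (_ * _); rewrite mulrC; congr (_ * _).
  rewrite [RHS]big_mkcond /=; apply: eq_bigr => p _.
  by case: eqP; rewrite ?mulr1 ?mulr0.
have NN : 0 < N%:R ^+ n :> R by rewrite exprn_gt0 // ltr0n.
rewrite -(ler_pM2l NN).
have -> : N%:R ^+ n * (nm (pcoef s m) * r ^+ mdegree m) =
   nm (\sum_j peval s (pt j) * ch j).
  by rewrite key !nmM !nmX nm_nat nm_real ger0_norm.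
rewrite (le_trans (nm_sum _ _ _)) //.
apply: (@le_trans _ _ (\sum_(j : {ffun 'I_n -> 'I_N}) B)).
  by apply: ler_sum => j _; rewrite nmM nch mulr1; exact: hB.
by rewrite sumr_const card_ffun !card_ord -[_ *+ _]mulr_natl natrX.
Qed.

Lemma peval_box n (s : poly_list R n) : exists N0, forall N h, (N0 <= N)%N ->
  peval s h = \sum_(b : {ffun 'I_n -> 'I_N}) pcoef s (box_index b) * monomial h (box_index b).
Proof.
exists (1 + \sum_(p <- s) \sum_i p.2 i)%N => N h NN.
have pN p i : p \in s -> (p.2 i < N)%N.
  move=> ps; apply: leq_trans NN; rewrite add1n ltnS (big_rem p) //= (bigD1 i) //=.
  by rewrite -!addnA leq_addr.
under [RHS]eq_bigr => b _ do rewrite /pcoef mulr_suml big_mkcond.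
rewrite exchange_big /= /peval; apply: eq_big_seq => p ps.
have pb : p.2 = box_index [ffun i => Ordinal (pN p i ps)].
  by apply/ffunP => i; rewrite !ffunE.
rewrite (bigD1 [ffun i => Ordinal (pN p i ps)]) //= -pb eqxx big1 ?addr0 // => b bp.
case: eqP => // e; case/eqP: bp; apply/ffunP => i; rewrite ffunE.
by apply: val_inj; rewrite /= e ffunE.
Qed.

Lemma half_geo N : \sum_(t < N) half ^+ t <= 2.
Proof.
suff -> : \sum_(t < N) half ^+ t = 2 - 2 * half ^+ N.
  by have := half_ge0 N; lra.
elim: N => [|N IH]; first by rewrite big_ord0 expr0; lra.
by rewrite big_ord_recr /= IH (halfS N); lra.
Qed.

Lemma box_geo n N :
  \sum_(b : {ffun 'I_n -> 'I_N}) half ^+ mdegree (box_index b) <= 2 ^+ n.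
Proof.
have -> : \sum_(b : {ffun 'I_n -> 'I_N}) half ^+ mdegree (box_index b) =
  \prod_(i < n) \sum_(t < N) half ^+ t.
  rewrite bigA_distr_bigA; apply: eq_bigr => b _; rewrite /mdegree expr_sum.
  by apply: eq_bigr => i _; rewrite ffunE.
rewrite prodr_const card_ord lerXn2r ?nnegrE ?half_geo //.
by rewrite sumr_ge0 // => t _; exact: half_ge0.
Qed.

Lemma term_bd r B (x : C) n (m : {ffun 'I_n -> nat}) h :
  0 < r -> nm x * r ^+ mdegree m <= B -> vn h <= r / 2 ->
  nm (x * monomial h m) <= B * half ^+ mdegree m.
Proof.
move=> r0 xB hr; rewrite nmM.
rewrite (le_trans (ler_wpM2l (nm_ge0 x) (monomial_bd m hr))) //.
by rewrite exprMn mulrA ler_wpM2r ?half_ge0.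
Qed.

Lemma box_bd n r B (a : {ffun 'I_n -> nat} -> C) N h : 0 < r ->
  (forall m, nm (a m) * r ^+ mdegree m <= B) -> vn h <= r / 2 ->
  \sum_(b : {ffun 'I_n -> 'I_N}) nm (a (box_index b) * monomial h (box_index b))
    <= B * 2 ^+ n.
Proof.
move=> r0 aB hr.
have B0 : 0 <= B.
  by rewrite (le_trans _ (aB [ffun=> 0%N])) // mulr_ge0 ?nm_ge0 ?exprn_ge0 // ltW.
rewrite (le_trans _ (ler_wpM2l B0 (box_geo n N))) // mulr_sumr ler_sum // => b _.
exact: term_bd (aB _) hr.
Qed.

Lemma peval_coef_bd n r B (s : poly_list R n) h : 0 < r ->
  (forall m, nm (pcoef s m) * r ^+ mdegree m <= B) -> vn h <= r / 2 ->
  nm (peval s h) <= B * 2 ^+ n.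
Proof.
move=> r0 aB hr; have [N0 hN] := peval_box s.
rewrite (hN N0) // (le_trans (nm_sum _ _ _)) //; exact: box_bd aB hr.
Qed.

Definition zero_at n (i : 'I_n) (h : 'rV[C]_n) : 'rV[C]_n :=
  \row_j (if j == i then 0 else h 0 j).
(** The quotient by the i-th variable of the terms that it divides. *)
Definition pdivX n (i : 'I_n) (s : poly_list R n) : poly_list R n :=
  map (fun p : C * {ffun 'I_n -> nat} => (p.1, [ffun j => (p.2 j - (j == i))%N]))
    (seq.filter (fun p : C * {ffun 'I_n -> nat} => (0 < p.2 i)%N) s).

Lemma pdivX_cat n i (s t : poly_list R n) : pdivX i (s ++ t) = pdivX i s ++ pdivX i t.
Proof. by rewrite /pdivX filter_cat map_cat. Qed.
Lemma pdivX_neg n i (s : poly_list R n) : pdivX i (pneg s) = pneg (pdivX i s).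
Proof. by rewrite /pdivX /pneg filter_map -!map_comp. Qed.

Lemma peval_div n i (s : poly_list R n) h :
  peval s h = peval s (zero_at i h) + h 0 i * peval (pdivX i s) h.
Proof.
rewrite /peval /pdivX big_map big_filter mulr_sumr [X in _ + X]big_mkcond /= -big_split /=.
apply: eq_bigr => p _.
have E (g : 'rV[C]_n) : monomial g p.2 = g 0 i ^+ p.2 i * \prod_(j | j != i) g 0 j ^+ p.2 j.
  by rewrite /monomial (bigD1 i).
have Z : \prod_(j | j != i) (zero_at i h) 0 j ^+ p.2 j = \prod_(j | j != i) h 0 j ^+ p.2 j.
  by apply: eq_bigr => j /negbTE ji; rewrite mxE ji.
have -> : monomial h [ffun j => (p.2 j - (j == i))%N] =
    h 0 i ^+ (p.2 i - 1) * \prod_(j | j != i) h 0 j ^+ p.2 j.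
  rewrite /monomial (bigD1 i) //= ffunE eqxx; congr (_ * _).
  by apply: eq_bigr => j /negbTE ji; rewrite ffunE ji subn0.
rewrite !E Z mxE eqxx.
case: (p.2 i) => [|k] /=; first by rewrite addr0 !expr0.
by rewrite expr0n /= mul0r mulr0 add0r subn1 /= exprS; ring.
Qed.

Lemma pcoef_div n i (s : poly_list R n) m :
  pcoef (pdivX i s) m = pcoef s [ffun j => (m j + (j == i))%N].
Proof.
rewrite /pcoef /pdivX big_map big_filter_cond /=; apply: eq_bigl => p.
apply/andP/eqP => [[p0 /eqP <-]|->].
  apply/ffunP => j; rewrite !ffunE; case: eqP => [->|_]; last by rewrite subn0 addn0.
  by rewrite subnK.
rewrite ffunE eqxx addn1; split=> //.
by apply/eqP/ffunP => j; rewrite !ffunE addnK.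
Qed.

Lemma mdegree_incr n i (m : {ffun 'I_n -> nat}) :
  mdegree [ffun j => (m j + (j == i))%N] = (mdegree m).+1.
Proof.
rewrite /mdegree; under eq_bigr do rewrite ffunE.
rewrite big_split /=; have -> : \sum_(j < n) (j == i : nat) = 1%N.
  by rewrite (bigD1 i) //= eqxx big1 ?addn0 // => j /negbTE ->.
by rewrite addn1.
Qed.

(** The coefficients of the quotient are among those of s, so Cauchy's
inequality bounds them; halving the radius makes their sum geometric. *)
Lemma pdivX_bd n r i (s : poly_list R n) B : 0 < r ->
  (forall h, vn h <= r -> nm (peval s h) <= B) ->
  forall h, vn h <= r / 2 -> nm (peval (pdivX i s) h) <= B / r * 2 ^+ n.
Proof.
move=> r0 hB h hr; apply: peval_coef_bd hr => // m.
rewrite pcoef_div ler_pdivlMr // -mulrA -exprSr -(mdegree_incr i).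
exact: cauchy_estimate (ltW r0) hB _.
Qed.

Lemma apx_seq n r (f : 'rV[C]_n -> C) : apx r f ->
  exists s : nat -> poly_list R n, forall k h, vn h <= r ->
    nm (f h - peval (s k) h) <= half ^+ k.
Proof.
move=> hf.
have /choice[s hs] k := hf _ (half_gt0 k).
by exists s.
Qed.

Lemma apx_seq_diff n r (f : 'rV[C]_n -> C) (s : nat -> poly_list R n) :
  (forall k h, vn h <= r -> nm (f h - peval (s k) h) <= half ^+ k) ->
  forall k h, vn h <= r -> nm (peval (s k ++ pneg (s k.+1)) h) <= 2 * half ^+ k.
Proof.
move=> hs k h hr; rewrite peval_cat peval_neg (le_trans (nmB3 (f h) _ _)) // nmBC.
by have := hs k h hr; have := hs k.+1 h hr; rewrite (halfS k); have := half_ge0 k.+1; lra.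
Qed.

(** Division is continuous for uniform convergence, by [pdivX_bd] applied to
the differences of successive approximations. *)
Lemma apx_div n r i (f : 'rV[C]_n -> C) : 0 < r -> apx r f ->
  exists g, apx (r / 2) g /\
    forall h, vn h <= r / 2 -> f h = f (zero_at i h) + h 0 i * g h.
Proof.
move=> r0 /apx_seq[s hs].
pose c := 2 / r * 2 ^+ n.
have [g [hg hgs]] : exists g, apx (r / 2) g /\
    forall k h, vn h <= r / 2 -> nm (peval (pdivX i (s k)) h - g h) <= 4 * c * half ^+ k.
  apply: uniform_limit => [k|k h hr]; first exact: apx_peval.
  have := pdivX_bd i r0 (apx_seq_diff hs k) hr.
  rewrite pdivX_cat pdivX_neg peval_cat peval_neg /c => /le_trans; apply.
  by rewrite le_eqVlt; apply/orP; left; apply/eqP; field; lra.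
exists g; split=> // h hr.
have hr' : vn h <= r by lra.
have zr' : vn (zero_at i h) <= r.
  apply: vn_le => [|j]; first lra.
  rewrite mxE; case: eqP => _; first by rewrite nm0 ltW.
  by rewrite (le_trans (le_vn _ _)).
apply/eqP; rewrite -subr_eq0; apply/eqP; apply: eq0_small => e e0.
have c0 : 0 <= c by rewrite /c mulr_ge0 ?divr_ge0 ?exprn_ge0 // ltW.
have [k hk] := half_small (2 + r * (4 * c)) e0.
apply: le_trans hk.
have -> : f h - (f (zero_at i h) + h 0 i * g h) =
  (f h - peval (s k) h) - (f (zero_at i h) - peval (s k) (zero_at i h)) +
  h 0 i * (peval (pdivX i (s k)) h - g h).
  by rewrite (peval_div i (s k) h); ring.
rewrite (le_trans (nmD _ _)) // nmM mulrDl lerD //.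
  by rewrite (le_trans (nmB _ _)) //; have := hs k h hr'; have := hs k _ zr'; lra.
rewrite -mulrA ler_pM ?nm_ge0 ?(le_trans (le_vn _ _)) //.
exact: hgs.
Qed.

End Coefficients.

(** * Neighbourhoods and limits in terms of the norms *)

Section Neighbourhoods.
Variable R : realType.
Local Notation C := (Cplx R).

Lemma nbhsC n (p : 'rV[C]_n) (P : 'rV[C]_n -> Prop) :
  (\forall q \near p, P q) <-> exists2 r : R, 0 < r & forall q, vn (q - p) <= r -> P q.
Proof.
split=> [/nbhs_ballP[e /= e0 he]|[r r0 hr]].
  have er : e = RtoC (ReC e).
    by rewrite /RtoC /ReC RRe_real // gtr0_real.
  have r0 : 0 < ReC e by rewrite -RtoC_lt -er.
  exists (ReC e / 2) => [|q hq]; first lra.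
  apply: he; split=> // i j; rewrite ord1 /ball /= -nmE er RtoC_lt nmBC.
  by have := le_vn (q - p) j; rewrite !mxE; lra.
apply/nbhs_ballP; exists (RtoC r) => /=; first by rewrite -RtoC0 RtoC_lt.
move=> q hq; apply: hr; apply: vn_le => [|i]; first exact: ltW.
by case: hq => _ /(_ 0 i); rewrite /ball /= -nmE RtoC_lt nmBC !mxE => /ltW.
Qed.

Definition cx n (t : 'rV[R]_n) : 'rV[C]_n := map_mx (@RtoC R) t.

Lemma nbhsR n (p : 'rV[R]_n) (P : 'rV[R]_n -> Prop) :
  (\forall q \near p, P q) <->
  exists2 r : R, 0 < r & forall q, vn (cx (q - p)) <= r -> P q.
Proof.
split=> [/nbhs_ballP[e /= e0 he]|[r r0 hr]].
  exists (e / 2) => [|q hq]; first lra.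
  apply: he; split=> // i j; rewrite ord1 /ball /= distrC.
  have := le_vn (cx (q - p)) j; rewrite !mxE nm_real => h.
  by rewrite (le_lt_trans (le_trans h hq)) //; lra.
apply/nbhs_ballP; exists r => // q hq; apply: hr; apply: vn_le => [|i]; first exact: ltW.
by case: hq => _ /(_ 0 i); rewrite /ball /= distrC !mxE nm_real => /ltW.
Qed.

Lemma cvgC (u : nat -> C) (l : C) :
  (u N @[N --> \oo] --> l) <->
  forall e : R, 0 < e -> exists N0, forall N, (N0 <= N)%N -> nm (u N - l) <= e.
Proof.
split=> [h e e0|h].
  have e0' : 0 < RtoC e by rewrite -RtoC0 RtoC_lt.
  have /cvgrPdist_le/(_ _ e0')[N0 _ hN] := h.
  exists N0 => N /hN /=; by rewrite -nmE RtoC_le nmBC.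
apply/cvgrPdist_le => e e0.
have er : e = RtoC (ReC e) by rewrite /RtoC /ReC RRe_real // gtr0_real.
have r0 : 0 < ReC e by rewrite -RtoC_lt -er.
have [N0 hN] := h _ r0; exists N0 => // N /= /hN.
by rewrite er -nmE RtoC_le nmBC.
Qed.

End Neighbourhoods.

(** * Power series *)

Section Series.
Variable R : realType.
Local Notation C := (Cplx R).
Local Notation half := (2^-1 : R).

(** The coefficients are the limits of those of the approximating
polynomials. Cauchy's inequality passes to the limit at every smaller radius,
which is what relates the order of the series to the growth of f. *)
Lemma apx_ps n r (f : 'rV[C]_n -> C) : 0 < r -> apx r f ->
  exists a : {ffun 'I_n -> nat} -> C,
    (forall r' B, 0 <= r' -> r' <= r -> (forall h, vn h <= r' -> nm (f h) <= B) ->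
       forall m, nm (a m) * r' ^+ mdegree m <= B) /\
    (forall h, vn h <= r / 2 -> is_ps_sum a h (f h)).
Proof.
move=> r0 hf; have [s hs] := apx_seq hf.
have rm (m : {ffun 'I_n -> nat}) : 0 < r ^+ mdegree m by rewrite exprn_gt0.
have /choice[a ha] (m : {ffun 'I_n -> nat}) :
    exists l, forall k, nm (pcoef (s k) m - l) <= 4 * (2 / r ^+ mdegree m) * half ^+ k.
  apply: cauchyC => k.
  have := cauchy_estimate (ltW r0) (apx_seq_diff hs k) m.
  by rewrite pcoef_cat pcoef_neg -ler_pdivlMr // mulrAC.
have ha' k m : nm (pcoef (s k) m - a m) * r ^+ mdegree m <= 8 * half ^+ k.
  rewrite -ler_pdivlMr // (le_trans (ha m k)) // le_eqVlt; apply/orP; left; apply/eqP.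
  by field; rewrite gt_eqF.
have hB : forall r' B, 0 <= r' -> r' <= r -> (forall h, vn h <= r' -> nm (f h) <= B) ->
       forall m, nm (a m) * r' ^+ mdegree m <= B.
  move=> r' B r'0 r'r hB m; apply: (@le_half_lim _ _ _ 9) => k.
  have h1 : nm (pcoef (s k) m) * r' ^+ mdegree m <= B + half ^+ k.
    apply: cauchy_estimate => // h hr'; have -> : peval (s k) h = f h - (f h - peval (s k) h) by ring.
    by rewrite (le_trans (nmB _ _)) // lerD // ?hB // hs // (le_trans hr').
  have h2 : nm (pcoef (s k) m - a m) * r' ^+ mdegree m <= 8 * half ^+ k.
    by rewrite (le_trans _ (ha' k m)) // ler_wpM2l ?nm_ge0 // lerXn2r ?nnegrE // ltW.
  have h3 : nm (a m) <= nm (pcoef (s k) m) + nm (pcoef (s k) m - a m).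
    have {1}-> : a m = pcoef (s k) m - (pcoef (s k) m - a m) by ring.
    exact: nmB.
  have : nm (a m) * r' ^+ mdegree m <=
     (nm (pcoef (s k) m) + nm (pcoef (s k) m - a m)) * r' ^+ mdegree m.
    by rewrite ler_wpM2r ?exprn_ge0.
  by rewrite mulrDl; lra.
exists a; split=> // h hr.
have [B B0 fB] := apx_bd hf.
have aB := hB r B (ltW r0) (lexx _) fB.
split.
  exists (RtoC (B * 2 ^+ n)) => N; rewrite /ps_partial_norm_sum.
  under eq_bigr do rewrite -nmE.
  rewrite -RtoC_sum RtoC_le; exact: box_bd aB hr.
apply/cvgC => e e0.
have [k hk] := half_small (8 * 2 ^+ n + 1) e0.
have [N0 hN] := peval_box (s k); exists N0 => N NN.
rewrite (le_trans _ hk) //.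
have -> : ps_partial_sum a h N - f h =
  \sum_(b : {ffun 'I_n -> 'I_N}) (a (box_index b) - pcoef (s k) (box_index b)) * monomial h (box_index b)
  + (peval (s k) h - f h).
  rewrite (hN N) // addrA -big_split /=; congr (_ - _).
  by apply: eq_bigr => b _; rewrite mulrBl subrK.
rewrite (le_trans (nmD _ _)) // mulrDl lerD //.
  rewrite (le_trans (nm_sum _ _ _)) // mulrAC.
  apply: (box_bd (a := fun m => a m - pcoef (s k) m)) hr => // m.
  by rewrite nmBC.
by rewrite mul1r nmBC hs //; lra.
Qed.

Lemma box_widen n N (F : {ffun 'I_n -> nat} -> C) :
  \sum_(b : {ffun 'I_n -> 'I_N}) F (box_index b) =
  \sum_(b : {ffun 'I_n -> 'I_N.+1} | [forall i, b i < N]%N) F (box_index b).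
Proof.
pose w (b : {ffun 'I_n -> 'I_N}) := [ffun i => widen_ord (leqnSn N) (b i)].
have wI : injective w.
  move=> b c /ffunP bc; apply/ffunP => i; have := bc i; rewrite !ffunE => /(congr1 val) e.
  exact: val_inj.
have wE b : box_index (w b) = box_index b by apply/ffunP => i; rewrite !ffunE.
transitivity (\sum_(c in w @: predT) F (box_index c)).
  rewrite big_imset /=; last by move=> b c _ _; exact: wI.
  by apply: eq_bigr => b _; rewrite wE.
apply: eq_bigl => c; apply/imsetP/forallP => [[b _ -> i]|h]; first by rewrite ffunE /=.
exists [ffun i => Ordinal (h i)] => //.
by apply/ffunP => i; rewrite !ffunE; apply: val_inj.
Qed.

(** A term outside the box of side N has degree at least N. Halving the
radius once gives the factor 2^-N, and once more makes the terms summable. *)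
Lemma ps_apx n r B (a : {ffun 'I_n -> nat} -> C) : 0 < r ->
  (forall m, nm (a m) * r ^+ mdegree m <= B) ->
  exists P, apx (r / 2 / 2) P /\
    forall h, vn h <= r / 2 / 2 -> forall e, 0 < e ->
     exists N0, forall N, (N0 <= N)%N -> nm (ps_partial_sum a h N - P h) <= e.
Proof.
move=> r0 aB; pose c := B * 2 ^+ n.
have B0 : 0 <= B.
  by rewrite (le_trans _ (aB [ffun=> 0%N])) // mulr_ge0 ?nm_ge0 ?exprn_ge0 // ltW.
have [P [hP hPc]] : exists P, apx (r / 2 / 2) P /\ forall N h, vn h <= r / 2 / 2 ->
    nm (ps_partial_sum a h N - P h) <= 4 * c * half ^+ N.
  apply: (uniform_limit (f := fun N h => ps_partial_sum a h N)) => [N|N h hr].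
    apply: apx_sum => b _; apply: apxM; first exact: apx_cst.
    by apply: apx_prod => i _; apply: apxX; exact: apx_X.
  rewrite nmBC /ps_partial_sum (box_widen N (fun m => a m * monomial h m)).
  rewrite (bigID (fun b : {ffun 'I_n -> 'I_N.+1} => [forall i, b i < N]%N)) /=.
  rewrite addrAC subrr add0r (le_trans (nm_sum _ _ _)) // /c -mulrA (mulrC (2 ^+ n)) mulrA.
  rewrite (le_trans _ (ler_wpM2l _ (box_geo R n N.+1))) ?mulr_ge0 ?half_ge0 //.
  rewrite mulr_sumr [leRHS](bigID (fun b : {ffun 'I_n -> 'I_N.+1} => [forall i, b i < N]%N)) /=.
  rewrite ler_wpDl //.
    by apply: sumr_ge0 => b _; rewrite !mulr_ge0 ?half_ge0.
  apply: ler_sum => b hb.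
  have [i bi|hi] := pickP (fun i => N <= b i)%N; last first.
    case/negP: hb; apply/forallP => i.
    by have := hi i; rewrite leqNgt => /negbFE.
  have deg : (N <= mdegree (box_index b))%N.
    by rewrite /mdegree (bigD1 i) //= ffunE (leq_trans bi) // leq_addr.
  have r20 : 0 < r / 2 by lra.
  have h1 : nm (a (box_index b)) * (r / 2) ^+ mdegree (box_index b) <= B * half ^+ N.
    rewrite exprMn mulrA ler_pM ?half_ge0 //.
      by rewrite mulr_ge0 ?nm_ge0 ?exprn_ge0 // ltW.
    by rewrite ler_wiXn2l // ?invr_ge0 // invf_le1 // ler1n.
  exact: term_bd r20 h1 hr.
exists P; split=> // h hr e e0; have [N0 hN0] := half_small (4 * c) e0.
exists N0 => N NN; rewrite (le_trans (hPc N h hr)) // (le_trans _ hN0) //.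
rewrite ler_wpM2l ?mulr_ge0 ?exprn_ge0 //.
by rewrite ler_wiXn2l // ?invr_ge0 // invf_le1 // ler1n.
Qed.

(** At the point with all coordinates r, absolute convergence bounds the
modulus of each term. *)
Lemma is_ps_bd n (a : {ffun 'I_n -> nat} -> C) r s : 0 < r ->
  is_ps_sum a (const_mx (RtoC r)) s ->
  exists B : R, forall m, nm (a m) * r ^+ mdegree m <= B.
Proof.
move=> r0 [[B hB] _]; exists (ReC B) => m.
have BR : B = RtoC (ReC B).
  rewrite /RtoC /ReC RRe_real // ger0_real // (le_trans _ (hB 0%N)) //.
  by apply: sumr_ge0.
pose N := (1 + \sum_i m i)%N.
have mN i : (m i < N)%N by rewrite /N add1n ltnS (bigD1 i) //= leq_addr.
have := hB N; rewrite BR /ps_partial_norm_sum.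
under eq_bigr do rewrite -nmE.
rewrite -RtoC_sum RtoC_le; apply: le_trans.
pose b : {ffun 'I_n -> 'I_N} := [ffun i => Ordinal (mN i)].
have eb : box_index b = m by apply/ffunP => i; rewrite !ffunE.
rewrite (bigD1 b) //= eb ler_wpDr ?sumr_ge0 // => [c _|]; first exact: nm_ge0.
rewrite nmM ler_wpM2l ?nm_ge0 // /monomial nm_prod /mdegree expr_sum.
rewrite le_eqVlt; apply/orP; left; apply/eqP; apply: eq_bigr => i _.
by rewrite mxE nmX nm_real gtr0_norm.
Qed.

(** The holomorphic extension: the same series at complex points. *)
Lemma real_analytic_ext n (g : 'rV[R]_n -> C) p : real_analytic_at g p ->
  exists r P, [/\ 0 < r, apx r P & forall h, vn (cx h) <= r -> g (p + h) = P (cx h)].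
Proof.
move=> [a /nbhsR[r0 r00 ha]].
have [|B hB] := @is_ps_bd n a r0 (g (p + const_mx r0)) r00.
  have := ha (const_mx r0); rewrite /cx map_const_mx; apply.
  rewrite subr0; apply: vn_le => [|i]; first exact: ltW.
  by rewrite !mxE nm_real gtr0_norm.
have [P [hP hPl]] := ps_apx r00 hB.
exists (r0 / 2 / 2), P; split=> // [|h hr]; first by lra.
apply/eqP; rewrite -subr_eq0; apply/eqP; apply: eq0_small => e e0.
have hr0 : vn (cx (h - 0)) <= r0 by rewrite subr0; lra.
have [_ /cvgC hc] := ha h hr0.
have [|N1 h1] := hc (e / 2); first lra.
have [|N2 h2] := hPl (cx h) hr (e / 2); first lra.
have := h1 (N1 + N2)%N (leq_addr _ _); rewrite -/(cx h); have := h2 (N1 + N2)%N (leq_addl _ _).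
have := nmB3 (ps_partial_sum a (cx h) (N1 + N2)) (g (p + h)) (P (cx h)).
by rewrite (nmBC (g _) (ps_partial_sum _ _ _)); lra.
Qed.

Lemma cx_conj n (h : 'rV[R]_n) : map_mx Num.conj (cx h) = cx h.
Proof. by apply/rowP => i; rewrite !mxE; apply: conj_Creal; rewrite complex_real. Qed.

(** The mean of an extension and its conjugate is again an
extension, since g is real, and commutes with the conjugation. *)
Lemma real_analytic_ext_real n (g : 'rV[R]_n -> R) p :
  real_analytic_at (fun t => RtoC (g t)) p ->
  exists r P, [/\ 0 < r, apx r P, forall h, vn (cx h) <= r -> RtoC (g (p + h)) = P (cx h)
    & forall h, P (map_mx Num.conj h) = Num.conj (P h)].
Proof.
move=> /real_analytic_ext[r [P [r0 hP hg]]].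
exists r, (fun h => 2^-1 * (P h + Num.conj (P (map_mx Num.conj h)))); split=> //.
- apply: apxM; first exact: apx_cst.
  by apply: apxD => //; exact: apx_conj.
- move=> h hr; rewrite cx_conj -hg // conj_Creal ?complex_real //.
  by field.
- move=> h; have -> : map_mx Num.conj (map_mx Num.conj h) = h.
    by apply/rowP => i; rewrite !mxE conjCK.
  by rewrite rmorphM rmorphD /= conjCK addrC fmorphV rmorph_nat.
Qed.

End Series.

(** * Analytic germs at the origin *)

Section Germs.
Variable R : realType.
Local Notation C := (Cplx R).

Lemma common_radius (I : finType) (P : I -> R -> Prop) :
  (forall i r r', r' <= r -> P i r -> P i r') ->
  (forall i, exists r, 0 < r /\ P i r) -> exists r, 0 < r /\ forall i, P i r.
Proof.
move=> mono /choice[r hr].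
have [r0 [r00 h0]] : exists r0, 0 < r0 /\ forall i, i \in enum I -> P i r0.
  elim: (enum I) => [|i s [r0 [r00 IH]]]; first by exists 1.
  exists (Num.min r0 (r i)); split; first by rewrite lt_min r00; case: (hr i).
  move=> j; rewrite inE => /orP[/eqP->|/IH].
    by apply: mono (hr i).2; rewrite ge_min lexx orbT.
  by apply: mono; rewrite ge_min lexx.
by exists r0; split=> // i; apply: h0; rewrite mem_enum.
Qed.

(** The neighbourhoods of 0 by explicit radii; [near0P] is the translation. *)
Definition near0 n (P : 'rV[C]_n -> Prop) : Prop :=
  exists r : R, 0 < r /\ forall h, vn h <= r -> P h.

Lemma near0P n (P : 'rV[C]_n -> Prop) : (\forall h \near (0 : 'rV[C]_n), P h) <-> near0 P.
Proof.
split=> [/nbhsC[r r0 h]|[r [r0 h]]].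
  by exists r; split=> // q qr; apply: h; rewrite subr0.
by apply/nbhsC; exists r => // q; rewrite subr0; exact: h.
Qed.

(** Analytic germs at 0. A germ is given by any function that agrees near 0
with a uniform limit of polynomials. *)
Definition An n (f : 'rV[C]_n -> C) : Prop := exists r : R, 0 < r /\ apx r f.
Definition AnV n m (F : 'rV[C]_n -> 'rV[C]_m) : Prop := forall i, An (fun h => F h 0 i).

Lemma An_ext n (f g : 'rV[C]_n -> C) : An f -> near0 (fun h => f h = g h) -> An g.
Proof.
move=> [r [r0 hf]] [r' [r'0 fg]]; exists (Num.min r r'); split.
  by rewrite lt_min r0.
apply: (apx_ext (apx_le _ hf)) => [|h]; first by rewrite ge_min lexx.
by rewrite le_min => /andP[_]; exact: fg.
Qed.
Lemma An_eq n (f g : 'rV[C]_n -> C) : An f -> f =1 g -> An g.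
Proof. by move=> hf fg; apply: An_ext hf _; exists 1; split. Qed.
Lemma An_cst n (c : C) : An (fun _ : 'rV[C]_n => c).
Proof. by exists 1; split=> //; exact: apx_cst. Qed.
Lemma An_X n i : An (fun h : 'rV[C]_n => h 0 i).
Proof. by exists 1; split=> //; exact: apx_X. Qed.
Lemma An_op2 n (op : C -> C -> C) (f g : 'rV[C]_n -> C) :
  (forall r (f g : 'rV[C]_n -> C), apx r f -> apx r g -> apx r (fun h => op (f h) (g h))) ->
  An f -> An g -> An (fun h => op (f h) (g h)).
Proof.
move=> hop [r [r0 hf]] [r' [r'0 hg]]; exists (Num.min r r'); split.
  by rewrite lt_min r0.
apply: hop; [apply: apx_le hf|apply: apx_le hg]; by rewrite ge_min lexx ?orbT.
Qed.
Lemma AnD n (f g : 'rV[C]_n -> C) : An f -> An g -> An (fun h => f h + g h).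
Proof. by apply: An_op2 => *; exact: apxD. Qed.
Lemma AnM n (f g : 'rV[C]_n -> C) : An f -> An g -> An (fun h => f h * g h).
Proof. by apply: An_op2 => *; exact: apxM. Qed.
Lemma AnB n (f g : 'rV[C]_n -> C) : An f -> An g -> An (fun h => f h - g h).
Proof. by apply: (An_op2 (op := fun x y => x - y)) => *; exact: apxB. Qed.
Lemma AnN n (f : 'rV[C]_n -> C) : An f -> An (fun h => - f h).
Proof. by move=> [r [r0 hf]]; exists r; split=> //; exact: apxN. Qed.
Lemma AnZ n c (f : 'rV[C]_n -> C) : An f -> An (fun h => c * f h).
Proof. by move=> hf; apply: AnM => //; exact: An_cst. Qed.
Lemma An_sum n (I : Type) (s : seq I) (P : pred I) (F : I -> 'rV[C]_n -> C) :
  (forall i, P i -> An (F i)) -> An (fun h => \sum_(i <- s | P i) F i h).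
Proof.
move=> hF; elim: s => [|i s IH].
  by apply: (An_eq (An_cst _ 0)) => h; rewrite big_nil.
case Pi: (P i); last by apply: (An_eq IH) => h; rewrite big_cons Pi.
by apply: (An_eq (AnD (hF _ Pi) IH)) => h; rewrite big_cons Pi.
Qed.
(** The germ with conjugate Taylor coefficients. *)
Definition conjf n (f : 'rV[C]_n -> C) : 'rV[C]_n -> C :=
  fun h => Num.conj (f (map_mx Num.conj h)).
Lemma An_conj n (f : 'rV[C]_n -> C) : An f -> An (conjf f).
Proof. by move=> [r [r0 hf]]; exists r; split=> //; exact: apx_conj. Qed.

Lemma AnV_apx n m (F : 'rV[C]_n -> 'rV[C]_m) : AnV F ->
  exists r, 0 < r /\ forall i, apx r (fun h => F h 0 i).
Proof. by move=> hF; apply: common_radius => // i r r' rr; exact: apx_le. Qed.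

(** A linear map multiplies norms by a bounded factor. *)
Lemma An_lin n m (f : 'rV[C]_n -> C) (A : 'M[C]_(m, n)) : An f -> An (fun h => f (h *m A)).
Proof.
move=> [r [r0 hf]].
pose K := 1 + \sum_i \sum_j nm (A j i).
have K0 : 0 < K.
  by rewrite ltr_pwDl // sumr_ge0 // => i _; rewrite sumr_ge0 // => j _; exact: nm_ge0.
exists (r / K); split; first by rewrite divr_gt0.
apply: (apx_comp (r := r)) => // [i|h hr].
  apply: (apx_ext (f := fun h => \sum_j h 0 j * A j i)) => [|h _]; last by rewrite mxE.
  by apply: apx_sum => j _; apply: apxM; [exact: apx_X|exact: apx_cst].
apply: vn_le => [|i]; first exact: ltW.
have h0 := vn_ge0 h.
rewrite mxE (le_trans (nm_sum _ _ _)) //.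
apply: (@le_trans _ _ (vn h * \sum_j nm (A j i))).
  rewrite mulr_sumr ler_sum // => j _; rewrite nmM ler_wpM2r ?nm_ge0 //.
  exact: le_vn.
apply: (@le_trans _ _ (vn h * K)); last by rewrite -ler_pdivlMr.
apply: ler_wpM2l => //; rewrite /K ler_wpDl // (bigD1 i) //= lerDl.
by rewrite sumr_ge0 // => k _; rewrite sumr_ge0 // => j _; exact: nm_ge0.
Qed.

Definition zero_on n (s : seq 'I_n) (h : 'rV[C]_n) : 'rV[C]_n :=
  \row_j (if j \in s then 0 else h 0 j).
Lemma zero_on_lin n (s : seq 'I_n) h :
  zero_on s h = h *m diag_mx (\row_j (if j \in s then 0 else 1)).
Proof.
apply/rowP => j; rewrite mul_mx_diag !mxE.
by case: (j \in s); rewrite ?mulr0 ?mulr1.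
Qed.
Lemma zero_at_lin n (i : 'I_n) (h : 'rV[C]_n) : zero_at i h = zero_on [:: i] h.
Proof. by apply/rowP => j; rewrite !mxE inE. Qed.

Lemma An_div n (f : 'rV[C]_n -> C) i : An f ->
  exists g, An g /\ near0 (fun h => f h = f (zero_on [:: i] h) + h 0 i * g h).
Proof.
move=> [r [r0 /(apx_div i r0)[g [hg fg]]]].
exists g; split; first by exists (r / 2); split=> //; lra.
by exists (r / 2); split=> [|h hr]; [lra|rewrite -zero_at_lin; exact: fg].
Qed.

Lemma near0_and n (P Q : 'rV[C]_n -> Prop) : near0 P -> near0 Q -> near0 (fun h => P h /\ Q h).
Proof.
move=> [r [r0 hP]] [r' [r'0 hQ]]; exists (Num.min r r'); split.
  by rewrite lt_min r0.
by move=> h; rewrite le_min => /andP[/hP + /hQ].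
Qed.
Lemma near0_sub n (P Q : 'rV[C]_n -> Prop) : (forall h, P h -> Q h) -> near0 P -> near0 Q.
Proof. by move=> PQ [r [r0 hP]]; exists r; split=> // h /hP/PQ. Qed.

Lemma An_division n (f : 'rV[C]_n -> C) (s : seq 'I_n) : uniq s -> An f ->
  exists g : 'I_n -> 'rV[C]_n -> C, (forall i, An (g i)) /\
    near0 (fun h => f h = f (zero_on s h) + \sum_(i <- s) h 0 i * g i h).
Proof.
move=> + hf; elim: s => [_|i s IHs /= /andP[is_ us]].
  exists (fun _ _ => 0); split=> [_|]; first exact: An_cst.
  exists 1; split=> // h _; rewrite big_nil addr0; congr f.
  by apply/rowP => j; rewrite mxE.
have [g [hg IH]] := IHs us.
have hz : An (fun h => f (zero_on s h)).
  by apply: (An_eq (An_lin _ hf)) => h; rewrite zero_on_lin.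
have [k [hk ek]] := An_div i hz.
exists (fun j => if j == i then k else g j); split=> [j|]; first by case: ifP.
apply: near0_sub (near0_and IH ek) => h [-> ->].
rewrite big_cons eqxx addrA; congr (_ + _ + _).
  by congr f; apply/rowP => j; rewrite !mxE !inE; case: (j == i); case: (j \in s).
rewrite big_seq [RHS]big_seq; apply: eq_bigr => j js.
by case: eqP => // ji; move: is_; rewrite -ji js.
Qed.

(** Hadamard's lemma: f (h + d), as a germ in the pair (h, d), is divided
successively by the coordinates of d. *)
Lemma An_hadamard n (f : 'rV[C]_n -> C) : An f ->
  exists g : 'I_n -> 'rV[C]_(n + n) -> C, (forall i, An (g i)) /\
  exists r, 0 < r /\ forall h d, vn h <= r -> vn d <= r ->
    f (h + d) = f h + \sum_i d 0 i * g i (row_mx h d).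
Proof.
move=> hf.
have hF : An (fun x : 'rV[C]_(n + n) => f (lsubmx x + rsubmx x)).
  apply: (An_eq (An_lin (col_mx 1%:M 1%:M) hf)) => h.
  by rewrite -{1}[h]hsubmxK mul_row_col !mulmx1.
pose s := [seq rshift n i | i <- enum 'I_n].
have us : uniq s by rewrite map_inj_uniq ?enum_uniq //; exact: rshift_inj.
have [g [hg [r [r0 hr]]]] := An_division us hF.
exists (fun i => g (rshift n i)); split=> [i|]; first exact: hg.
exists r; split=> // h d hh hd.
have := hr (row_mx h d) (vn_row_mx hh hd); rewrite row_mxKl row_mxKr => ->.
rewrite big_map -big_enum /=; congr (_ + _); last first.
  by apply: eq_bigr => i _; rewrite row_mxEr.
have -> : zero_on s (row_mx h d) = row_mx h 0.
  apply/rowP => j; rewrite mxE; have [k ->|k ->] := split_ordP j.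
    rewrite !row_mxEl; case: ifP => // /mapP[l _ /eqP].
    by rewrite eq_lrshift.
  by rewrite !row_mxEr mxE (map_f (@rshift n n)) ?mem_enum.
by rewrite row_mxKl row_mxKr addr0.
Qed.

Definition Lip n (f : 'rV[C]_n -> C) : Prop := exists K r : R, [/\ 0 < K, 0 < r &
  forall h k, vn h <= r -> vn k <= r -> nm (f h - f k) <= K * vn (h - k)].
Definition LipV n m (F : 'rV[C]_n -> 'rV[C]_m) := forall i, Lip (fun h => F h 0 i).
(** The Lipschitz constants of f near 0 are arbitrarily small. For analytic
germs this means that f and its differential vanish at 0, and it is the form in
which fixed point arguments use it. *)
Definition flat n (f : 'rV[C]_n -> C) : Prop :=
  f 0 = 0 /\ forall e, 0 < e -> exists r : R, 0 < r /\
  forall h k, vn h <= r -> vn k <= r -> nm (f h - f k) <= e * vn (h - k).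
Definition flatV n m (F : 'rV[C]_n -> 'rV[C]_m) := forall i, flat (fun h => F h 0 i).

(** The quotients in Hadamard's lemma are bounded. *)
Lemma An_Lip n (f : 'rV[C]_n -> C) : An f -> Lip f.
Proof.
move=> /An_hadamard[g [hg [r [r0 hr]]]].
have [r' [r'0 hr']] : exists r', 0 < r' /\ forall i, apx r' (g i).
  by apply: common_radius => // i a b ab; exact: apx_le.
have /choice[B hB] i : exists B, 0 < B /\ forall h, vn h <= r' -> nm (g i h) <= B.
  by have [B B0 hB] := apx_bd (hr' i); exists B.
pose K := 1 + \sum_i B i; pose q := Num.min r r' / 2.
have m0 : 0 < Num.min r r' by rewrite lt_min r0.
have B0 i : 0 <= B i by rewrite ltW //; case: (hB i).
exists K, q; split; first by rewrite /K ltr_pwDl // sumr_ge0.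
  by rewrite /q; lra.
move=> h k; rewrite /q => hh hk.
have [mr mr'] : Num.min r r' <= r /\ Num.min r r' <= r'.
  by rewrite !ge_min !lexx orbT.
have hd := vnB h k.
have -> : h = k + (h - k) by rewrite addrC subrK.
rewrite hr; [|lra|lra].
have -> : k + (h - k) - k = h - k by rewrite addrAC subrr add0r.
rewrite addrAC subrr add0r (le_trans (nm_sum _ _ _)) //.
apply: (@le_trans _ _ (\sum_i (vn (h - k) * B i))).
  apply: ler_sum => i _; rewrite nmM ler_pM ?nm_ge0 ?le_vn //.
  by apply: (hB i).2; apply: vn_row_mx; lra.
rewrite -mulr_sumr mulrC ler_wpM2r ?vn_ge0 // /K; lra.
Qed.

Lemma LipV_unif n m (F : 'rV[C]_n -> 'rV[C]_m) : LipV F ->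
  exists K r : R, [/\ 0 < K, 0 < r &
  forall h k, vn h <= r -> vn k <= r -> vn (F h - F k) <= K * vn (h - k)].
Proof.
move=> /choice[K hK].
have [r [r0 hr]] : exists r, 0 < r /\ forall i, 0 < K i /\
    forall h k, vn h <= r -> vn k <= r -> nm (F h 0 i - F k 0 i) <= K i * vn (h - k).
  apply: common_radius => [i r r' rr [K0 h]|i]; last by have [r [? ? ?]] := hK i; exists r.
  by split=> // a b ha hb; apply: h; exact: le_trans rr.
have K0 i : 0 < K i by case: (hr i).
have S0 : 0 <= \sum_i K i by rewrite sumr_ge0 // => i _; exact: ltW.
exists (1 + \sum_i K i), r; split=> // [|h k hh hk]; first lra.
apply: vn_le => [|i]; first by rewrite mulr_ge0 ?vn_ge0 //; lra.
rewrite mxE [X in nm (_ + X)]mxE (le_trans ((hr i).2 _ _ hh hk)) // ler_wpM2r ?vn_ge0 //.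
rewrite (bigD1 i) //= ler_wpDl // lerDl sumr_ge0 // => j _; exact: ltW.
Qed.

Lemma flatV_unif n m (F : 'rV[C]_n -> 'rV[C]_m) : flatV F ->
  F 0 = 0 /\ forall e, 0 < e -> exists r : R, 0 < r /\
  forall h k, vn h <= r -> vn k <= r -> vn (F h - F k) <= e * vn (h - k).
Proof.
move=> hF; split; first by apply/rowP => i; rewrite mxE (hF i).1.
move=> e e0.
have [r [r0 hr]] : exists r, 0 < r /\ forall i,
    forall h k, vn h <= r -> vn k <= r -> nm (F h 0 i - F k 0 i) <= e * vn (h - k).
  apply: common_radius => [i r r' rr h a b ha hb|i]; last exact: (hF i).2.
  by apply: h; exact: le_trans rr.
exists r; split=> // h k hh hk.
apply: vn_le => [|i]; first by rewrite mulr_ge0 ?vn_ge0 // ltW.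
by rewrite mxE [X in nm (_ + X)]mxE hr.
Qed.

Lemma LipV_small n m (F : 'rV[C]_n -> 'rV[C]_m) : LipV F -> F 0 = 0 ->
  forall e, 0 < e -> exists r, 0 < r /\ forall h, vn h <= r -> vn (F h) <= e.
Proof.
move=> /LipV_unif[K [r [K0 r0 h]]] F0 e e0.
exists (Num.min r (e / K)); split; first by rewrite lt_min r0 divr_gt0.
move=> k; rewrite le_min => /andP[kr ke].
have := h k 0 kr; rewrite vn0 F0 !subr0 => /(_ (ltW r0)) /le_trans; apply.
by rewrite mulrC -ler_pdivlMr.
Qed.

Lemma flat_Lip n (f : 'rV[C]_n -> C) : flat f -> Lip f.
Proof. by move=> [_ /(_ 1 ltr01)[r [r0 hr]]]; exists 1, r; split. Qed.
Lemma AnV_Lip n m (F : 'rV[C]_n -> 'rV[C]_m) : AnV F -> LipV F.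
Proof. by move=> hF i; exact: An_Lip. Qed.

Lemma flat_comp n m (f : 'rV[C]_n -> C) (G : 'rV[C]_m -> 'rV[C]_n) :
  flat f -> LipV G -> G 0 = 0 -> flat (fun h => f (G h)).
Proof.
move=> [f0 hf] hG G0; split; first by rewrite G0.
move=> e e0; have [K [r [K0 r0 hK]]] := LipV_unif hG.
have [r' [r'0 hr']] := hf (e / K) (divr_gt0 e0 K0).
have [q [q0 hq]] := LipV_small hG G0 r'0.
exists (Num.min r q); split; first by rewrite lt_min r0.
move=> h k; rewrite !le_min => /andP[hr hq'] /andP[kr kq].
rewrite (le_trans (hr' _ _ (hq _ hq') (hq _ kq))) //.
rewrite -mulrA ler_pM2l // mulrC ler_pdivrMr // mulrC.
exact: hK.
Qed.

Lemma flat0 n : flat (fun _ : 'rV[C]_n => 0).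
Proof.
split=> // e e0; exists 1; split=> // h k _ _.
by rewrite subr0 nm0 mulr_ge0 ?vn_ge0 // ltW.
Qed.
Lemma flatD n (f g : 'rV[C]_n -> C) : flat f -> flat g -> flat (fun h => f h + g h).
Proof.
move=> [f0 hf] [g0 hg]; split; first by rewrite f0 g0 addr0.
move=> e e0; have [r [r0 hr]] := hf (e / 2) ltac:(lra).
have [r' [r'0 hr']] := hg (e / 2) ltac:(lra).
exists (Num.min r r'); split; first by rewrite lt_min r0.
move=> h k; rewrite !le_min => /andP[h1 h2] /andP[k1 k2].
have -> : f h + g h - (f k + g k) = (f h - f k) + (g h - g k) by ring.
by rewrite (le_trans (nmD _ _)) //; have := hr _ _ h1 k1; have := hr' _ _ h2 k2; lra.
Qed.
Lemma flatM n (f g : 'rV[C]_n -> C) : Lip f -> Lip g -> f 0 = 0 -> g 0 = 0 ->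
  flat (fun h => f h * g h).
Proof.
move=> [K [r [K0 r0 hK]]] [K' [r' [K'0 r'0 hK']]] f0 g0.
split; first by rewrite f0 mul0r.
move=> e e0; pose q := Num.min (Num.min r r') (e / (2 * K * K')).
have KK : 0 < 2 * K * K' by rewrite !mulr_gt0.
have q0 : 0 < q by rewrite !lt_min r0 r'0 divr_gt0.
have [qr qr' qe] : [/\ q <= r, q <= r' & q <= e / (2 * K * K')].
  by rewrite /q !ge_min !lexx !orbT.
exists q; split=> // h k hq kq.
have -> : f h * g h - f k * g k = (f h - f k) * g h + f k * (g h - g k) by ring.
have z0 s : 0 < s -> vn (0 : 'rV[C]_n) <= s by rewrite vn0; exact: ltW.
have b1 := hK h k (le_trans hq qr) (le_trans kq qr).
have b2 := hK' h k (le_trans hq qr') (le_trans kq qr').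
have b3 : nm (g h) <= K' * q.
  have := hK' h 0 (le_trans hq qr') (z0 _ r'0); rewrite g0 !subr0 => /le_trans; apply.
  by rewrite ler_wpM2l // ltW.
have b4 : nm (f k) <= K * q.
  have := hK k 0 (le_trans kq qr) (z0 _ r0); rewrite f0 !subr0 => /le_trans; apply.
  by rewrite ler_wpM2l // ltW.
have d0 := vn_ge0 (h - k).
rewrite (le_trans (nmD _ _)) // !nmM.
apply: (@le_trans _ _ ((K * vn (h - k)) * (K' * q) + (K * q) * (K' * vn (h - k)))).
  by rewrite lerD // ler_pM ?nm_ge0.
have -> : K * vn (h - k) * (K' * q) + K * q * (K' * vn (h - k)) =
  (q * (2 * K * K')) * vn (h - k) by ring.
by rewrite ler_wpM2r // -ler_pdivlMr.
Qed.
Lemma flat_lin n m (f : 'rV[C]_n -> C) (A : 'M[C]_(m, n)) :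
  flat f -> flat (fun h => f (h *m A)).
Proof.
move=> hf; apply: flat_comp => //; last by rewrite mul0mx.
move=> i; apply: An_Lip; exact: (An_lin A (An_X i)).
Qed.
Lemma flatZ n c (f : 'rV[C]_n -> C) : flat f -> flat (fun h => c * f h).
Proof.
move=> [f0 hf]; split; first by rewrite f0 mulr0.
have N0 := nm_ge0 c.
move=> e e0; have [|r [r0 hr]] := hf (e / (nm c + 1)); first by rewrite divr_gt0 //; lra.
exists r; split=> // h k hh hk; rewrite -mulrBr nmM.
apply: (@le_trans _ _ ((nm c + 1) * nm (f h - f k))).
  by rewrite ler_wpM2r ?nm_ge0 //; lra.
rewrite mulrC -ler_pdivlMr; last lra.
by rewrite mulrAC; exact: hr.
Qed.
Lemma flat_ext n (f g : 'rV[C]_n -> C) : f =1 g -> flat f -> flat g.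
Proof. by move=> /funext ->. Qed.
Lemma flat_sum n (I : Type) (s : seq I) (F : I -> 'rV[C]_n -> C) :
  (forall i, flat (F i)) -> flat (fun h => \sum_(i <- s) F i h).
Proof.
move=> hF; elim: s => [|i s IH].
  by apply: flat_ext (flat0 n) => h; rewrite big_nil.
by apply: flat_ext (flatD (hF i) IH) => h; rewrite big_cons.
Qed.

Lemma flat_near0 n (f g : 'rV[C]_n -> C) : near0 (fun h => f h = g h) -> flat f -> flat g.
Proof.
move=> [q [q0 fg]] [f0 hf]; split; first by rewrite -fg // vn0 ltW.
move=> e /hf[r [r0 hr]]; exists (Num.min r q); split; first by rewrite lt_min r0.
move=> h k; rewrite !le_min => /andP[h1 h2] /andP[k1 k2].
by rewrite -!fg //; exact: hr.
Qed.

Lemma An_comp n m (f : 'rV[C]_n -> C) (G : 'rV[C]_m -> 'rV[C]_n) :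
  An f -> AnV G -> G 0 = 0 -> An (fun h => f (G h)).
Proof.
move=> [r [r0 hf]] hG G0.
have [q [q0 hq]] := LipV_small (AnV_Lip hG) G0 r0.
have [r' [r'0 hr']] := AnV_apx hG.
exists (Num.min q r'); split; first by rewrite lt_min q0.
apply: (apx_comp hf) => [i|h]; first by apply: (apx_le _ (hr' i)); rewrite ge_min lexx orbT.
by rewrite le_min => /andP[/hq].
Qed.

End Germs.

(** * Implicit and inverse functions *)

Section Implicit.
Variable R : realType.
Local Notation C := (Cplx R).
Local Notation half := (2^-1 : R).

(** v |-> - Q (x, v) is a contraction of ratio 1/2. Its iterates are
analytic in x and converge geometrically, so the fixed point is analytic. The
last bound is the converse estimate: a small defect of the equation at v puts v
close to the solution. *)
Theorem implicit_function k n (Q : 'rV[C]_(k + n) -> 'rV[C]_n) : AnV Q -> flatV Q ->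
  exists phi : 'rV[C]_k -> 'rV[C]_n, [/\ AnV phi, flatV phi & exists r : R, 0 < r /\
    forall x v, vn x <= r -> vn v <= r ->
      phi x + Q (row_mx x (phi x)) = 0 /\
      vn (v - phi x) <= 2 * vn (v + Q (row_mx x v))].
Proof.
move=> hQ fQ; have [Q0 fQu] := flatV_unif fQ.
have [r1 [r10 lip1]] := fQu half ltac:(by rewrite invr_gt0).
have [r2 [r20 apx2]] := AnV_apx hQ.
pose r := Num.min r1 r2.
have r0 : 0 < r by rewrite lt_min r10.
have rr1 : r <= r1 by rewrite ge_min lexx.
have rr2 : r <= r2 by rewrite ge_min lexx orbT.
have lip x v x' v' : vn x <= r -> vn v <= r -> vn x' <= r -> vn v' <= r ->
    vn (Q (row_mx x v) - Q (row_mx x' v')) <= half * vn (row_mx x v - row_mx x' v').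
  move=> hx hv hx' hv'; apply: lip1; apply: le_trans rr1; exact: vn_row_mx.
have Qr x v : vn x <= r -> vn v <= r -> vn (Q (row_mx x v)) <= half * r.
  move=> hx hv; have := lip x v 0 0 hx hv; rewrite !vn0 (ltW r0) row_mx0 Q0 !subr0.
  move=> /(_ isT isT)/le_trans; apply; rewrite ler_wpM2l ?invr_ge0 //.
  exact: vn_row_mx.
pose it : nat -> 'rV[C]_k -> 'rV[C]_n :=
  fix it j := if j is j'.+1 then fun x => - Q (row_mx x (it j' x)) else fun=> 0.
have itr j x : vn x <= r -> vn (it j x) <= half * r.
  elim: j => [|j IH] hx /=; first by rewrite vn0 mulr_ge0 ?invr_ge0 // ltW.
  rewrite vnN; apply: Qr => //; have := IH hx; lra.
have itr' j x : vn x <= r -> vn (it j x) <= r by move=> hx; have := itr j x hx; lra.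
have ita j i : apx r (fun x => it j x 0 i).
  elim: j i => [|j IH] i /=.
    by apply: (apx_ext (apx_cst _ r 0)) => h _; rewrite mxE.
  apply: (apx_ext (f := fun x => - Q (row_mx x (it j x)) 0 i)) => [|h _]; last by rewrite mxE.
  apply: apxN; apply: (apx_comp (apx_le rr2 (apx2 i))) => [l|h hr]; last first.
    by apply: vn_row_mx => //; exact: itr'.
  have [l' ->|l' ->] := split_ordP l.
    by apply: (apx_ext (apx_X r l')) => h _; rewrite row_mxEl.
  by apply: (apx_ext (IH l')) => h _; rewrite row_mxEr.
have dmx x (v v' : 'rV[C]_n) : row_mx x v - row_mx x v' = row_mx 0 (v - v') :> 'rV[C]_(k + n).
  by rewrite opp_row_mx add_row_mx subrr.
have vdmx (v : 'rV[C]_n) : vn (row_mx (0 : 'rV[C]_k) v) <= vn v.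
  by apply: vn_row_mx; rewrite // vn0 vn_ge0.
have lipv x v v' : vn x <= r -> vn v <= r -> vn v' <= r ->
    vn (Q (row_mx x v) - Q (row_mx x v')) <= half * vn (v - v').
  move=> hx hv hv'; rewrite (le_trans (lip _ _ _ _ hx hv hx hv')) //.
  by rewrite dmx ler_wpM2l ?invr_ge0.
have itc j x : vn x <= r -> vn (it j x - it j.+1 x) <= r * half ^+ j.
  move=> hx; elim: j => [|j IH].
    by rewrite expr0 mulr1 sub0r vnN; exact: itr'.
  have -> : it j.+1 x - it j.+2 x = Q (row_mx x (it j.+1 x)) - Q (row_mx x (it j x)).
    by rewrite /= opprK addrC.
  rewrite vnBC in IH; rewrite (le_trans (lipv _ _ _ hx _ _)) ?itr' //.
  rewrite exprS mulrCA ler_wpM2l ?invr_ge0 //.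
have /choice[phi' hphi'] i : exists g, apx r g /\
    forall j x, vn x <= r -> nm (it j x 0 i - g x) <= 4 * r * half ^+ j.
  apply: uniform_limit => // j x hx; rewrite (le_trans _ (itc j x hx)) //.
  by have := le_vn (it j x - it j.+1 x) i; rewrite !mxE.
pose phi x : 'rV[C]_n := \row_i phi' i x.
have philim j x : vn x <= r -> vn (it j x - phi x) <= 4 * r * half ^+ j.
  move=> hx; apply: vn_le => [|i]; last by rewrite !mxE; exact: (hphi' i).2.
  by rewrite !mulr_ge0 ?half_ge0 // ltW.
have phir x : vn x <= r -> vn (phi x) <= half * r.
  move=> hx; apply: (@le_half_lim _ _ _ (4 * r)) => j.
  have -> : phi x = it j x - (it j x - phi x) by rewrite opprB addrC subrK.
  by rewrite (le_trans (vnB _ _)) // lerD ?itr ?philim.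
have phir' x : vn x <= r -> vn (phi x) <= r by move=> /phir; lra.
have eqn x : vn x <= r -> phi x + Q (row_mx x (phi x)) = 0.
  move=> hx; apply: vn_eq0; apply: (@le_half_lim _ _ _ (4 * r)) => j; rewrite add0r.
  have -> : phi x + Q (row_mx x (phi x)) =
    - (it j.+1 x - phi x) + (Q (row_mx x (phi x)) - Q (row_mx x (it j x))).
    by apply/rowP => l; rewrite /= !mxE; ring.
  rewrite (le_trans (vnD _ _)) // vnN.
  have h1 := philim j.+1 x hx; have h2 := lipv x _ _ hx (phir' x hx) (itr' j x hx).
  have h3 := philim j x hx; rewrite vnBC in h3.
  have e := halfS R j; have h4 : r * half ^+ j = r * half ^+ j.+1 + r * half ^+ j.+1.
    by rewrite e mulrDr.
  lra.
have bd x v : vn x <= r -> vn v <= r -> vn (v - phi x) <= 2 * vn (v + Q (row_mx x v)).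
  move=> hx hv.
  have h1 := lipv x _ _ hx hv (phir' x hx).
  have e : phi x = - Q (row_mx x (phi x)) by apply/eqP; rewrite -addr_eq0 eqn.
  have h2 : v - phi x = (v + Q (row_mx x v)) - (Q (row_mx x v) - Q (row_mx x (phi x))).
    by rewrite {1}e; apply/rowP => l; rewrite !mxE; ring.
  have := vnB (v + Q (row_mx x v)) (Q (row_mx x v) - Q (row_mx x (phi x))).
  rewrite -h2; lra.
have phi0 : phi 0 = 0.
  apply: vn_eq0; have := bd 0 0; rewrite !vn0 (ltW r0) row_mx0 Q0 addr0 vn0 mulr0.
  by move=> /(_ isT isT); rewrite sub0r vnN.
(* the fixed point inherits the Lipschitz constants of Q *)
have philip e q : 0 < e -> e <= half -> q <= r ->
    (forall h k, vn h <= q -> vn k <= q -> vn (Q h - Q k) <= e * vn (h - k)) ->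
    forall x x', vn x <= q -> vn x' <= q -> vn (phi x) <= q -> vn (phi x') <= q ->
    vn (phi x - phi x') <= 2 * e * vn (x - x').
  move=> e0 eh qr hq x x' hx hx' px px'.
  have E y : vn y <= q -> phi y = - Q (row_mx y (phi y)).
    by move=> hy; apply/eqP; rewrite -addr_eq0 eqn //; exact: le_trans qr.
  have h1 : vn (phi x - phi x') <= e * vn (row_mx x (phi x) - row_mx x' (phi x')).
    rewrite {1}(E x) // {1}(E x') // opprK addrC vnBC vnBC.
    by rewrite (vnBC (row_mx x _)); apply: hq; exact: vn_row_mx.
  have h2 : vn (row_mx x (phi x) - row_mx x' (phi x')) <= vn (x - x') + vn (phi x - phi x').
    rewrite opp_row_mx add_row_mx; apply: vn_row_mx.
      by rewrite lerDl vn_ge0.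
    by rewrite lerDr vn_ge0.
  have h3 : e * vn (row_mx x (phi x) - row_mx x' (phi x')) <=
            e * (vn (x - x') + vn (phi x - phi x')) by rewrite ler_pM2l.
  have h4 : e * vn (phi x - phi x') <= half * vn (phi x - phi x').
    by rewrite ler_wpM2r ?vn_ge0.
  lra.
have phile x : vn x <= r -> vn (phi x) <= vn x.
  move=> hx; have := philip half r ltac:(by rewrite invr_gt0) (lexx _) (lexx _) _ x 0 hx.
  rewrite vn0 phi0 vn0 (ltW r0) !subr0 => h.
  have := h (fun a b ha hb => lip1 a b (le_trans ha rr1) (le_trans hb rr1)) isT (phir' x hx) isT.
  lra.
exists phi; split.
- move=> i; exists r; split=> //.
  by apply: (apx_ext (hphi' i).1) => h _; rewrite mxE.
- move=> i; split; first by rewrite phi0 mxE.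
  move=> e e0; pose e' := Num.min half (e / 2).
  have e'0 : 0 < e' by rewrite lt_min invr_gt0 ltr0n /=; lra.
  have [e'h e'e] : e' <= half /\ e' <= e / 2 by rewrite !ge_min !lexx orbT.
  have [q [q0 hq]] := fQu e' e'0.
  pose s := Num.min q r; have sq : s <= q by rewrite ge_min lexx.
  have sr : s <= r by rewrite ge_min lexx orbT.
  exists s; split; first by rewrite lt_min q0.
  move=> x x' hx hx'.
  have px : vn (phi x) <= s by rewrite (le_trans (phile _ (le_trans hx sr))).
  have px' : vn (phi x') <= s by rewrite (le_trans (phile _ (le_trans hx' sr))).
  have := philip e' s e'0 e'h sr _ x x' hx hx' px px'.
  move=> /(_ (fun a b ha hb => hq a b (le_trans ha sq) (le_trans hb sq))) h.
  have := le_vn (phi x - phi x') i; rewrite !mxE.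
  have : 2 * e' * vn (x - x') <= e * vn (x - x') by rewrite ler_wpM2r ?vn_ge0 //; lra.
  lra.
- by exists r; split=> // x v hx hv; split; [exact: eqn|exact: bd].
Qed.

(** Solve v + Q (y + v) = 0 for v; the inverse is y |-> y + v. *)
Theorem inverse_function n (Q : 'rV[C]_n -> 'rV[C]_n) : AnV Q -> flatV Q ->
  exists G : 'rV[C]_n -> 'rV[C]_n, [/\ AnV G, flatV (fun y => G y - y) & exists r : R, 0 < r /\
    (forall y, vn y <= r -> G y + Q (G y) = y) /\
    (forall x, vn x <= r -> G (x + Q x) = x)].
Proof.
move=> hQ fQ.
pose A : 'M[C]_(n + n, n) := col_mx 1%:M 1%:M.
have EA (y v : 'rV[C]_n) : row_mx y v *m A = y + v by rewrite mul_row_col !mulmx1.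
have [phi [hphi fphi [r [r0 hr]]]] := @implicit_function n n (fun x => Q (x *m A))
  (fun i => An_lin A (hQ i)) (fun i => flat_lin A (fQ i)).
have Q0 : Q 0 = 0 by case: (flatV_unif fQ).
have [q [q0 hq]] : exists q, 0 < q /\ forall h, vn h <= q -> vn (Q h) <= r / 2.
  by apply: LipV_small => //; [exact: AnV_Lip|lra].
exists (fun y => y + phi y); split.
- move=> i; have h0 : An (fun y : 'rV[C]_n => y 0 i + phi y 0 i) by apply: AnD => //; exact: An_X.
  by apply: An_eq h0 _ => h; rewrite mxE.
- by move=> i; apply: flat_ext (fphi i) => h; rewrite addrAC subrr add0r.
exists (Num.min q (r / 2)); split; first by rewrite lt_min q0; lra.
split=> [y|x]; rewrite le_min => /andP[h1 h2].
  have [e _] := hr y 0 ltac:(lra) ltac:(by rewrite vn0 ltW).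
  by rewrite EA in e; rewrite -addrA e addr0.
have hx : vn (x + Q x) <= r by rewrite (le_trans (vnD _ _)) //; have := hq x h1; lra.
have hQx : vn (- Q x) <= r by rewrite vnN; have := hq x h1; lra.
have [_] := hr (x + Q x) (- Q x) hx hQx.
rewrite EA addrK addNr vn0 mulr0 => /vn_eq0/eqP; rewrite subr_eq0 => /eqP <-.
by rewrite addrK.
Qed.

End Implicit.

(** * Holomorphic functions and coordinates from germs *)

Section Interface.
Variable R : realType.
Local Notation C := (Cplx R).

Lemma apx_shift n r (f : 'rV[C]_n -> C) p : apx r f ->
  apx (r - vn p) (fun h => f (p + h)).
Proof.
move=> hf; apply: (apx_comp hf) => [i|h hr].
  apply: (apx_ext (apxD (apx_cst n _ (p 0 i)) (apx_X _ i))) => h _.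
  by rewrite mxE.
by rewrite (le_trans (vnD _ _)) //; lra.
Qed.

Lemma An_shift n r (f : 'rV[C]_n -> C) p : vn p < r -> apx r f ->
  An (fun h => f (p + h)).
Proof.
by move=> pr hf; exists (r - vn p); split; [lra|exact: apx_shift].
Qed.

Lemma An_ps n (f : 'rV[C]_n -> C) : An f ->
  exists a : {ffun 'I_n -> nat} -> C, \forall h \near (0 : 'rV[C]_n), is_ps_sum a h (f h).
Proof.
move=> [r [r0 /(apx_ps r0)[a [_ ha]]]]; exists a; apply/near0P.
by exists (r / 2); split=> //; lra.
Qed.

Lemma apx_holomorphic n r (f : 'rV[C]_n -> C) p : vn p < r -> apx r f -> holomorphic_at f p.
Proof. by move=> pr hf; have [a ha] := An_ps (An_shift pr hf); exists a. Qed.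

(** By Cauchy's inequality at radius t, a coefficient of degree d < k is at
most a constant times t^(k - d), for all small t. *)
Lemma An_bigO n k (f : 'rV[C]_n -> C) : An f ->
  (exists K r : R, 0 < r /\ forall h, vn h <= r -> nm (f h) <= K * vn h ^+ k) ->
  bigO_series k f.
Proof.
move=> [r [r0 /(apx_ps r0)[a [aB ha]]]] [K' [q [q0 hq']]].
pose K := `|K'|.
have hq h : vn h <= q -> nm (f h) <= K * vn h ^+ k.
  move=> /hq' /le_trans; apply; rewrite ler_wpM2r ?exprn_ge0 ?vn_ge0 //; exact: ler_norm.
have K0 : 0 <= K by exact: normr_ge0.
exists a; split; last by apply/near0P; exists (r / 2); split=> //; lra.
move=> m mk; apply: eq0_small => e e0.
pose t := Num.min (Num.min r q) (Num.min 1 (e / (K + 1))).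
have t0 : 0 < t by rewrite !lt_min r0 q0 ltr01 divr_gt0 //; lra.
have [tr tq t1 te] : [/\ t <= r, t <= q, t <= 1 & t <= e / (K + 1)].
  by rewrite /t !ge_min !lexx !orbT.
have := aB t (K * t ^+ k) (ltW t0) tr.
have h1 h : vn h <= t -> nm (f h) <= K * t ^+ k.
  move=> ht; rewrite (le_trans (hq _ (le_trans ht tq))) // ler_wpM2l //.
  by rewrite lerXn2r // ?nnegrE ?vn_ge0 // ltW.
move=> /(_ h1 m).
have -> : k = ((k - (mdegree m).+1) + 1 + mdegree m)%N by lia.
rewrite exprD mulrA ler_pM2r ?exprn_gt0 // exprD expr1 mulrA => /le_trans; apply.
apply: (@le_trans _ _ (K * t)).
  rewrite ler_pM2r // ler_piMr // exprn_ile1 // ltW //.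
move: te; rewrite ler_pdivlMr; last by lra.
by move: K0 => {aB}; nra.
Qed.

Lemma An_bounded m (f : 'rV[C]_m -> C) : An f ->
  exists K r : R, 0 < r /\ forall h, vn h <= r -> nm (f h) <= K * vn h ^+ 0.
Proof.
move=> /An_Lip[K [r [K0 r0 h]]]; exists (K * r + nm (f 0)), r; split=> // x xr.
rewrite expr0 mulr1 -[f x](subrK (f 0)) (le_trans (nmD _ _)) // lerD2r.
have := h x 0 xr; rewrite vn0 subr0 => /(_ (ltW r0)) /le_trans; apply.
by rewrite ler_pM2l.
Qed.

(** On the points of a small ball whose image lies in that ball, F and G
are mutually inverse; these points form open sets. *)
Lemma local_coords n (F G : 'rV[C]_n -> 'rV[C]_n) : AnV F -> AnV G ->
  F 0 = 0 -> G 0 = 0 -> near0 (fun p => G (F p) = p) -> near0 (fun q => F (G q) = q) ->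
  local_holomorphic_coordinates F.
Proof.
move=> /AnV_apx[r1 [r10 h1]] /AnV_apx[r2 [r20 h2]] F0 G0 [r3 [r30 h3]] [r4 [r40 h4]].
pose r := Num.min (Num.min r1 r2) (Num.min r3 r4).
have r0 : 0 < r by rewrite !lt_min r10 r20 r30.
have [e1 e2 e3 e4] : [/\ r <= r1, r <= r2, r <= r3 & r <= r4].
  by rewrite /r !ge_min !lexx !orbT.
have op (H : 'rV[C]_n -> 'rV[C]_n) : (forall i, apx r (fun h => H h 0 i)) ->
    open [set p | vn p < r /\ vn (H p) < r].
  move=> hH; rewrite openE => p [/= pr Hr].
  have hV : AnV (fun h => H (p + h) - H p).
    move=> i; have hi := An_shift pr (hH i).
    by apply: (An_eq (AnB hi (An_cst _ (H p 0 i)))) => h; rewrite !mxE.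
  have z : H (p + 0) - H p = 0 by rewrite addr0 subrr.
  have [|q [q0 hq]] := LipV_small (AnV_Lip hV) z (e := (r - vn (H p)) / 2); first by lra.
  apply/nbhsC; exists (Num.min q ((r - vn p) / 2)); first by rewrite lt_min q0; lra.
  move=> x; rewrite le_min => /andP[xq xr]; split=> /=.
    by have := vnD (x - p) p; rewrite subrK; lra.
  have := hq _ xq; rewrite [p + _]addrC subrK => hx.
  by have := vnD (H x - H p) (H p); rewrite subrK; lra.
have aF i : apx r (fun h => F h 0 i) by apply: apx_le (h1 i).
have aG i : apx r (fun h => G h 0 i) by apply: apx_le (h2 i).
exists [set p | vn p < r /\ vn (F p) < r], [set p | vn p < r /\ vn (G p) < r], G.
split.
- by split; exact: op.
- by split=> //=; rewrite F0 vn0.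
- move=> p [/= pr Fr]; have e : G (F p) = p by apply: h3; lra.
  by rewrite e.
- move=> p [/= pr Gr]; have e : F (G p) = p by apply: h4; lra.
  by rewrite e.
- by split=> p [/= pr _] j; [exact: apx_holomorphic (aF j)|exact: apx_holomorphic (aG j)].
Qed.

End Interface.

(** * Vector-valued germs *)

Section VectorGerms.
Variable R : realType.
Local Notation C := (Cplx R).

Lemma near0_comp n m (P : 'rV[C]_n -> Prop) (F : 'rV[C]_m -> 'rV[C]_n) :
  near0 P -> LipV F -> F 0 = 0 -> near0 (fun h => P (F h)).
Proof.
move=> [r [r0 hP]] hF F0; have [q [q0 hq]] := LipV_small hF F0 r0.
by exists q; split=> // h /hq/hP.
Qed.

Lemma AnV_eq n m (F G : 'rV[C]_n -> 'rV[C]_m) : AnV F -> F =1 G -> AnV G.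
Proof. by move=> hF /funext <-. Qed.
Lemma flatV_eq n m (F G : 'rV[C]_n -> 'rV[C]_m) : flatV F -> F =1 G -> flatV G.
Proof. by move=> hF /funext <-. Qed.

Lemma AnV_id n : AnV (fun h : 'rV[C]_n => h).
Proof. by move=> i; exact: An_X. Qed.
Lemma AnV_cst n m (v : 'rV[C]_m) : AnV (fun _ : 'rV[C]_n => v).
Proof. by move=> i; exact: An_cst. Qed.
Lemma AnV_add n m (F G : 'rV[C]_n -> 'rV[C]_m) : AnV F -> AnV G -> AnV (fun h => F h + G h).
Proof. by move=> hF hG i; apply: (An_eq (AnD (hF i) (hG i))) => h; rewrite mxE. Qed.
Lemma AnV_scale n m c (F : 'rV[C]_n -> 'rV[C]_m) : AnV F -> AnV (fun h => c *: F h).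
Proof. by move=> hF i; apply: (An_eq (AnZ c (hF i))) => h; rewrite mxE. Qed.
Lemma AnV_opp n m (F : 'rV[C]_n -> 'rV[C]_m) : AnV F -> AnV (fun h => - F h).
Proof. by move=> hF i; apply: (An_eq (AnN (hF i))) => h; rewrite mxE. Qed.
Lemma AnV_sub n m (F G : 'rV[C]_n -> 'rV[C]_m) : AnV F -> AnV G -> AnV (fun h => F h - G h).
Proof. by move=> hF hG; apply: AnV_add => //; exact: AnV_opp. Qed.
Lemma AnV_lsub n m k (F : 'rV[C]_n -> 'rV[C]_(m + k)) : AnV F -> AnV (fun h => lsubmx (F h)).
Proof. by move=> hF i; apply: (An_eq (hF (lshift k i))) => h; rewrite mxE. Qed.
Lemma AnV_rsub n m k (F : 'rV[C]_n -> 'rV[C]_(m + k)) : AnV F -> AnV (fun h => rsubmx (F h)).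
Proof. by move=> hF i; apply: (An_eq (hF (rshift m i))) => h; rewrite mxE. Qed.
Lemma AnV_row n m k (F : 'rV[C]_n -> 'rV[C]_m) (G : 'rV[C]_n -> 'rV[C]_k) :
  AnV F -> AnV G -> AnV (fun h => row_mx (F h) (G h)).
Proof.
move=> hF hG i; have [j ->|j ->] := split_ordP i.
  by apply: (An_eq (hF j)) => h; rewrite row_mxEl.
by apply: (An_eq (hG j)) => h; rewrite row_mxEr.
Qed.
Lemma AnV_mul n m k (F : 'rV[C]_n -> 'rV[C]_m) (A : 'M[C]_(m, k)) :
  AnV F -> AnV (fun h => F h *m A).
Proof.
move=> hF i; have : An (fun h => \sum_j A j i * F h 0 j).
  by apply: An_sum => j _; exact: AnZ.
by move=> h1; apply: (An_eq h1) => h; rewrite mxE; apply: eq_bigr => j _; rewrite mulrC.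
Qed.
Lemma AnV_comp n m k (F : 'rV[C]_n -> 'rV[C]_k) (G : 'rV[C]_m -> 'rV[C]_n) :
  AnV F -> AnV G -> G 0 = 0 -> AnV (fun h => F (G h)).
Proof. by move=> hF hG G0 i; exact: (An_comp (hF i)). Qed.
Definition conjV n m (F : 'rV[C]_n -> 'rV[C]_m) : 'rV[C]_n -> 'rV[C]_m :=
  fun h => map_mx Num.conj (F (map_mx Num.conj h)).
Lemma AnV_conjV n m (F : 'rV[C]_n -> 'rV[C]_m) : AnV F -> AnV (conjV F).
Proof. by move=> hF i; apply: (An_eq (An_conj (hF i))) => h; rewrite mxE. Qed.

Lemma flatV_add n m (F G : 'rV[C]_n -> 'rV[C]_m) :
  flatV F -> flatV G -> flatV (fun h => F h + G h).
Proof.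
by move=> hF hG i; have := flatD (hF i) (hG i); apply: flat_ext => h; rewrite mxE.
Qed.
Lemma flatV_scale n m c (F : 'rV[C]_n -> 'rV[C]_m) : flatV F -> flatV (fun h => c *: F h).
Proof. by move=> hF i; have := flatZ c (hF i); apply: flat_ext => h; rewrite mxE. Qed.
Lemma flatV_0 n m : flatV (fun _ : 'rV[C]_n => 0 : 'rV[C]_m).
Proof. by move=> i; have := flat0 R n; apply: flat_ext => h; rewrite mxE. Qed.
Lemma flatV_sub n m (F G : 'rV[C]_n -> 'rV[C]_m) :
  flatV F -> flatV G -> flatV (fun h => F h - G h).
Proof.
move=> hF hG; have := flatV_add hF (flatV_scale (-1) hG).
by move=> /flatV_eq; apply=> h; rewrite scaleN1r.
Qed.
Lemma flatV_comp n m k (F : 'rV[C]_n -> 'rV[C]_k) (G : 'rV[C]_m -> 'rV[C]_n) :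
  flatV F -> LipV G -> G 0 = 0 -> flatV (fun h => F (G h)).
Proof. by move=> hF hG G0 i; exact: (flat_comp (hF i)). Qed.
Lemma flatV_row n m k (F : 'rV[C]_n -> 'rV[C]_m) (G : 'rV[C]_n -> 'rV[C]_k) :
  flatV F -> flatV G -> flatV (fun h => row_mx (F h) (G h)).
Proof.
move=> hF hG i; have [j ->|j ->] := split_ordP i.
  by have := hF j; apply: flat_ext => h; rewrite row_mxEl.
by have := hG j; apply: flat_ext => h; rewrite row_mxEr.
Qed.
Lemma flatV_rsub n m k (F : 'rV[C]_n -> 'rV[C]_(m + k)) : flatV F -> flatV (fun h => rsubmx (F h)).
Proof. by move=> hF i; have := hF (rshift m i); apply: flat_ext => h; rewrite mxE. Qed.
Lemma flat_conj n (f : 'rV[C]_n -> C) : flat f -> flat (conjf f).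
Proof.
move=> [f0 hf]; split; first by rewrite /conjf map_mx0 f0 conjC0.
move=> e /hf[r [r0 hr]]; exists r; split=> // h k hh hk.
rewrite /conjf -rmorphB nm_conj.
have := hr (map_mx Num.conj h) (map_mx Num.conj k); rewrite -map_mxB !vn_conj.
exact.
Qed.
Lemma flatV_conjV n m (F : 'rV[C]_n -> 'rV[C]_m) : flatV F -> flatV (conjV F).
Proof. by move=> hF i; have := flat_conj (hF i); apply: flat_ext => h; rewrite mxE. Qed.
Lemma flatV_at0 n m (F : 'rV[C]_n -> 'rV[C]_m) : flatV F -> F 0 = 0.
Proof. by move=> /flatV_unif[]. Qed.
Lemma map_conjK m n (h : 'M[C]_(m, n)) : map_mx Num.conj (map_mx Num.conj h) = h.
Proof. by apply/matrixP => i j; rewrite !mxE conjCK. Qed.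

Lemma conj_addi n (u v : 'rV[C]_n) :
  map_mx Num.conj (u + ('i : C) *: v) = map_mx Num.conj u - ('i : C) *: map_mx Num.conj v.
Proof. by apply/rowP => j; rewrite !mxE rmorphD rmorphM /= conjCi mulNr. Qed.
Lemma conj_subi n (u v : 'rV[C]_n) :
  map_mx Num.conj (u - ('i : C) *: v) = map_mx Num.conj u + ('i : C) *: map_mx Num.conj v.
Proof. by apply/rowP => j; rewrite !mxE rmorphB rmorphM /= conjCi mulNr opprK. Qed.

Lemma implicit_function_near0 k n (Q : 'rV[C]_(k + n) -> 'rV[C]_n) : AnV Q -> flatV Q ->
  exists phi : 'rV[C]_k -> 'rV[C]_n, [/\ AnV phi, flatV phi,
    near0 (fun x => phi x + Q (row_mx x (phi x)) = 0) &
    near0 (fun y => vn (rsubmx y - phi (lsubmx y)) <= 2 * vn (rsubmx y + Q y))].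
Proof.
move=> hQ fQ; have [phi [h1 h2 [r [r0 h3]]]] := implicit_function hQ fQ.
exists phi; split=> //; exists r; split=> // x hx.
  have [|//] := h3 x 0 hx; by rewrite vn0 ltW.
have := h3 (lsubmx x) (rsubmx x) (le_trans (vn_lsub _) hx) (le_trans (vn_rsub _) hx).
by rewrite hsubmxK => -[].
Qed.

End VectorGerms.

(** * Normal coordinates *)

Section NormalCoordinates.
Variables (R : realType) (n : nat).
Local Notation C := (Cplx R).
Local Notation ii := ('i : C).

(** A point (z, chi, u), where chi is an independent variable that takes the
value conj z on the submanifold. *)
Definition tri (z c : 'rV[C]_1) (u : 'rV[C]_n) : 'rV[C]_(1 + 1 + n) := row_mx (row_mx z c) u.
Definition tz (x : 'rV[C]_(1 + 1 + n)) : 'rV[C]_1 := lsubmx (lsubmx x).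
Definition tc (x : 'rV[C]_(1 + 1 + n)) : 'rV[C]_1 := rsubmx (lsubmx x).
Definition tu (x : 'rV[C]_(1 + 1 + n)) : 'rV[C]_n := rsubmx x.
Lemma tzE z c u : tz (tri z c u) = z. Proof. by rewrite /tz /tri !row_mxKl. Qed.
Lemma tcE z c u : tc (tri z c u) = c. Proof. by rewrite /tc /tri row_mxKl row_mxKr. Qed.
Lemma tuE z c u : tu (tri z c u) = u. Proof. by rewrite /tu /tri row_mxKr. Qed.
Lemma triK x : tri (tz x) (tc x) (tu x) = x.
Proof. by rewrite /tri /tz /tc /tu !hsubmxK. Qed.

(** The points (z, u + i v) and (chi, u - i v), which are conjugate to each
other when chi = conj z and u, v are real. *)
Definition point_pair (y : 'rV[C]_(1 + 1 + n + n)) : 'rV[C]_((1 + n) + (1 + n)) :=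
  let x := lsubmx y in let v := rsubmx y in
  row_mx (row_mx (tz x) (tu x + ii *: v)) (row_mx (tc x) (tu x - ii *: v)).
Lemma point_pairE z c u v : point_pair (row_mx (tri z c u) v) =
  row_mx (row_mx z (u + ii *: v)) (row_mx c (u - ii *: v)).
Proof. by rewrite /point_pair row_mxKl row_mxKr tzE tcE tuE. Qed.

Lemma AnV_tz m (F : 'rV[C]_m -> 'rV[C]_(1 + 1 + n)) : AnV F -> AnV (fun y => tz (F y)).
Proof. by move=> hF; do 2!apply: AnV_lsub. Qed.
Lemma AnV_tc m (F : 'rV[C]_m -> 'rV[C]_(1 + 1 + n)) : AnV F -> AnV (fun y => tc (F y)).
Proof. by move=> hF; apply: AnV_rsub; apply: AnV_lsub. Qed.
Lemma AnV_tu m (F : 'rV[C]_m -> 'rV[C]_(1 + 1 + n)) : AnV F -> AnV (fun y => tu (F y)).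
Proof. by move=> hF; apply: AnV_rsub. Qed.
Lemma AnV_tri m (F G : 'rV[C]_m -> 'rV[C]_1) (H : 'rV[C]_m -> 'rV[C]_n) :
  AnV F -> AnV G -> AnV H -> AnV (fun y => tri (F y) (G y) (H y)).
Proof. by move=> hF hG hH; do 2?apply: AnV_row. Qed.
Lemma tri0 : tri 0 0 0 = 0. Proof. by rewrite /tri !row_mx0. Qed.

Lemma AnV_point_pair : AnV point_pair.
Proof.
have h1 : AnV (fun y : 'rV[C]_(1 + 1 + n + n) => lsubmx y) by apply: AnV_lsub; exact: AnV_id.
have h2 : AnV (fun y : 'rV[C]_(1 + 1 + n + n) => ii *: rsubmx y).
  by apply: AnV_scale; apply: AnV_rsub; exact: AnV_id.
apply: AnV_row; apply: AnV_row; rewrite /tz /tc /tu.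
- by apply: AnV_tz.
- by apply: AnV_add => //; exact: AnV_tu.
- by apply: AnV_tc.
- by apply: AnV_sub => //; exact: AnV_tu.
Qed.
Lemma point_pair0 : point_pair 0 = 0.
Proof.
by rewrite -[X in point_pair X]row_mx0 -tri0 point_pairE scaler0 subr0 addr0 !row_mx0.
Qed.

(** (w - tau) / 2 i for a pair (z, w), (chi, tau): it is v on the pairs of the
previous definition. *)
Definition lin2 (y : 'rV[C]_((1 + n) + (1 + n))) : 'rV[C]_n :=
  (2 * ii)^-1 *: (rsubmx (lsubmx y) - rsubmx (rsubmx y)).
Lemma i2_neq0 : 2 * ii != 0.
Proof. by rewrite mulf_neq0 ?pnatr_eq0 // neq0Ci. Qed.
Lemma lin2_point_pair y : lin2 (point_pair y) = rsubmx y.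
Proof.
rewrite /lin2 /point_pair row_mxKl !row_mxKr.
move: (tu _) (rsubmx y) => u v; apply/rowP => j; rewrite !mxE; field.
exact: neq0Ci.
Qed.

(** n equations in a pair of points, real when the points are conjugate to
each other, with linear part v. *)
Record herm_eq (P : 'rV[C]_((1 + n) + (1 + n)) -> 'rV[C]_n) : Prop := HermEq {
  herm_an : AnV P;
  herm_sym : forall p q, P (row_mx (map_mx Num.conj p) (map_mx Num.conj q)) =
                         map_mx Num.conj (P (row_mx q p));
  herm_lin : flatV (fun y => P y - lin2 y) }.

(** An antilinear involution; its fixed points are those with chi = conj z
and u real. *)
Definition mirror (x : 'rV[C]_(1 + 1 + n)) : 'rV[C]_(1 + 1 + n) :=
  tri (map_mx Num.conj (tc x)) (map_mx Num.conj (tz x)) (map_mx Num.conj (tu x)).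

Lemma vn_tri z c u d : vn z <= d -> vn c <= d -> vn u <= d -> vn (tri z c u) <= d.
Proof. by move=> *; do 2?apply: vn_row_mx. Qed.
Lemma vn_mirror x : vn (mirror x) <= vn x.
Proof.
apply: vn_tri; rewrite vn_conj /tc /tz /tu ?vn_rsub //.
  by rewrite (le_trans (vn_rsub _)) // vn_lsub.
by rewrite (le_trans (vn_lsub _)) // vn_lsub.
Qed.

(** Conjugating the equations shows that conj (phi x) solves them at the
mirror point of x, where phi is the only solution. *)
Lemma hermitian_graph P : herm_eq P ->
  exists phi : 'rV[C]_(1 + 1 + n) -> 'rV[C]_n, [/\ AnV phi, flatV phi,
    near0 (fun x => phi (mirror x) = map_mx Num.conj (phi x)),
    near0 (fun x => P (point_pair (row_mx x (phi x))) = 0) &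
    near0 (fun y => vn (rsubmx y - phi (lsubmx y)) <= 2 * vn (P (point_pair y)))].
Proof.
move=> [aP sP lP].
have hQ : AnV (fun y => P (point_pair y) - rsubmx y).
  apply: AnV_sub; first by apply: AnV_comp => //; [exact: AnV_point_pair|exact: point_pair0].
  by apply: AnV_rsub; exact: AnV_id.
have fQ : flatV (fun y => P (point_pair y) - rsubmx y).
  have := flatV_comp lP (AnV_Lip AnV_point_pair) point_pair0 => /flatV_eq; apply=> y.
  by rewrite lin2_point_pair.
have [phi [h1 h2 h3 h4]] := implicit_function_near0 hQ fQ.
have h3' : near0 (fun x => P (point_pair (row_mx x (phi x))) = 0).
  by apply: near0_sub h3 => x; rewrite row_mxKr addrC subrK.
have h4' : near0 (fun y => vn (rsubmx y - phi (lsubmx y)) <= 2 * vn (P (point_pair y))).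
  by apply: near0_sub h4 => y; rewrite [rsubmx y + (_ - _)]addrCA subrr addr0.
exists phi; split=> //.
have [r [r0 hr]] := h3'; have [q [q0 hq]] := h4'.
have [s [s0 hs]] := LipV_small (AnV_Lip h1) (flatV_at0 h2) q0.
pose t := Num.min r (Num.min q s).
have [tr tq ts] : [/\ t <= r, t <= q & t <= s] by rewrite /t !ge_min !lexx !orbT.
exists t; split; first by rewrite !lt_min r0 q0.
move=> x hx; set psi := phi x.
have hsw := le_trans (vn_mirror x) hx.
suff E0 : P (point_pair (row_mx (mirror x) (map_mx Num.conj psi))) = 0.
  have := hq (row_mx (mirror x) (map_mx Num.conj psi)).
  rewrite E0 vn0 mulr0 row_mxKl row_mxKr => h.
  have /vn_eq0/eqP : vn (map_mx Num.conj psi - phi (mirror x)) <= 0.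
    by apply: h; apply: vn_row_mx; [lra|rewrite vn_conj; apply: hs; lra].
  by rewrite subr_eq0 => /eqP.
have := hr x (le_trans hx tr); rewrite -{1}[x]triK point_pairE => /(congr1 (map_mx Num.conj)).
rewrite -sP map_mx0 => <-; congr P.
by rewrite point_pairE !map_row_mx conj_addi conj_subi.
Qed.

Lemma near0_conj m (Q : 'rV[C]_m -> Prop) : near0 Q -> near0 (fun h => Q (map_mx Num.conj h)).
Proof. by move=> [r [r0 hr]]; exists r; split=> // h hh; apply: hr; rewrite vn_conj. Qed.

Lemma LipV_of_flat m (G : 'rV[C]_m -> 'rV[C]_m) : flatV (fun q => G q - q) -> LipV G /\ G 0 = 0.
Proof.
move=> fG; split; last by have := flatV_at0 fG; rewrite subr0.
move=> i; have [K [r [K0 r0 hr]]] := flat_Lip (fG i).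
exists (K + 1), r; split=> // [|h k hh hk]; first lra.
have := hr h k hh hk; rewrite !mxE => h1.
have -> : G h 0 i - G k 0 i = (G h 0 i - h 0 i - (G k 0 i - k 0 i)) + (h - k) 0 i.
  by rewrite !mxE; ring.
by rewrite (le_trans (nmD _ _)) // mulrDl mul1r lerD // le_vn.
Qed.

(** A change of coordinates acts on the first point of a pair, and its
conjugate on the second. *)
Definition double (G : 'rV[C]_(1 + n) -> 'rV[C]_(1 + n)) (y : 'rV[C]_((1 + n) + (1 + n))) :=
  row_mx (G (lsubmx y)) (conjV G (rsubmx y)).

Lemma herm_change P G : herm_eq P -> AnV G -> flatV (fun q => G q - q) ->
  herm_eq (fun y => P (double G y)).
Proof.
move=> [aP sP lP] aG fG; have [_ G0] := LipV_of_flat fG.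
have cG0 : conjV G 0 = 0 by rewrite /conjV map_mx0 G0 map_mx0.
have aD : AnV (double G).
  apply: AnV_row; first by apply: AnV_comp => //; [by apply: AnV_lsub; exact: AnV_id|rewrite linear0].
  apply: AnV_comp => //; last by rewrite linear0.
  - exact: AnV_conjV.
  - by apply: AnV_rsub; exact: AnV_id.
have D0 : double G 0 = 0 by rewrite /double !linear0 G0 cG0 row_mx0.
split.
- exact: AnV_comp.
- move=> p q; rewrite /double !row_mxKl !row_mxKr /conjV !map_conjK.
  by rewrite -{1}[G (map_mx _ p)]map_conjK sP.
- have fcG : flatV (fun q => conjV G q - q).
    have := flatV_conjV fG => /flatV_eq; apply=> q.
    by rewrite /conjV raddfB /= map_conjK.
  have fl : flatV (fun y : 'rV[C]_((1 + n) + (1 + n)) => G (lsubmx y) - lsubmx y).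
    apply: (flatV_comp (F := fun q => G q - q)) => //; last by rewrite linear0.
    by apply: AnV_Lip; by apply: AnV_lsub; exact: AnV_id.
  have fr : flatV (fun y : 'rV[C]_((1 + n) + (1 + n)) => conjV G (rsubmx y) - rsubmx y).
    apply: (flatV_comp (F := fun q => conjV G q - q)) => //; last by rewrite linear0.
    by apply: AnV_Lip; by apply: AnV_rsub; exact: AnV_id.
  have h1 := flatV_comp lP (AnV_Lip aD) D0.
  have h2 := flatV_scale (2 * ii)^-1 (flatV_sub (flatV_rsub fl) (flatV_rsub fr)).
  have := flatV_add h1 h2 => /flatV_eq; apply=> y.
  rewrite /lin2 /double row_mxKl row_mxKr !raddfB /=.
  move: (P _) (rsubmx (G _)) (rsubmx (conjV G _)) (rsubmx (lsubmx y)) (rsubmx (rsubmx y)).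
  by move=> a b c d e; apply/rowP => j; rewrite !mxE; ring.
Qed.

(** phi vanishes for chi = 0 when (z, w) and (0, w) always form a pair that
solves the equations. In the first coordinates the solutions with chi = 0 are
the pairs (z, u + i f (z, 0, u)), (0, u - i f (z, 0, u)). Let U (z, w) solve
w + U - i f (z, 0, w + U) = w - i f (0, 0, w); then for u = w + U the second
point does not depend on z, and G sends (z, w) to the first one. *)
Theorem normal_coordinates P : herm_eq P ->
  exists G phi, [/\ AnV G, flatV (fun q => G q - q), AnV phi, flatV phi &
   [/\ near0 (fun x => phi (mirror x) = map_mx Num.conj (phi x)),
    near0 (fun x => phi (tri (tz x) 0 (tu x)) = 0),
    near0 (fun x => phi (tri 0 (tc x) (tu x)) = 0),
    near0 (fun x => P (double G (point_pair (row_mx x (phi x)))) = 0) &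
    near0 (fun y => vn (rsubmx y - phi (lsubmx y)) <= 2 * vn (P (double G (point_pair y))))]].
Proof.
move=> hP; have [f [af ff sf ef _]] := hermitian_graph hP.
have f0 := flatV_at0 ff.
(* T1 and T2 send ((z, w), U) to (z, 0, w + U) and (0, 0, w) *)
pose T1 (y : 'rV[C]_((1 + n) + n)) := tri (lsubmx (lsubmx y)) 0 (rsubmx (lsubmx y) + rsubmx y).
pose T2 (y : 'rV[C]_((1 + n) + n)) := tri 0 0 (rsubmx (lsubmx y)).
have aid : AnV (fun y : 'rV[C]_((1 + n) + n) => y) by exact: AnV_id.
have aT1 : AnV T1.
  apply: AnV_tri; [by do 2!apply: AnV_lsub|exact: AnV_cst|].
  by apply: AnV_add; [apply: AnV_rsub; exact: AnV_lsub|exact: AnV_rsub].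
have aT2 : AnV T2.
  by apply: AnV_tri; [exact: AnV_cst|exact: AnV_cst|apply: AnV_rsub; exact: AnV_lsub].
have T10 : T1 0 = 0 by rewrite /T1 !linear0 addr0 tri0.
have T20 : T2 0 = 0 by rewrite /T2 !linear0 tri0.
pose Q y := ii *: f (T2 y) - ii *: f (T1 y).
have aQ : AnV Q by apply: AnV_sub; apply: AnV_scale; exact: AnV_comp.
have fQ : flatV Q.
  by apply: flatV_sub; apply: flatV_scale; apply: flatV_comp => //; exact: AnV_Lip.
have [U [aU fU eU bU]] := implicit_function_near0 aQ fQ.
have U0 := flatV_at0 fU.
pose sh (q : 'rV[C]_(1 + n)) := tri (lsubmx q) 0 (rsubmx q + U q).
have aid' : AnV (fun q : 'rV[C]_(1 + n) => q) by exact: AnV_id.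
have ash : AnV sh.
  apply: AnV_tri; [exact: AnV_lsub|exact: AnV_cst|].
  by apply: AnV_add => //; exact: AnV_rsub.
have sh0 : sh 0 = 0 by rewrite /sh !linear0 U0 addr0 tri0.
pose G (q : 'rV[C]_(1 + n)) := row_mx (lsubmx q) (rsubmx q + U q + ii *: f (sh q)).
have aG : AnV G.
  apply: AnV_row; first exact: AnV_lsub.
  apply: AnV_add; first by apply: AnV_add => //; exact: AnV_rsub.
  by apply: AnV_scale; exact: AnV_comp.
have fG : flatV (fun q => G q - q).
  have : flatV (fun q => row_mx (0 : 'rV[C]_1) (U q + ii *: f (sh q))).
    apply: flatV_row; first exact: flatV_0.
    apply: flatV_add => //; apply: flatV_scale; apply: flatV_comp => //; exact: AnV_Lip.
  move=> /flatV_eq; apply=> q; rewrite /G -[X in _ - X]hsubmxK opp_row_mx add_row_mx subrr.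
  by congr row_mx; apply/rowP => j; rewrite !mxE; ring.
have U00 : near0 (fun t : 'rV[C]_n => U (row_mx 0 t) = 0).
  pose V (t : 'rV[C]_n) : 'rV[C]_((1 + n) + n) := row_mx (row_mx 0 t) 0.
  have aV : AnV V.
    by apply: AnV_row; [apply: AnV_row; [exact: AnV_cst|exact: AnV_id]|exact: AnV_cst].
  have V0 : V 0 = 0 by rewrite /V !row_mx0.
  have := near0_comp bU (AnV_Lip aV) V0; apply: near0_sub => t.
  rewrite /Q /T1 /T2 /V row_mxKl !row_mxKr row_mxKl addr0 subrr addr0 vn0 mulr0.
  by move=> /vn_eq0/eqP; rewrite sub0r oppr_eq0 => /eqP.
have [phi [aphi fphi sphi ephi bphi]] := hermitian_graph (herm_change hP aG fG).
exists G, phi; split=> //.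
pose pz x : 'rV[C]_(1 + n) := row_mx (tz x) (tu x).
have aidx : AnV (fun x : 'rV[C]_(1 + 1 + n) => x) by exact: AnV_id.
have apz : AnV pz by apply: AnV_row; [exact: AnV_tz|exact: AnV_tu].
have t0 : (tz (0 : 'rV[C]_(1 + 1 + n)) = 0) * (tc (0 : 'rV[C]_(1 + 1 + n)) = 0) * (tu (0 : 'rV[C]_(1 + 1 + n)) = 0).
  by rewrite /tz /tc /tu !linear0.
have pz0 : pz 0 = 0 by rewrite /pz !t0 row_mx0.
have van1 : near0 (fun x => phi (tri (tz x) 0 (tu x)) = 0).
  pose V1 x : 'rV[C]_(1 + 1 + n + n) := row_mx (tri (tz x) 0 (tu x)) 0.
  have aV1 : AnV V1.
    apply: AnV_row; last exact: AnV_cst.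
    by apply: AnV_tri; [exact: AnV_tz|exact: AnV_cst|exact: AnV_tu].
  have V10 : V1 0 = 0 by rewrite /V1 !t0 tri0 row_mx0.
  have n1 := near0_comp bphi (AnV_Lip aV1) V10.
  have n2 := near0_comp eU (AnV_Lip apz) pz0.
  have z3 : sh (pz 0) = 0 by rewrite pz0 sh0.
  have n3 := near0_comp ef (AnV_Lip (AnV_comp ash apz pz0)) z3.
  have tuL : AnV (fun x => tu x) by exact: AnV_tu.
  have n4 := near0_comp (near0_conj U00) (AnV_Lip tuL) (t0.2).
  have a00 : AnV (fun x => tri 0 0 (tu x)) by apply: AnV_tri; [exact: AnV_cst|exact: AnV_cst|exact: AnV_tu].
  have z5 : tri 0 0 (tu 0) = 0 by rewrite t0 tri0.
  have n5 := near0_comp sf (AnV_Lip a00) z5.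
  apply: near0_sub (near0_and n1 (near0_and n2 (near0_and n3 (near0_and n4 n5)))) => x [e1 [e2 [e3 [e4 e5]]]].
  have el : lsubmx (pz x) = tz x by rewrite row_mxKl.
  have er : rsubmx (pz x) = tu x by rewrite row_mxKr.
  have shE : sh (pz x) = tri (tz x) 0 (tu x + U (pz x)) by rewrite /sh el er.
  suff E0 : P (double G (point_pair (V1 x))) = 0.
    move: e1; rewrite E0 vn0 mulr0 /V1 row_mxKl row_mxKr sub0r vnN.
    by move=> /vn_eq0.
  rewrite /V1 point_pairE scaler0 addr0 subr0 /double row_mxKl row_mxKr -/(pz x).
  have E2 : conjV G (row_mx 0 (tu x)) = row_mx 0 (tu x - ii *: f (tri 0 0 (tu x))).
    have c0 : map_mx Num.conj (0 : 'rV[C]_1) = 0 by apply/rowP => j; rewrite !mxE conjC0.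
    rewrite /conjV (map_row_mx _ (0 : 'rV[C]_1)) c0 /G /sh row_mxKl row_mxKr e4 addr0.
    move: e5; rewrite /mirror tzE tcE tuE c0 => ->.
    by rewrite map_row_mx c0 conj_addi !map_conjK.
  have aux (a b s t : 'rV[C]_n) :
      s + (ii *: a - ii *: b) = 0 -> t - ii *: a = t + s - ii *: b.
    move=> /eqP; rewrite addr_eq0 opprB => /eqP ->.
    by apply/rowP => j; rewrite !mxE; ring.
  have E3 : tu x - ii *: f (tri 0 0 (tu x)) = tu x + U (pz x) - ii *: f (sh (pz x)).
    move: e2; rewrite /Q /T1 /T2 !row_mxKl !row_mxKr -shE.
    exact: aux.
  rewrite E2 E3; move: e3; rewrite {1}shE point_pairE => <-; congr (P (row_mx (row_mx _ _) _)).
    by rewrite el.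
  by rewrite er.
split=> //.
(* the case z = 0 is the mirror image of the case chi = 0 *)
have [r [r0 hr]] := van1; have [q [q0 hq]] := sphi.
exists (Num.min r q); split; first by rewrite lt_min r0.
move=> x; rewrite le_min => /andP[xr xq].
have xr' := le_trans (vn_mirror x) xr.
have := hr _ xr'; rewrite {1}/mirror tzE tuE => h.
have xt : vn (tri 0 (tc x) (tu x)) <= q.
  apply: vn_tri; first by rewrite vn0 ltW.
    by rewrite (le_trans (vn_rsub _)) // (le_trans (vn_lsub _)).
  by rewrite (le_trans (vn_rsub _)).
have c0 : map_mx Num.conj (0 : 'rV[C]_1) = 0 by apply/rowP => j; rewrite !mxE conjC0.
have := hq _ xt; rewrite {1}/mirror tzE tcE tuE c0 h => /(congr1 (map_mx Num.conj)).
by rewrite map_conjK map_mx0.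
Qed.

End NormalCoordinates.

(** * Taylor expansion of the graphing function *)

Section Expansion.
Variables (R : realType).
Local Notation C := (Cplx R).

(** Divide by all the coordinates, then subtract from the quotients their
values at 0. *)
Lemma An_taylor2 n (h : 'rV[C]_n -> C) : An h ->
  exists (c : 'I_n -> C) (K : R), near0 (fun y =>
    nm (h y - h 0 - \sum_i c i * y 0 i) <= K * vn y ^+ 2) /\
    flat (fun y => h y - h 0 - \sum_i c i * y 0 i).
Proof.
move=> ha; have [g [hg e]] := An_division (enum_uniq 'I_n) ha.
exists (fun i => g i 0).
have /choice[K hK] i : exists K, 0 < K /\ near0 (fun y => nm (g i y - g i 0) <= K * vn y).
  have [K [r [K0 r0 hr]]] := An_Lip (hg i).
  exists K; split=> //; exists r; split=> // y yr.
  by have := hr y 0 yr; rewrite vn0 subr0 (ltW r0) => /(_ isT).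
exists (\sum_i K i); split; last first.
  have : flat (fun y : 'rV[C]_n => \sum_(i <- enum 'I_n) y 0 i * (g i y - g i 0)).
    apply: flat_sum => i; apply: flatM; rewrite ?mxE ?subrr //.
      by apply: An_Lip; exact: An_X.
    by apply: An_Lip; apply: AnB; [exact: hg|exact: An_cst].
  apply: flat_near0; apply: near0_sub e => y ->.
  have -> : zero_on (enum 'I_n) y = 0 by apply/rowP => j; rewrite !mxE mem_enum.
  rewrite [h 0 + _]addrC addrK -[X in _ = _ - X]big_enum /= -sumrB.
  by apply: eq_bigr => i _; rewrite mulrBr [g i 0 * _]mulrC.
have hQ : near0 (fun y => forall i, nm (g i y - g i 0) <= K i * vn y).
  have [r [r0 hr]] : exists r, 0 < r /\ forall i y, vn y <= r -> nm (g i y - g i 0) <= K i * vn y.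
    apply: common_radius => [i r r' rr h1 y yr|i]; last exact: (hK i).2.
    by apply: h1; exact: le_trans rr.
  by exists r; split=> // y yr i; exact: hr.
apply: near0_sub (near0_and e hQ) => y [-> hr].
have -> : zero_on (enum 'I_n) y = 0 by apply/rowP => j; rewrite !mxE mem_enum.
have -> : h 0 + \sum_(i <- enum 'I_n) y 0 i * g i y - h 0 - \sum_i g i 0 * y 0 i =
  \sum_i y 0 i * (g i y - g i 0).
  rewrite [h 0 + _]addrC addrK big_enum /= -sumrB.
  by apply: eq_bigr => i _; rewrite mulrBr [g i 0 * _]mulrC.
rewrite (le_trans (nm_sum _ _ _)) // mulr_suml ler_sum // => i _.
by rewrite nmM expr2 mulrCA ler_pM ?nm_ge0 ?le_vn.
Qed.

(** H is the quotient of f by z chi, expanded to first order in (z, chi) at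
u = 0; A is the remainder O_2 (z, chi) and B the quotients by the u_k. *)
Definition expansion n (f H : 'rV[C]_(1 + 1 + n) -> C) (a b g : C) (A : 'rV[C]_(1 + 1) -> C)
    (B : 'I_n -> 'rV[C]_(1 + 1 + n) -> C) : Prop :=
  [/\ An H, An A, (exists K : R, near0 (fun y => nm (A y) <= K * vn y ^+ 2)),
      (forall k, An (B k)) &
      near0 (fun x => f x = tz x 0 0 * tc x 0 0 * H x /\
        H x = a + b * tz x 0 0 + g * tc x 0 0 + A (lsubmx x) + \sum_k tu x 0 k * B k x)].

(** Divide by z, by chi, then by the u_k, and apply Taylor's formula to
the restriction of the quotient to u = 0. *)
Lemma quotient_expansion n (f : 'rV[C]_(1 + 1 + n) -> C) : An f ->
  near0 (fun x => f (tri 0 (tc x) (tu x)) = 0) ->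
  near0 (fun x => f (tri (tz x) 0 (tu x)) = 0) ->
  exists H a b g A B, expansion f H a b g A B.
Proof.
move=> hf v0 v1.
pose i0 : 'I_(1 + 1 + n) := lshift n (lshift 1 0).
pose i1 : 'I_(1 + 1 + n) := lshift n (rshift 1 0).
have x0 (x : 'rV[C]_(1 + 1 + n)) : x 0 i0 = tz x 0 0 by rewrite !mxE.
have x1 (x : 'rV[C]_(1 + 1 + n)) : x 0 i1 = tc x 0 0 by rewrite !mxE.
have zs0 (x : 'rV[C]_(1 + 1 + n)) : zero_on [:: i0] x = tri 0 (tc x) (tu x).
  rewrite -[LHS]triK; congr tri; apply/rowP => j; rewrite !mxE inE.
  - by rewrite ord1 eqxx.
  - by rewrite ord1.
  - by rewrite eq_rlshift.
have zs1 (x : 'rV[C]_(1 + 1 + n)) : zero_on [:: i1] x = tri (tz x) 0 (tu x).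
  rewrite -[LHS]triK; congr tri; apply/rowP => j; rewrite !mxE inE.
  - by rewrite ord1.
  - by rewrite ord1 eqxx.
  - by rewrite eq_rlshift.
have [g0 [hg0 e0]] := An_div i0 hf.
have [H [hH e1]] := An_div i1 hg0.
pose s := [seq rshift (1 + 1) i | i <- enum 'I_n].
have us : uniq s by rewrite map_inj_uniq ?enum_uniq //; exact: rshift_inj.
have [B [hB eB]] := An_division us hH.
have zss x : zero_on s x = tri (tz x) (tc x) 0.
  rewrite -[LHS]triK; congr tri; apply/rowP => j; rewrite !mxE.
  - by case: ifP => // /mapP[l _ /eqP]; rewrite eq_lrshift.
  - by case: ifP => // /mapP[l _ /eqP]; rewrite eq_lrshift.
  - by rewrite (map_f (@rshift (1 + 1) n)) ?mem_enum.
(* the restriction of the quotient to u = 0 *)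
pose h (y : 'rV[C]_(1 + 1)) := H (row_mx y 0).
have ah : An h.
  apply: (An_comp hH); last by rewrite row_mx0.
  by apply: AnV_row; [exact: AnV_id|exact: AnV_cst].
have [c [K [hK _]]] := An_taylor2 ah.
exists H, (h 0), (c (lshift 1 0)), (c (rshift 1 0)),
  (fun y => h y - h 0 - \sum_i c i * y 0 i), (fun k => B (rshift (1 + 1) k)).
split=> //; first 2 last.
- have idz : LipV (fun x : 'rV[C]_(1 + 1 + n) => zero_on [:: i1] x).
    have aid : AnV (fun x : 'rV[C]_(1 + 1 + n) => x) by exact: AnV_id.
    have aV : AnV (fun x : 'rV[C]_(1 + 1 + n) => tri (tz x) 0 (tu x)).
      by apply: AnV_tri; [exact: AnV_tz|exact: AnV_cst|exact: AnV_tu].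
    by move=> i; apply: An_Lip; apply: (An_eq (aV i)) => x; rewrite zs1.
  have z0 : zero_on [:: i1] (0 : 'rV[C]_(1 + 1 + n)) = 0.
    by apply/rowP => j; rewrite !mxE; case: ifP.
  have e0' := near0_comp e0 idz z0; have v0' := near0_comp v0 idz z0.
  apply: near0_sub (near0_and e0 (near0_and e1 (near0_and eB (near0_and v0 (near0_and v1 (near0_and e0' v0')))))).
  move=> x [E0 [E1 [EB [V0 [V1 [E0' V0']]]]]]; split.
    rewrite zs0 V0 add0r x0 in E0; rewrite E0 E1 x1.
    suff : tz x 0 0 * g0 (zero_on [:: i1] x) = 0 by move=> h0; rewrite mulrDr h0 add0r mulrA.
    have tzz : tz (zero_on [:: i1] x) = tz x by rewrite zs1 tzE.
    by move: E0'; rewrite zs0 V0' add0r x0 tzz => <-; rewrite zs1 V1.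
  rewrite EB zss big_map /tri hsubmxK.
  have -> : \sum_(i <- enum 'I_n) x 0 (rshift (1 + 1) i) * B (rshift (1 + 1) i) x =
     \sum_k tu x 0 k * B (rshift (1 + 1) k) x.
    by rewrite big_enum /=; apply: eq_bigr => k _; rewrite [in RHS]mxE.
  congr (_ + _); rewrite -/(h (lsubmx x)) big_split_ord /= !big_ord1 !mxE.
  have -> : (ord0 : 'I_1) = 0 by exact: val_inj.
  by ring.
- by apply: AnB; [apply: AnB => //; exact: An_cst|apply: An_sum => i _; apply: AnZ; exact: An_X].
- by exists K.
Qed.

Lemma affine_small (a b K : R) (r : R) : 0 < r ->
  (forall t, 0 < t -> t <= r -> `|a + b * t| <= K * t ^+ 2) -> a = 0 /\ b = 0.
Proof.
move=> r0 h.
pose K1 := `|K| + 1.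
have K10 : 0 < K1 by rewrite ltr_pwDr.
have h1 t : 0 < t -> t <= r -> `|a + b * t| <= K1 * t ^+ 2.
  move=> t0 tr; rewrite (le_trans (h t t0 tr)) // ler_wpM2r ?exprn_ge0 ?ltW //.
  by have := ler_norm K; rewrite /K1; lra.
have a0 : a = 0.
  apply/eqP; rewrite -normr_eq0 eq_le normr_ge0 andbT leNgt; apply/negP => an.
  pose t := Num.min (Num.min r 1) (`|a| / (2 * (`|b| + K1))).
  have bK : 0 < `|b| + K1 by rewrite ltr_wpDl.
  have t0 : 0 < t by rewrite !lt_min r0 ltr01 divr_gt0 // mulr_gt0.
  have [tr t1 ta] : [/\ t <= r, t <= 1 & t <= `|a| / (2 * (`|b| + K1))].
    by rewrite /t !ge_min !lexx !orbT.
  have := h1 t t0 tr.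
  have : `|a| <= `|a + b * t| + `|b| * t.
    have {1}-> : a = (a + b * t) - b * t by ring.
    by rewrite (le_trans (ler_normB _ _)) // normrM (gtr0_norm t0).
  move: ta; rewrite ler_pdivlMr ?mulr_gt0 // => ta.
  have : K1 * t ^+ 2 <= K1 * t by rewrite ler_pM2l // expr2 ler_piMr // ltW.
  by nra.
split=> //; apply/eqP; rewrite -normr_eq0 eq_le normr_ge0 andbT leNgt; apply/negP => bn.
pose t := Num.min r (`|b| / (2 * K1)).
have t0 : 0 < t by rewrite lt_min r0 divr_gt0 // mulr_gt0.
have [tr ta] : t <= r /\ t <= `|b| / (2 * K1) by rewrite /t !ge_min !lexx !orbT.
have := h1 t t0 tr; rewrite a0 add0r normrM (gtr0_norm t0) expr2 mulrA ler_pM2r //.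
move: ta; rewrite ler_pdivlMr ?mulr_gt0 //; nra.
Qed.

(** At the points (z, conj z, 0) both f and z conj z are real, hence so is
H. Letting z = t and z = i t with t small and real separates the terms of order
0 and 1. *)
Lemma expansion_real n (f H : 'rV[C]_(1 + 1 + n) -> C) (a b g : C) (A : 'rV[C]_(1 + 1) -> C)
    (B : 'I_n -> 'rV[C]_(1 + 1 + n) -> C) :
  near0 (fun x => f (mirror x) = Num.conj (f x)) ->
  expansion f H a b g A B ->
  ImC a = 0 /\ g = Num.conj b.
Proof.
move=> [r1 [r10 h1]] [_ _ [K [r2 [r20 h2]]] _ [r3 [r30 h3]]].
pose r := Num.min r1 (Num.min r2 r3).
have r0 : 0 < r by rewrite !lt_min r10 r20.
have [e1 e2 e3] : [/\ r <= r1, r <= r2 & r <= r3] by rewrite /r !ge_min !lexx !orbT.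
have key (w : C) : w != 0 -> nm w <= r ->
    `|ImC (a + b * w + g * Num.conj w)| <= K * nm w ^+ 2.
  move=> w0 wr; pose x : 'rV[C]_(1 + 1 + n) := tri (const_mx w) (const_mx (Num.conj w)) 0.
  have vw : vn (lsubmx x) = nm w.
    rewrite row_mxKl; apply/eqP; rewrite eq_le; apply/andP; split.
      by apply: vn_row_mx; apply: vn_le => [|i]; rewrite ?nm_ge0 // mxE ?nm_conj.
    have := le_vn (row_mx (const_mx w : 'rV[C]_1) (const_mx (Num.conj w) : 'rV[C]_1)) (lshift 1 0).
    by rewrite row_mxEl mxE.
  have vx : vn x <= r.
    apply: vn_row_mx; last by rewrite vn0 ltW.
    by move: vw; rewrite row_mxKl => ->.
  have sx : mirror x = x.
    rewrite /mirror /x tzE tcE tuE map_mx0; congr tri; apply/rowP => j; rewrite !mxE //.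
    by rewrite conjCK.
  have [f1 f2] := h3 x (le_trans vx e3).
  have := h1 x (le_trans vx e1); rewrite sx f1 /x tzE tcE !mxE -/x => hreal.
  have hH : Num.conj (H x) = H x.
    have n0 : w * Num.conj w != 0 by rewrite mulf_neq0 // conjC_eq0.
    by apply: (mulfI n0); rewrite {1}hreal !rmorphM /= conjCK [Num.conj w * w]mulrC.
  have sum0 : \sum_k tu x 0 k * B k x = 0.
    by apply: big1 => k _; rewrite /x tuE mxE mul0r.
  move: (Im_real hH); rewrite f2 sum0 addr0 ImCD /x tzE tcE !mxE -/x => hI.
  have -> : ImC (a + b * w + g * Num.conj w) = - ImC (A (lsubmx x)) by lra.
  rewrite normrN (le_trans (nm_Im _)) // -vw; apply: h2; rewrite vw; lra.
have [a0 b0] : ImC a = 0 /\ ImC (b + g) = 0.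
  apply: (affine_small (K := K) r0) => t t0 tr.
  have := key (RtoC t); rewrite nm_real (gtr0_norm t0) conj_RtoC => k1.
  have -> : ImC a + ImC (b + g) * t = ImC (a + b * RtoC t + g * RtoC t).
    rewrite !ImCD mulrDl -addrA; congr (_ + (_ + _)).
      by case: (b) => p q; rewrite /RtoC /ImC /=; ring.
    by case: (g) => p q; rewrite /RtoC /ImC /=; ring.
  apply: k1 => //; apply/eqP => /(congr1 (@ReC R)); rewrite /RtoC /ReC /=; lra.
have [_ c0] : ImC a = 0 /\ ReC (b - g) = 0.
  apply: (affine_small (K := K) r0) => t t0 tr.
  have := key ('i * RtoC t); rewrite nmM nm_i mul1r nm_real (gtr0_norm t0).
  rewrite rmorphM /= conjCi conj_RtoC => k1.
  have -> : ImC a + ReC (b - g) * t = ImC (a + b * ('i * RtoC t) + g * (- 'i * RtoC t)).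
    rewrite !ImCD ReCD mulrDl -addrA; congr (_ + (_ + _)).
      by case: (b) => p q; rewrite iE /RtoC /ImC /ReC /=; ring.
    by case: (g) => p q; rewrite iE /RtoC /ImC /ReC /=; ring.
  apply: k1 => //; rewrite mulf_neq0 ?neq0Ci //.
  apply/eqP => /(congr1 (@ReC R)); rewrite /RtoC /ReC /=; lra.
split=> //; rewrite conjE.
move: b0 c0; rewrite ImCD ReCD; case: (b) (g) => [p q] [p' q']; rewrite /ImC /ReC /= => h h'.
by apply/eqP; rewrite eq_complex /=; apply/andP; split; apply/eqP; lra.
Qed.

End Expansion.

(** * Derivatives and Lie brackets of real analytic germs *)

Section RealCalculus.
Variables (R : realType) (m : nat).
Local Notation C := (Cplx R).
Local Notation E := 'rV[R]_m.
Local Notation cx := (@cx R _).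

Definition near0R (P : E -> Prop) := exists r : R, 0 < r /\ forall t, vn (cx t) <= r -> P t.

Lemma near0R_and (P Q : E -> Prop) : near0R P -> near0R Q -> near0R (fun h => P h /\ Q h).
Proof.
move=> [r [r0 hP]] [r' [r'0 hQ]]; exists (Num.min r r'); split.
  by rewrite lt_min r0.
by move=> h; rewrite le_min => /andP[/hP + /hQ].
Qed.
Lemma near0R_sub (P Q : E -> Prop) : (forall h, P h -> Q h) -> near0R P -> near0R Q.
Proof. by move=> PQ [r [r0 hP]]; exists r; split=> // h /hP/PQ. Qed.
Lemma near0R_all (P : E -> Prop) : (forall h, P h) -> near0R P.
Proof. by exists 1; split. Qed.
Lemma cx0 : cx (0 : E) = 0. Proof. by apply/rowP => j; rewrite !mxE. Qed.
Lemma cxD (s t : E) : cx (s + t) = cx s + cx t.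
Proof. by apply/rowP => j; rewrite !mxE RtoCD. Qed.
Lemma cxN (t : E) : cx (- t) = - cx t.
Proof. by apply/rowP => j; rewrite !mxE RtoCN. Qed.
Lemma cxB (s t : E) : cx (s - t) = cx s - cx t.
Proof. by rewrite cxD cxN. Qed.
Lemma cxZ (s : R) (t : E) : cx (s *: t) = RtoC s *: cx t.
Proof. by apply/rowP => j; rewrite !mxE RtoCM. Qed.
Lemma near0R_at0 (P : E -> Prop) : near0R P -> P 0.
Proof. by move=> [r [r0]]; apply; rewrite cx0 vn0 ltW. Qed.
Lemma near0RP (P : E -> Prop) : (\forall p \near (0 : E), P p) <-> near0R P.
Proof.
split=> [/nbhsR[r r0 h]|[r [r0 h]]].
  by exists r; split=> // q qr; apply: h; rewrite subr0.
by apply/nbhsR; exists r => // q; rewrite subr0; exact: h.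
Qed.
Lemma near0R_shift (P : E -> Prop) : near0R P ->
  near0R (fun p => exists r : R, 0 < r /\ forall d, vn (cx d) <= r -> P (p + d)).
Proof.
move=> [r [r0 hP]]; exists (r / 2); split; first by lra.
move=> p hp; exists (r / 2); split; first by lra.
by move=> d hd; apply: hP; rewrite cxD (le_trans (vnD _ _)) //; lra.
Qed.

(** The derivative along v, with a quadratic bound on the remainder: it is
unique and obeys the usual rules at a single point. *)
Definition hasd (f : E -> C) (p v : E) (c : C) : Prop :=
  exists K r : R, 0 < r /\ forall s : R, `|s| <= r ->
    nm (f (p + s *: v) - f p - RtoC s * c) <= K * s ^+ 2.

Lemma hasd_uniq f p v c c' : hasd f p v c -> hasd f p v c' -> c = c'.
Proof.
move=> [K [r [r0 h]]] [K' [r' [r'0 h']]].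
apply/eqP; rewrite -subr_eq0; apply/eqP; apply: eq0_small => e e0.
pose KK := `|K| + `|K'| + 1.
have KK0 : 0 < KK by rewrite ltr_wpDl // addr_ge0.
pose s := Num.min (Num.min r r') (e / KK).
have s0 : 0 < s by rewrite !lt_min r0 r'0 divr_gt0.
have [sr sr' se] : [/\ s <= r, s <= r' & s <= e / KK] by rewrite /s !ge_min !lexx !orbT.
have := h s; have := h' s; rewrite (gtr0_norm s0) => /(_ sr') h1 /(_ sr) h2.
have : nm (RtoC s * (c - c')) <= KK * s ^+ 2.
  have -> : RtoC s * (c - c') = (f (p + s *: v) - f p - RtoC s * c') - (f (p + s *: v) - f p - RtoC s * c).
    by ring.
  rewrite (le_trans (nmB _ _)) //.
  apply: (@le_trans _ _ ((K + K') * s ^+ 2)); first by rewrite mulrDl addrC; lra.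
  rewrite ler_wpM2r ?exprn_ge0 ?ltW // /KK; have := ler_norm K; have := ler_norm K'; lra.
rewrite nmM nm_real (gtr0_norm s0) expr2 mulrA [_ * s]mulrC ler_pM2l // => /le_trans; apply.
by rewrite mulrC -ler_pdivlMr.
Qed.

(** Real and imaginary parts are R-linear and do not increase the modulus. *)
Lemma hasd_derive f p v c : hasd f p v c ->
  'D_v (fun t => ReC (f t)) p = ReC c /\ 'D_v (fun t => ImC (f t)) p = ImC c.
Proof.
move=> [K [r [r0 h]]].
have aux (g : C -> R) : (forall x y, g (x + y) = g x + g y) ->
    (forall x, g (- x) = - g x) -> (forall (s : R) x, g (RtoC s * x) = s * g x) ->
    (forall x, `|g x| <= nm x) -> 'D_v (fun t => g (f t)) p = g c.
  move=> gD gN gZ gb; apply: cvg_lim => //.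
  apply/cvgrPdist_le => e e0.
  pose K1 := `|K| + 1; have K10 : 0 < K1 by rewrite ltr_pwDr.
  apply/nbhs_ballP; exists (Num.min r (e / K1)) => /=.
    by rewrite lt_min r0 divr_gt0.
  move=> s; rewrite /ball /= sub0r normrN lt_min => /andP[sr se].
  move=> s0 /=.
  have s1 : 0 < `|s| by rewrite normr_gt0.
  have -> : g c - s^-1 *: (g (f (s *: v + p)) - g (f p)) =
      - (s^-1 * g (f (p + s *: v) - f p - RtoC s * c)).
    rewrite !gD !gN gZ [s *: v + p]addrC -[_ *: _]/(_ * _).
    by field.
  rewrite normrN normrM normfV mulrC ler_pdivrMr //.
  rewrite (le_trans (gb _)) // (le_trans (h s (ltW sr))) //.
  apply: (@le_trans _ _ (K1 * s ^+ 2)).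
    by rewrite ler_wpM2r ?sqr_ge0 // /K1; have := ler_norm K; lra.
  rewrite -[s ^+ 2]real_normK ?num_real // expr2 mulrA ler_pM2r // mulrC -ler_pdivlMr //.
  exact: ltW.
split; apply: aux.
- exact: ReCD.
- by case=> a b; rewrite /ReC.
- by move=> s [a b]; rewrite /ReC /RtoC /=; ring.
- exact: nm_Re.
- exact: ImCD.
- by case=> a b; rewrite /ImC.
- by move=> s [a b]; rewrite /ImC /RtoC /=; ring.
- exact: nm_Im.
Qed.

Lemma hasd_ext f g p v c :
  (exists r : R, 0 < r /\ forall d, vn (cx d) <= r -> f (p + d) = g (p + d)) ->
  hasd f p v c -> hasd g p v c.
Proof.
move=> [q [q0 fg]] [K [r [r0 h]]].
have V0 := vn_ge0 (cx v); have V1 : 0 < vn (cx v) + 1 by lra.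
exists K, (Num.min r (q / (vn (cx v) + 1))); split; first by rewrite lt_min r0 divr_gt0.
move=> s; rewrite le_min => /andP[sr sq].
have hs : vn (cx (s *: v)) <= q.
  rewrite cxZ (le_trans (vnZ _ _)) // nm_real.
  move: sq; rewrite ler_pdivlMr // => sq; apply: le_trans sq.
  by rewrite ler_wpM2l // lerDl.
have e1 := fg _ hs; have e2 : f p = g p.
  by have := fg 0; rewrite cx0 vn0 addr0; apply; exact: ltW.
by rewrite -e1 -e2; exact: h.
Qed.

Lemma hasd_bd f p v c : hasd f p v c -> exists M r : R, [/\ 0 < M, 0 < r & forall s : R, `|s| <= r ->
  nm (f (p + s *: v) - f p) <= M * `|s|].
Proof.
move=> [K [r [r0 h]]]; exists (nm c + 1 + `|K|), (Num.min r 1).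
have n0 := nm_ge0 c; have K0 := normr_ge0 K.
split; [by lra|by rewrite lt_min r0 ltr01|].
move=> s; rewrite le_min => /andP[sr s1].
have -> : f (p + s *: v) - f p = (f (p + s *: v) - f p - RtoC s * c) + RtoC s * c by ring.
rewrite (le_trans (nmD _ _)) // nmM nm_real.
have := h s sr; have s0 := normr_ge0 s.
have : K * s ^+ 2 <= `|K| * `|s|.
  rewrite -[s ^+ 2]real_normK ?num_real // expr2.
  apply: (@le_trans _ _ (`|K| * (`|s| * `|s|))).
    by rewrite ler_wpM2r ?mulr_ge0 // ler_norm.
  by rewrite ler_wpM2l // ler_piMr.
nra.
Qed.

Lemma hasd_cst c p v : hasd (fun=> c) p v 0.
Proof. by exists 0, 1; split=> // s _; rewrite subrr mulr0 subr0 nm0 mul0r. Qed.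
Lemma hasdD f g p v c d : hasd f p v c -> hasd g p v d -> hasd (fun t => f t + g t) p v (c + d).
Proof.
move=> [K [r [r0 h]]] [K' [r' [r'0 h']]].
exists (K + K'), (Num.min r r'); split; first by rewrite lt_min r0.
move=> s; rewrite le_min => /andP[sr sr'].
have -> : f (p + s *: v) + g (p + s *: v) - (f p + g p) - RtoC s * (c + d) =
  (f (p + s *: v) - f p - RtoC s * c) + (g (p + s *: v) - g p - RtoC s * d) by ring.
by rewrite mulrDl (le_trans (nmD _ _)) // lerD ?h ?h'.
Qed.
Lemma hasdM f g p v c d : hasd f p v c -> hasd g p v d ->
  hasd (fun t => f t * g t) p v (c * g p + f p * d).
Proof.
move=> hf hg; have [M [q [M0 q0 hM]]] := hasd_bd hf; have [M' [q' [M'0 q'0 hM']]] := hasd_bd hg.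
move: hf hg => [K [r [r0 h]]] [K' [r' [r'0 h']]].
exists (K * nm (g p) + nm (f p) * K' + M * M'), (Num.min (Num.min r r') (Num.min q q')).
split; first by rewrite !lt_min r0 r'0 q0.
move=> s; rewrite !le_min => /andP[/andP[sr sr'] /andP[sq sq']].
have -> : f (p + s *: v) * g (p + s *: v) - f p * g p - RtoC s * (c * g p + f p * d) =
  (f (p + s *: v) - f p - RtoC s * c) * g p + f p * (g (p + s *: v) - g p - RtoC s * d) +
  (f (p + s *: v) - f p) * (g (p + s *: v) - g p) by ring.
rewrite [leRHS]mulrDl [X in _ <= X + _]mulrDl (le_trans (nmD _ _)) // lerD //.
  rewrite (le_trans (nmD _ _)) // lerD // nmM.
    by rewrite mulrAC ler_wpM2r ?nm_ge0 ?h.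
  by rewrite -mulrA ler_wpM2l ?nm_ge0 ?h'.
rewrite nmM -[s ^+ 2]real_normK ?num_real // expr2 mulrACA.
by rewrite ler_pM ?nm_ge0 ?hM ?hM'.
Qed.
Lemma hasd_conj f p v c : hasd f p v c -> hasd (fun t => Num.conj (f t)) p v (Num.conj c).
Proof.
move=> [K [r [r0 h]]]; exists K, r; split=> // s sr.
have -> : Num.conj (f (p + s *: v)) - Num.conj (f p) - RtoC s * Num.conj c =
   Num.conj (f (p + s *: v) - f p - RtoC s * c).
  by rewrite !rmorphB rmorphM /= conj_RtoC.
by rewrite nm_conj h.
Qed.

(** Germs at 0 of complex-valued real analytic functions: restrictions of
holomorphic germs to real points. *)
Definition RA (f : E -> C) := exists G, An G /\ near0R (fun t => f t = G (cx t)).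
Definition RAV n (F : E -> 'rV[C]_n) := forall i, RA (fun t => F t 0 i).

Lemma RA_ext f g : RA f -> near0R (fun t => f t = g t) -> RA g.
Proof.
by move=> [G [aG eG]] e; exists G; split=> //; apply: near0R_sub (near0R_and eG e) => t [<- ->].
Qed.
Lemma RA_eq f g : RA f -> f =1 g -> RA g.
Proof. by move=> hf /funext <-. Qed.
Lemma RA_cst c : RA (fun=> c).
Proof. by exists (fun=> c); split; [exact: An_cst|exact: near0R_all]. Qed.
Lemma RAD f g : RA f -> RA g -> RA (fun t => f t + g t).
Proof.
move=> [F [aF eF]] [G [aG eG]]; exists (fun h => F h + G h); split; first exact: AnD.
by apply: near0R_sub (near0R_and eF eG) => t [-> ->].
Qed.
Lemma RAM f g : RA f -> RA g -> RA (fun t => f t * g t).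
Proof.
move=> [F [aF eF]] [G [aG eG]]; exists (fun h => F h * G h); split; first exact: AnM.
by apply: near0R_sub (near0R_and eF eG) => t [-> ->].
Qed.
Lemma RAZ c f : RA f -> RA (fun t => c * f t).
Proof. by apply: RAM; exact: RA_cst. Qed.
Lemma RAB f g : RA f -> RA g -> RA (fun t => f t - g t).
Proof.
by move=> hf hg; apply: (RA_eq (RAD hf (RAZ (-1) hg))) => t; rewrite mulN1r.
Qed.
Lemma RA_sum (I : Type) (s : seq I) (F : I -> E -> C) :
  (forall i, RA (F i)) -> RA (fun t => \sum_(i <- s) F i t).
Proof.
move=> hF; elim: s => [|i s IH].
  by apply: (RA_eq (RA_cst 0)) => t; rewrite big_nil.
by apply: (RA_eq (RAD (hF i) IH)) => t; rewrite big_cons.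
Qed.
Lemma RA_prod (I : Type) (s : seq I) (F : I -> E -> C) :
  (forall i, RA (F i)) -> RA (fun t => \prod_(i <- s) F i t).
Proof.
move=> hF; elim: s => [|i s IH].
  by apply: (RA_eq (RA_cst 1)) => t; rewrite big_nil.
by apply: (RA_eq (RAM (hF i) IH)) => t; rewrite big_cons.
Qed.
Lemma RA_conj f : RA f -> RA (fun t => Num.conj (f t)).
Proof.
move=> [F [aF eF]]; exists (conjf F); split; first exact: An_conj.
by apply: near0R_sub eF => t ->; rewrite /conjf cx_conj.
Qed.
Lemma near0R_fin (I : finType) (P : I -> E -> Prop) :
  (forall i, near0R (P i)) -> near0R (fun t => forall i, P i t).
Proof.
move=> hP; have [r [r0 hr]] : exists r, 0 < r /\ forall i t, vn (cx t) <= r -> P i t.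
  by apply: common_radius => // i r r' rr h t ht; apply: h; exact: le_trans rr.
by exists r; split=> // t tr i; exact: hr.
Qed.
Lemma RAV_ext n (F : E -> 'rV[C]_n) : RAV F ->
  exists G, AnV G /\ near0R (fun t => F t = G (cx t)).
Proof.
move=> /choice[G hG]; exists (fun h => \row_i G i h); split.
  by move=> i; apply: (An_eq (hG i).1) => h; rewrite mxE.
apply: near0R_sub (near0R_fin (fun i => (hG i).2)) => t h.
by apply/rowP => i; rewrite h mxE.
Qed.
Lemma RA_comp n (H : 'rV[C]_n -> C) (F : E -> 'rV[C]_n) : An H -> RAV F -> F 0 = 0 ->
  RA (fun t => H (F t)).
Proof.
move=> aH /RAV_ext[G [aG eG]] F0; exists (fun h => H (G h)); split.
  by apply: An_comp => //; have := near0R_at0 eG; rewrite cx0 F0.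
by apply: near0R_sub eG => t ->.
Qed.

(** The operation [cpartial] in a space of any dimension. *)
Definition dpart (k : 'I_m) (f : E -> C) (p : E) : C :=
  Complex ('D_(delta_mx 0 k) (fun t => ReC (f t)) p)
          ('D_(delta_mx 0 k) (fun t => ImC (f t)) p).

Lemma dpartE k f p c : hasd f p (delta_mx 0 k) c -> dpart k f p = c.
Proof. by move=> /hasd_derive[h1 h2]; rewrite /dpart h1 h2; case: (c). Qed.

(** Hadamard's lemma used twice; the remainder is uniform in the base point. *)
Lemma An_taylor_at (F : 'rV[C]_m -> C) : An F ->
  exists g : 'I_m -> 'rV[C]_m -> C, (forall k, An (g k)) /\
  exists K r, [/\ 0 <= K, 0 < r & forall h d, vn h <= r -> vn d <= r ->
    nm (F (h + d) - F h - \sum_i d 0 i * g i h) <= K * vn d ^+ 2].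
Proof.
move=> aF; have [g [ag [r [r0 hg]]]] := An_hadamard aF.
exists (fun i h => g i (row_mx h 0)); split.
  move=> i; apply: (An_comp (ag i)); last by rewrite row_mx0.
  by apply: AnV_row; [exact: AnV_id|exact: AnV_cst].
have [q [q0 hq]] : exists q, 0 < q /\ forall i, exists K, 0 < K /\ forall x y : 'rV[C]_(m + m),
    vn x <= q -> vn y <= q -> nm (g i x - g i y) <= K * vn (x - y).
  apply: common_radius => [i a b ba [K [K0 hK]]|i].
    by exists K; split=> // x y xb yb; apply: hK; exact: le_trans ba.
  have [K [a [K0 a0 ha]]] := An_Lip (ag i).
  by exists a; split=> //; exists K.
have /choice[K hK] := hq.
exists (\sum_i K i), (Num.min r q); split.
- by apply: sumr_ge0 => i _; exact: ltW (hK i).1.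
- by rewrite lt_min r0.
move=> h d; rewrite !le_min => /andP[hr hq1] /andP[dr dq].
rewrite hg // [F h + _]addrC addrK -sumrB (le_trans (nm_sum _ _ _)) // mulr_suml.
apply: ler_sum => i _; rewrite -mulrBr nmM expr2 mulrCA ler_pM ?nm_ge0 ?le_vn //.
have z0 : vn (0 : 'rV[C]_m) <= q by rewrite vn0 ltW.
rewrite (le_trans ((hK i).2 _ _ (vn_row_mx hq1 dq) (vn_row_mx hq1 z0))) //.
rewrite ler_pM2l; last exact: (hK i).1.
rewrite opp_row_mx add_row_mx subrr subr0.
by apply: vn_row_mx; rewrite // vn0 vn_ge0.
Qed.

Lemma RA_taylor f : RA f -> exists g : 'I_m -> E -> C, (forall k, RA (g k)) /\
  exists K r, [/\ 0 <= K, 0 < r & forall p d, vn (cx p) <= r -> vn (cx d) <= r ->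
    nm (f (p + d) - f p - \sum_i RtoC (d 0 i) * g i p) <= K * vn (cx d) ^+ 2].
Proof.
move=> [F [aF [r1 [r10 eF]]]]; have [g [ag [K [r [K0 r0 hr]]]]] := An_taylor_at aF.
exists (fun i p => g i (cx p)); split.
  by move=> k; exists (g k); split=> //; exact: near0R_all.
exists K, (Num.min r r1 / 2); split=> //.
  have : 0 < Num.min r r1 by rewrite lt_min r0.
  lra.
have [mr mr1] : Num.min r r1 <= r /\ Num.min r r1 <= r1 by rewrite !ge_min !lexx orbT.
have mp : 0 < Num.min r r1 by rewrite lt_min r0.
move=> p d hp hd; have hpd : vn (cx (p + d)) <= r1.
  by rewrite cxD (le_trans (vnD _ _)) //; lra.
have hp1 : vn (cx p) <= r1 by lra.
have := hr (cx p) (cx d) ltac:(lra) ltac:(lra).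
rewrite !eF // cxD; under [X in _ - X]eq_bigr do rewrite mxE.
exact.
Qed.

Lemma taylor_hasd f (g : 'I_m -> C) p K r : 0 <= K -> 0 < r ->
  (forall d, vn (cx d) <= r -> nm (f (p + d) - f p - \sum_i RtoC (d 0 i) * g i) <= K * vn (cx d) ^+ 2) ->
  forall v, hasd f p v (\sum_i RtoC (v 0 i) * g i).
Proof.
move=> K0 r0 h v; have V0 := vn_ge0 (cx v); have V1 : 0 < vn (cx v) + 1 by lra.
exists (K * vn (cx v) ^+ 2), (r / (vn (cx v) + 1)); split; first by rewrite divr_gt0.
move=> s; rewrite ler_pdivlMr // => sr.
have vs : vn (cx (s *: v)) <= `|s| * vn (cx v).
  by rewrite cxZ (le_trans (vnZ _ _)) // nm_real.
have hs : vn (cx (s *: v)) <= r.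
  by apply: le_trans sr; apply: le_trans vs _; rewrite ler_wpM2l // lerDl.
have := h _ hs.
have -> : \sum_i RtoC ((s *: v) 0 i) * g i = RtoC s * \sum_i RtoC (v 0 i) * g i.
  by rewrite mulr_sumr; apply: eq_bigr => i _; rewrite mxE RtoCM mulrA.
move=> /le_trans; apply; rewrite -mulrA ler_wpM2l //.
rewrite -[s ^+ 2]real_normK ?num_real // -exprMn mulrC.
by rewrite lerXn2r ?nnegrE ?vn_ge0 ?mulr_ge0 // mulrC.
Qed.

Lemma sum_delta k (g : 'I_m -> C) :
  \sum_i RtoC ((delta_mx 0 k : E) 0 i) * g i = g k.
Proof.
rewrite (bigD1 k) //= mxE !eqxx /= RtoC1 mul1r big1 ?addr0 // => i /negbTE ik.
by rewrite mxE ik andbF RtoC0 mul0r.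
Qed.

Lemma RA_grad f : RA f -> exists g : 'I_m -> E -> C, (forall k, RA (g k)) /\
  near0R (fun p => forall v, hasd f p v (\sum_k RtoC (v 0 k) * g k p)).
Proof.
move=> /RA_taylor[g [rg [K [r [K0 r0 hr]]]]]; exists g; split=> //.
exists r; split=> // p pr v; apply: (taylor_hasd K0 r0) => d dr.
exact: hr.
Qed.

Lemma RA_hasd f : RA f ->
  near0R (fun p => forall v, hasd f p v (\sum_k RtoC (v 0 k) * dpart k f p)).
Proof.
move=> /RA_grad[g [_ hg]]; apply: near0R_sub hg => p h v.
have e k : dpart k f p = g k p by apply: dpartE; rewrite -(sum_delta k (fun k => g k p)).
by under eq_bigr do rewrite e.
Qed.
Lemma RA_hasd_delta f k : RA f -> near0R (fun p => hasd f p (delta_mx 0 k) (dpart k f p)).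
Proof.
move=> /RA_hasd; apply: near0R_sub => p h.
by rewrite -(sum_delta k (fun k => dpart k f p)).
Qed.
Lemma RA_dpart f k : RA f -> RA (dpart k f).
Proof.
move=> /RA_grad[g [rg hg]]; apply: RA_ext (rg k) _; apply: near0R_sub hg => p h.
by apply/esym/dpartE; rewrite -(sum_delta k (fun k => g k p)).
Qed.

Lemma dpart_ext f g k : RA f -> near0R (fun t => f t = g t) ->
  near0R (fun t => dpart k f t = dpart k g t).
Proof.
move=> rf /near0R_shift e; apply: near0R_sub (near0R_and e (RA_hasd_delta k rf)) => p [e' h].
by apply/esym/dpartE; exact: hasd_ext h.
Qed.
Lemma dpartD f g k : RA f -> RA g ->
  near0R (fun p => dpart k (fun t => f t + g t) p = dpart k f p + dpart k g p).
Proof.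
move=> /(RA_hasd_delta k) hf /(RA_hasd_delta k) hg; apply: near0R_sub (near0R_and hf hg) => p [h1 h2].
by apply: dpartE; exact: hasdD.
Qed.
Lemma dpartM f g k : RA f -> RA g ->
  near0R (fun p => dpart k (fun t => f t * g t) p = dpart k f p * g p + f p * dpart k g p).
Proof.
move=> /(RA_hasd_delta k) hf /(RA_hasd_delta k) hg; apply: near0R_sub (near0R_and hf hg) => p [h1 h2].
by apply: dpartE; exact: hasdM.
Qed.
Lemma dpart_conj f k : RA f ->
  near0R (fun p => dpart k (fun t => Num.conj (f t)) p = Num.conj (dpart k f p)).
Proof.
move=> /(RA_hasd_delta k); apply: near0R_sub => p h.
by apply: dpartE; exact: hasd_conj.
Qed.
Lemma dpart_cst c k p : dpart k (fun=> c) p = 0.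
Proof. by apply: dpartE; exact: hasd_cst. Qed.

Definition second_difference (f : E -> C) p u v (s s' : R) : C :=
  f (p + s *: u + s' *: v) - f (p + s' *: v) - f (p + s *: u) + f p.

(** Divide f (p + s e_k + s' e_l), analytic in (p, s, s'), by s and
then by s'. The second difference is s s' times the quotient, whose value at
s = s' = 0 is the iterated derivative. *)
Lemma RA_second_difference f k l : RA f ->
  near0R (fun p => exists K r : R, [/\ 0 <= K, 0 < r & forall s, 0 < s -> s <= r ->
    nm (second_difference f p (delta_mx 0 k) (delta_mx 0 l) s s - RtoC (s * s) * dpart l (dpart k f) p)
      <= K * (s * s * s)]).
Proof.
move=> [F [aF [r1 [r10 eF]]]].
pose ek : 'rV[C]_m := delta_mx 0 k; pose el : 'rV[C]_m := delta_mx 0 l.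
pose Mx : 'M[C]_(m + (1 + 1), m) := col_mx 1%:M (col_mx ek el).
pose X (p : E) (s s' : R) : 'rV[C]_(m + (1 + 1)) :=
  row_mx (cx p) (row_mx (const_mx (RtoC s)) (const_mx (RtoC s'))).
have c1 (a : C) (e : 'rV[C]_m) : (const_mx a : 'rV[C]_1) *m e = a *: e.
  by apply/rowP => j; rewrite !mxE big_ord1 !mxE.
have cd i : cx (delta_mx 0 i) = delta_mx 0 i :> 'rV[C]_m.
  by apply/rowP => j; rewrite !mxE; case: andP => _; rewrite ?RtoC1 ?RtoC0.
have XM p s s' : X p s s' *m Mx = cx (p + s *: delta_mx 0 k + s' *: delta_mx 0 l).
  by rewrite /X /Mx !mul_row_col mulmx1 !c1 !cxD !cxZ !cd addrA.
have aA := An_lin Mx aF.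
pose i1 : 'I_(m + (1 + 1)) := rshift m (lshift 1 0).
pose i2 : 'I_(m + (1 + 1)) := rshift m (rshift 1 0).
have [A1 [aA1 [q1 [q10 e1]]]] := An_div i1 aA.
have [A2 [aA2 [q2 [q20 e2]]]] := An_div i2 aA1.
have [K1 [b1 [K10 b10 L1]]] := An_Lip aA1.
have [K2 [b2 [K20 b20 L2]]] := An_Lip aA2.
have X1 p s s' : X p s s' 0 i1 = RtoC s by rewrite /X row_mxEr row_mxEl mxE.
have X2 p s s' : X p s s' 0 i2 = RtoC s' by rewrite /X row_mxEr row_mxEr mxE.
have Z1 p s s' : zero_on [:: i1] (X p s s') = X p 0 s'.
  apply/rowP => j; rewrite mxE inE /X.
  have [j' ->|j' ->] := split_ordP j; first by rewrite eq_lrshift !row_mxEl.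
  rewrite !row_mxEr (inj_eq (@rshift_inj _ _)).
  have [j'' ->|j'' ->] := split_ordP j'; first by rewrite ord1 eqxx row_mxEl mxE.
  by rewrite eq_rlshift !row_mxEr.
have Z2 p s s' : zero_on [:: i2] (X p s s') = X p s 0.
  apply/rowP => j; rewrite mxE inE /X.
  have [j' ->|j' ->] := split_ordP j; first by rewrite eq_lrshift !row_mxEl.
  rewrite !row_mxEr (inj_eq (@rshift_inj _ _)).
  have [j'' ->|j'' ->] := split_ordP j'; last by rewrite ord1 eqxx row_mxEr mxE.
  by rewrite eq_lrshift !row_mxEl.
pose t := Num.min r1 (Num.min (Num.min q1 q2) (Num.min b1 b2)).
have t0 : 0 < t by rewrite !lt_min r10 q10 q20 b10.
have [tr tq1 tq2 tb1 tb2] : [/\ t <= r1, t <= q1, t <= q2, t <= b1 & t <= b2].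
  by rewrite /t !ge_min !lexx !orbT.
have [t4q1 t4q2 t4b1 t4b2] : [/\ t / 4 <= q1, t / 4 <= q2, t / 4 <= b1 & t / 4 <= b2].
  by split; lra.
have t40 : 0 < t / 4 by lra.
have vd (a : R) (i : 'I_m) : vn (cx (a *: delta_mx 0 i)) <= `|a|.
  apply: vn_le => // j; rewrite !mxE nm_real normrM.
  by case: (_ && _); rewrite ?normr1 ?normr0 ?mulr1 ?mulr0.
have vX p (s s' : R) : vn (cx p) <= t / 4 -> `|s| <= t / 4 -> `|s'| <= t / 4 -> vn (X p s s') <= t / 4.
  move=> hp hs hs'; apply: vn_row_mx => //.
  by apply: vn_row_mx; apply: vn_le => [|i]; rewrite ?mxE ?nm_real // ltW.
have fX p (s s' : R) : vn (cx p) <= t / 4 -> `|s| <= t / 4 -> `|s'| <= t / 4 ->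
   f (p + s *: delta_mx 0 k + s' *: delta_mx 0 l) = F (X p s s' *m Mx).
  move=> hp hs hs'; rewrite XM eF // !cxD (le_trans (vnD _ _)) //.
  have h1 := le_trans (vnD (cx p) (cx (s *: delta_mx 0 k))) (lerD hp (le_trans (vd s k) hs)).
  by apply: le_trans (lerD h1 (le_trans (vd s' l) hs')) _; lra.
have z0 : `|0 : R| <= t / 4 by rewrite normr0 ltW.
have D1 p (s s' : R) : vn (cx p) <= t / 4 -> `|s| <= t / 4 -> `|s'| <= t / 4 ->
   f (p + s *: delta_mx 0 k + s' *: delta_mx 0 l) =
   f (p + s' *: delta_mx 0 l) + RtoC s * A1 (X p s s').
  move=> hp hs hs'; rewrite fX // e1; last exact: le_trans (vX p s s' hp hs hs') t4q1.
  rewrite Z1 X1; congr (_ + _).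
  have -> : p + s' *: delta_mx 0 l = p + (0 : R) *: delta_mx 0 k + s' *: delta_mx 0 l.
    by rewrite scale0r addr0.
  by rewrite -fX.
have D2 p (s s' : R) : vn (cx p) <= t / 4 -> `|s| <= t / 4 -> `|s'| <= t / 4 ->
   A1 (X p s s') = A1 (X p s 0) + RtoC s' * A2 (X p s s').
  move=> hp hs hs'; rewrite e2; last exact: le_trans (vX p s s' hp hs hs') t4q2.
  by rewrite Z2 X2.
have dX p (s s' a a' : R) : vn (X p s s' - X p a a') <= Num.max `|s - a| `|s' - a'|.
  rewrite /X opp_row_mx add_row_mx subrr opp_row_mx add_row_mx.
  have m0 : 0 <= Num.max `|s - a| `|s' - a'| by rewrite le_max normr_ge0.
  apply: vn_row_mx; first by rewrite vn0.
  apply: vn_row_mx; apply: vn_le => // i; rewrite !mxE -RtoCN -RtoCD nm_real le_max lexx ?orbT //.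
have dk p (s' : R) : vn (cx p) <= t / 4 -> `|s'| <= t / 4 ->
   dpart k f (p + s' *: delta_mx 0 l) = A1 (X p 0 s').
  move=> hp hs'; apply: dpartE; exists K1, (t / 4); split=> //.
  move=> s hs.
  have -> : p + s' *: delta_mx 0 l + s *: delta_mx 0 k = p + s *: delta_mx 0 k + s' *: delta_mx 0 l.
    by rewrite addrAC.
  rewrite D1 // [f _ + _]addrC addrK -mulrBr nmM nm_real.
  rewrite -[s ^+ 2]real_normK ?num_real // expr2 mulrCA ler_wpM2l //.
  have v1 := vX p s s' hp hs hs'; have v2 := vX p 0 s' hp z0 hs'.
  rewrite (le_trans (L1 _ _ (le_trans v1 t4b1) (le_trans v2 t4b1))) //.
  rewrite ler_pM2l // (le_trans (dX _ _ _ _ _)) // subr0 subrr normr0.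
  by rewrite ge_max lexx normr_ge0.
exists (t / 4); split=> // p hp.
have dkl : dpart l (dpart k f) p = A2 (X p 0 0).
  apply: dpartE; exists K2, (t / 4); split=> //.
  move=> s' hs'; rewrite dk //.
  have -> : dpart k f p = A1 (X p 0 0) by have := dk p 0 hp z0; rewrite scale0r addr0.
  rewrite D2 // [A1 _ + _]addrC addrK -mulrBr nmM nm_real.
  rewrite -[s' ^+ 2]real_normK ?num_real // expr2 mulrCA ler_wpM2l //.
  have v1 := vX p 0 s' hp z0 hs'; have v2 := vX p 0 0 hp z0 z0.
  rewrite (le_trans (L2 _ _ (le_trans v1 t4b2) (le_trans v2 t4b2))) //.
  rewrite ler_pM2l // (le_trans (dX _ _ _ _ _)) // !subr0 normr0.
  by rewrite ge_max lexx normr_ge0.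
exists K2, (t / 4); split=> //; first exact: ltW.
move=> s s0 st; have hs : `|s| <= t / 4 by rewrite gtr0_norm.
have E1 := D1 p s s hp hs hs.
have E2 : f (p + s *: delta_mx 0 k) = f p + RtoC s * A1 (X p s 0).
  by have := D1 p s 0 hp hs z0; rewrite scale0r !addr0.
have -> : second_difference f p (delta_mx 0 k) (delta_mx 0 l) s s = RtoC (s * s) * A2 (X p s s).
  by rewrite /second_difference E1 E2 (D2 p s s) // RtoCM; ring.
rewrite dkl -mulrBr nmM nm_real gtr0_norm ?mulr_gt0 // mulrCA ler_pM2l ?mulr_gt0 //.
have v1 := vX p s s hp hs hs; have v2 := vX p 0 0 hp z0 z0.
rewrite (le_trans (L2 _ _ (le_trans v1 t4b2) (le_trans v2 t4b2))) //.
rewrite ler_pM2l // (le_trans (dX _ _ _ _ _)) // !subr0 gtr0_norm //.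
by rewrite ge_max lexx.
Qed.

(** The second difference is symmetric in the two directions. *)
Lemma schwarz f k l : RA f -> near0R (fun p => dpart l (dpart k f) p = dpart k (dpart l f) p).
Proof.
move=> rf; apply: near0R_sub (near0R_and (RA_second_difference k l rf) (RA_second_difference l k rf)).
move=> p [[K [r [K0 r0 h]]] [K' [r' [K'0 r'0 h']]]].
apply/eqP; rewrite -subr_eq0; apply/eqP; apply: eq0_small => e e0.
have KK0 : 0 < K + K' + 1 by lra.
pose s := Num.min (Num.min r r') (e / (K + K' + 1)).
have s0 : 0 < s by rewrite !lt_min r0 r'0 divr_gt0.
have [sr sr' se] : [/\ s <= r, s <= r' & s <= e / (K + K' + 1)].
  by rewrite /s !ge_min !lexx !orbT.
have h1 := h s s0 sr; have h2 := h' s s0 sr'.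
have sw2 : second_difference f p (delta_mx 0 l) (delta_mx 0 k) s s = second_difference f p (delta_mx 0 k) (delta_mx 0 l) s s.
  by rewrite /second_difference [p + s *: delta_mx 0 l + _]addrAC; ring.
rewrite sw2 in h2; have ss0 : 0 < s * s by rewrite mulr_gt0.
rewrite -(ler_pM2l ss0) -{1}(gtr0_norm ss0) -nm_real -nmM.
have aux (a b c d : C) : a * (b - c) = (d - a * c) - (d - a * b) by ring.
rewrite (aux _ _ _ (second_difference f p (delta_mx 0 k) (delta_mx 0 l) s s)).
rewrite (le_trans (nmB _ _)) //.
rewrite addrC; apply: le_trans (lerD h1 h2) _.
apply: (@le_trans _ _ (s * s * ((K + K' + 1) * s))).
  have sss : 0 <= s * s * s by rewrite !mulr_ge0 // ltW.
  have -> : s * s * ((K + K' + 1) * s) = K * (s * s * s) + K' * (s * s * s) + s * s * s by ring.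
  by rewrite lerDl.
by rewrite ler_pM2l // mulrC -ler_pdivlMr.
Qed.

(** The derivation defined by a complex vector field. *)
Definition dvf (X : E -> 'rV[C]_m) (f : E -> C) (p : E) : C :=
  \sum_k X p 0 k * dpart k f p.

Lemma RA_dvf X f : RAV X -> RA f -> RA (dvf X f).
Proof. by move=> rX rf; apply: RA_sum => k; apply: RAM; [exact: rX|exact: RA_dpart]. Qed.
Lemma dvf_ext X f g : RA f -> near0R (fun t => f t = g t) -> near0R (fun t => dvf X f t = dvf X g t).
Proof.
move=> rf e; apply: near0R_sub (near0R_fin (fun k => dpart_ext k rf e)) => p h.
by apply: eq_bigr => k _; rewrite h.
Qed.
Lemma dvfD X f g : RA f -> RA g ->
  near0R (fun p => dvf X (fun t => f t + g t) p = dvf X f p + dvf X g p).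
Proof.
move=> rf rg; apply: near0R_sub (near0R_fin (fun k => dpartD k rf rg)) => p h.
by rewrite -big_split; apply: eq_bigr => k _; rewrite h mulrDr.
Qed.
Lemma dvfM X f g : RA f -> RA g ->
  near0R (fun p => dvf X (fun t => f t * g t) p = dvf X f p * g p + f p * dvf X g p).
Proof.
move=> rf rg; apply: near0R_sub (near0R_fin (fun k => dpartM k rf rg)) => p h.
rewrite mulr_suml mulr_sumr -big_split; apply: eq_bigr => k _; rewrite h /=; ring.
Qed.
Lemma dvf_cst X c p : dvf X (fun=> c) p = 0.
Proof. by apply: big1 => k _; rewrite dpart_cst mulr0. Qed.
Lemma dvfZ X c f : RA f -> near0R (fun p => dvf X (fun t => c * f t) p = c * dvf X f p).
Proof.
move=> rf; apply: near0R_sub (dvfM X (RA_cst c) rf) => p ->.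
by rewrite dvf_cst mul0r add0r.
Qed.
Lemma dvf_sum X (I : Type) (s : seq I) (F : I -> E -> C) : (forall i, RA (F i)) ->
  near0R (fun p => dvf X (fun t => \sum_(i <- s) F i t) p = \sum_(i <- s) dvf X (F i) p).
Proof.
move=> rF; elim: s => [|i s IH].
  apply: near0R_sub (dvf_ext X (RA_cst 0) (g := fun t => \sum_(i <- [::]) F i t) _) => [p <-|].
    by rewrite dvf_cst big_nil.
  by apply: near0R_all => t; rewrite big_nil.
have e1 := dvfD X (rF i) (RA_sum s rF).
apply: near0R_sub (near0R_and e1 IH) => p [E1 E2].
rewrite big_cons -E2 -E1; congr (dvf X _ p).
by apply/funext => t; rewrite big_cons.
Qed.

(** [lie_bracket], written with derivations. *)
Definition bracket (X Y : E -> 'rV[C]_m) (p : E) : 'rV[C]_m :=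
  \row_j (dvf X (fun t => Y t 0 j) p - dvf Y (fun t => X t 0 j) p).
Lemma RAV_bracket X Y : RAV X -> RAV Y -> RAV (bracket X Y).
Proof.
move=> rX rY j; apply: (RA_eq (RAB (RA_dvf rX (rY j)) (RA_dvf rY (rX j)))) => t.
by rewrite mxE.
Qed.
(** The second order terms cancel by [schwarz]. *)
Lemma dvf_bracket X Y f : RAV X -> RAV Y -> RA f ->
  near0R (fun p => dvf (bracket X Y) f p = dvf X (dvf Y f) p - dvf Y (dvf X f) p).
Proof.
move=> rX rY rf.
have key (X1 Y1 : E -> 'rV[C]_m) : RAV Y1 ->
    near0R (fun p => dvf X1 (dvf Y1 f) p = \sum_j (dvf X1 (fun t => Y1 t 0 j) p * dpart j f p +
       Y1 p 0 j * \sum_k X1 p 0 k * dpart k (dpart j f) p)).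
  move=> rY1.
  have h1 := dvf_sum X1 (index_enum 'I_m) (fun j => RAM (rY1 j) (RA_dpart j rf)).
  have h2 := near0R_fin (fun j => dvfM X1 (rY1 j) (RA_dpart j rf)).
  apply: near0R_sub (near0R_and h1 h2) => p [E1 E2].
  by rewrite E1; apply: eq_bigr => j _; rewrite E2.
have sch := near0R_fin (fun k => near0R_fin (fun l => schwarz k l rf)).
apply: near0R_sub (near0R_and sch (near0R_and (key X Y rY) (key Y X rX))) => p [S [-> ->]].
rewrite !big_split /= opprD addrACA.
have -> : \sum_i Y p 0 i * (\sum_k X p 0 k * dpart k (dpart i f) p) =
          \sum_i X p 0 i * (\sum_k Y p 0 k * dpart k (dpart i f) p).
  under eq_bigr do rewrite mulr_sumr.
  rewrite exchange_big /=; apply: eq_bigr => k _; rewrite mulr_sumr.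
  by apply: eq_bigr => i _; rewrite (S i k); ring.
rewrite subrr addr0 -sumrB; apply: eq_bigr => j _.
by rewrite mxE mulrBl.
Qed.

End RealCalculus.

(** * Real and complex coordinates *)

Section ComplexPoints.
Variables (R : realType) (N : nat).
Local Notation C := (Cplx R).
Local Notation E := 'rV[R]_(N + N).
Local Notation ii := ('i : C).

Definition cpt (t : E) : 'rV[C]_N := complex_point t.
Definition rpt (w : 'rV[C]_N) : E := row_mx (map_mx (@ReC R) w) (map_mx (@ImC R) w).

Lemma cptE t : cpt t = lsubmx (cx t) + ii *: rsubmx (cx t).
Proof. by apply/rowP => j; rewrite !mxE [LHS]CE /ReC /ImC /=. Qed.
Lemma cptK t : rpt (cpt t) = t.
Proof.
rewrite -[RHS]hsubmxK; congr row_mx; apply/rowP => j; rewrite !mxE //.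
Qed.
Lemma rptK w : cpt (rpt w) = w.
Proof.
apply/rowP => j; rewrite /cpt /complex_point mxE /rpt row_mxKl row_mxKr !mxE.
by case: (w 0 j).
Qed.
Lemma rptD v w : rpt (v + w) = rpt v + rpt w.
Proof.
rewrite /rpt add_row_mx; congr row_mx; apply/rowP => j; rewrite !mxE ?ReCD ?ImCD //.
Qed.
Lemma rptN w : rpt (- w) = - rpt w.
Proof.
rewrite /rpt opp_row_mx; congr row_mx; apply/rowP => j; rewrite !mxE; by case: (w 0 j).
Qed.
Lemma rptB v w : rpt (v - w) = rpt v - rpt w.
Proof. by rewrite rptD rptN. Qed.
Lemma vn_rpt w : vn (cx (rpt w)) <= vn w.
Proof.
apply: vn_le => [|j]; first exact: vn_ge0.
rewrite mxE nm_real; have [k ->|k ->] := split_ordP j.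
  by rewrite row_mxEl mxE (le_trans (nm_Re _)) // le_vn.
by rewrite row_mxEr mxE (le_trans (nm_Im _)) // le_vn.
Qed.
Lemma vn_cpt t : vn (cpt t) <= 2 * vn (cx t).
Proof.
rewrite cptE (le_trans (vnD _ _)) // mulr_natl mulr2n lerD ?vn_lsub //.
by rewrite (le_trans (vnZ _ _)) // nm_i mul1r vn_rsub.
Qed.
Lemma cpt0 : cpt 0 = 0.
Proof. by rewrite cptE cx0 !linear0 addr0. Qed.

(** The linear map that sends a pair (zeta, tau) to (x, y) with zeta = x + i y
and tau = x - i y; x and y may be complex. *)
Definition recon (y : 'rV[C]_(N + N)) : 'rV[C]_(N + N) :=
  row_mx (2^-1 *: (lsubmx y + rsubmx y)) ((2 * ii)^-1 *: (lsubmx y - rsubmx y)).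
Lemma conj_cpt t : map_mx Num.conj (cpt t) = lsubmx (cx t) - ii *: rsubmx (cx t).
Proof.
have cl : map_mx Num.conj (lsubmx (cx t)) = lsubmx (cx t).
  by apply/rowP => j; rewrite !mxE conj_RtoC.
have cr : map_mx Num.conj (rsubmx (cx t)) = rsubmx (cx t).
  by apply/rowP => j; rewrite !mxE conj_RtoC.
by rewrite cptE conj_addi cl cr.
Qed.
Lemma recon_cpt t : recon (row_mx (cpt t) (map_mx Num.conj (cpt t))) = cx t.
Proof.
rewrite /recon row_mxKl row_mxKr conj_cpt cptE -[RHS]hsubmxK.
move: (lsubmx (cx t)) (rsubmx (cx t)) => a b.
congr row_mx; apply/rowP => j; rewrite !mxE.
  by field.
by field; exact: neq0Ci.
Qed.
Lemma recon_conj p q : recon (row_mx (map_mx Num.conj p) (map_mx Num.conj q)) =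
  map_mx Num.conj (recon (row_mx q p)).
Proof.
rewrite /recon !row_mxKl !row_mxKr map_row_mx; congr row_mx; apply/rowP => j; rewrite !mxE.
  by rewrite rmorphM rmorphD fmorphV rmorph_nat addrC.
rewrite rmorphM rmorphB fmorphV rmorphM rmorph_nat /= conjCi mulrN invrN mulNr -mulrN opprB.
by [].
Qed.

End ComplexPoints.

(** * Bases adapted to independent linear forms *)

Section LinearAlgebra.
Variables (R : realType) (n : nat).
Local Notation C := (Cplx R).
Local Notation ii := ('i : C).

(** The row space has codimension 1, so some vector of the standard basis
lies outside. *)
Lemma complete_basis (D : 'M[C]_(n, 1 + n)) : row_free D ->
  exists e : 'rV[C]_(1 + n), col_mx e D \in unitmx.
Proof.
move=> fD.
have [k hk] : exists k, ~~ ((delta_mx 0 k : 'rV[C]_(1 + n)) <= D)%MS.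
  apply/existsP; apply: contraT; rewrite negb_exists => /forallP h.
  have : (1%:M <= D)%MS.
    by apply/row_subP => i; rewrite row1; exact: negbNE (h i).
  move=> /mxrankS; rewrite mxrank1 => h1.
  by have := leq_trans h1 (rank_leq_row D); rewrite add1n ltnn.
move: (delta_mx 0 k) hk => e hk.
exists e; rewrite -row_full_unit /row_full eqn_leq rank_leq_col /=.
have : (D < col_mx e D)%MS.
  rewrite ltmxE; apply/andP; split; first by rewrite -addsmxE addsmxSr.
  by apply: contra hk => /(submx_trans _); apply; rewrite -addsmxE addsmxSl.
by move=> /rank_ltmx; rewrite (eqP fD).
Qed.

(** Linear coordinates, with matrices B and S = B^-1, in which the forms D
are, up to the factor 1 / 2 i, the last n coordinates. *)
Lemma adapted_basis (D : 'M[C]_(n, 1 + n)) : row_free D ->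
  exists B S : 'M[C]_(1 + n), [/\ S *m B = 1%:M, B *m S = 1%:M &
    B *m D^T = (2 * ii)^-1 *: col_mx 0 1%:M].
Proof.
move=> fD.
have fD2 : row_free ((2 * ii) *: D).
  by rewrite /row_free mxrank_scale_nz // i2_neq0.
have [e he] := complete_basis fD2.
pose S := (col_mx e ((2 * ii) *: D))^T.
have uS : S \in unitmx by rewrite unitmx_tr.
exists (invmx S), S; split; [exact: mulmxV|exact: mulVmx|].
have SE : S *m col_mx 0 1%:M = (2 * ii) *: D^T.
  by rewrite /S tr_col_mx mul_row_col mulmx0 add0r mulmx1 linearZ.
have -> : D^T = (2 * ii)^-1 *: (S *m col_mx 0 1%:M).
  by rewrite SE scalerA mulVf ?i2_neq0 // scale1r.
by rewrite -scalemxAr mulKmx.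
Qed.

End LinearAlgebra.

(** * A generic submanifold in normal coordinates *)

Section NormalForm.
Variables (R : realType) (n : nat).
Local Notation C := (Cplx R).
Local Notation N := (1 + n)%N.
Local Notation E := 'rV[R]_(N + N).
Local Notation ii := ('i : C).
Variable rho : E -> 'rV[R]_n.

Definition jac (p : E) : 'M[R]_(n, N + N) :=
  \matrix_(j < n, k < N + N) 'D_(delta_mx 0 k) (fun t => rho t 0 j) p.

Lemma dpart_real k (g : E -> R) p : dpart k (fun t => RtoC (g t)) p = RtoC ('D_(delta_mx 0 k) g p).
Proof.
have h3 : 'D_(delta_mx 0 k) (fun=> 0 : R) p = 0 by exact: derive_cst.
by rewrite /dpart; change (Complex ('D_(delta_mx 0 k) g p) ('D_(delta_mx 0 k) (fun=> 0 : R) p) = RtoC ('D_(delta_mx 0 k) g p)); rewrite h3.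
Qed.

Lemma hasd_real (g : E -> R) p v c : hasd (fun t => RtoC (g t)) p v c -> c = RtoC ('D_v g p).
Proof.
move=> /hasd_derive[h1 h2]; have h3 : 'D_v (fun=> 0 : R) p = 0 by exact: derive_cst.
by case: c h1 h2 => a b; rewrite /ReC /ImC /RtoC /= h3 => -> <-.
Qed.

Lemma derive_jac (p v : E) :
  (forall j v, hasd (fun t => RtoC (rho t 0 j)) p v
       (\sum_k RtoC (v 0 k) * dpart k (fun t => RtoC (rho t 0 j)) p)) ->
  \row_j 'D_v (fun t => rho t 0 j) p = v *m (jac p)^T.
Proof.
move=> h; apply/rowP => j; rewrite !mxE; apply: RtoC_inj.
rewrite -(hasd_real (h j v)) RtoC_sum; apply: eq_bigr => k _.
by rewrite dpart_real RtoCM !mxE.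
Qed.

(** Write a linear relation as x = al + i be. It says that al J and be J
are exchanged, up to sign, by the complex structure. Both kill the tangent
space, so be J also kills its image under J, hence everything. *)
Lemma complex_gradient_free (J : 'M[R]_(n, N + N)) : row_free J ->
  (forall v : E, exists a b : E, [/\ a *m J^T = 0, b *m J^T = 0 & v = a + Jmx b]) ->
  row_free (2^-1 *: map_mx (@RtoC R) (lsubmx J) + (2 * ii)^-1 *: map_mx (@RtoC R) (rsubmx J)).
Proof.
move=> fJ gJ; rewrite -kermx_eq0; apply/rowV0P => x /sub_kermxP.
pose al := map_mx (@ReC R) x; pose be := map_mx (@ImC R) x.
have xE : x = map_mx (@RtoC R) al + ii *: map_mx (@RtoC R) be.
  by apply/rowP => j; rewrite !mxE {1}[x 0 j]CE.
rewrite mulmxDr -!scalemxAr => h.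
have key : al *m lsubmx J = - (be *m rsubmx J) /\ be *m lsubmx J = al *m rsubmx J.
  have h' k : 2^-1 * (\sum_j x 0 j * RtoC (J j (lshift N k))) +
      (2 * ii)^-1 * (\sum_j x 0 j * RtoC (J j (rshift N k))) = 0.
    have aux (A B : 'rV[C]_N) (c d : C) : c *: A + d *: B = 0 -> c * A 0 k + d * B 0 k = 0.
      by move=> /(congr1 (fun M : 'rV[C]_N => M 0 k)); rewrite !mxE.
    have eA (M : 'M[R]_(n, N)) : (x *m map_mx (@RtoC R) M) 0 k = \sum_j x 0 j * RtoC (M j k).
      by rewrite mxE; apply: eq_bigr => j _; rewrite mxE.
    have := aux _ _ _ _ h; rewrite !eA.
    by under eq_bigr do rewrite mxE; under [X in _ + _ * X]eq_bigr do rewrite mxE.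
  have ex k : \sum_j x 0 j * RtoC (J j k) = Complex (\sum_j al 0 j * J j k) (\sum_j be 0 j * J j k).
    have -> : Complex (\sum_j al 0 j * J j k) (\sum_j be 0 j * J j k) =
       RtoC (\sum_j al 0 j * J j k) + ii * RtoC (\sum_j be 0 j * J j k).
      by rewrite [LHS]CE.
    rewrite !RtoC_sum mulr_sumr -big_split; apply: eq_bigr => j _ /=.
    by rewrite {1}xE !mxE !RtoCM; ring.
  have h2 k : Complex (\sum_j al 0 j * J j (lshift N k)) (\sum_j be 0 j * J j (lshift N k)) =
     ii * Complex (\sum_j al 0 j * J j (rshift N k)) (\sum_j be 0 j * J j (rshift N k)).
    have := h' k; rewrite !ex; move: (Complex _ _) (Complex _ _) => b a hab.
    have i0 : ii != 0 by exact: neq0Ci.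
    have ii2 : ii * ii = -1 by rewrite -expr2 sqrCi.
    have e : a + ii^-1 * b = 0.
      have -> : a + ii^-1 * b = 2 * (2^-1 * a + (2 * ii)^-1 * b) by field.
      by rewrite hab mulr0.
    have iv : ii^-1 = - ii by apply: (mulfI i0); rewrite mulfV // mulrN ii2 opprK.
    by move: e; rewrite iv mulNr => /eqP; rewrite subr_eq0 => /eqP.
  split; apply/rowP => k; have := h2 k; rewrite iE => /(congr1 (fun z : C => (ReC z, ImC z)));
    rewrite /ReC /ImC /= !mul0r !mul1r ?sub0r ?add0r ?addr0 => -[e1 e2]; rewrite !mxE.
    transitivity (\sum_j al 0 j * J j (lshift N k)).
      by apply: eq_bigr => j _; rewrite [lsubmx _ _ _]mxE.
    by rewrite e1; congr (- _); apply: eq_bigr => j _; rewrite [rsubmx _ _ _]mxE.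
  transitivity (\sum_j be 0 j * J j (lshift N k)).
    by apply: eq_bigr => j _; rewrite [lsubmx _ _ _]mxE.
  by rewrite e2; apply: eq_bigr => j _; rewrite [rsubmx _ _ _]mxE.
case: key => k1 k2.
have JE : J = row_mx (lsubmx J) (rsubmx J) by rewrite hsubmxK.
have be0 (v : E) : be *m J *m v^T = 0.
  have [a [b [ha hb ->]]] := gJ v.
  have ta (c : E) : c *m J^T = 0 -> J *m c^T = 0 by move=> /(congr1 trmx); rewrite trmx_mul trmxK trmx0.
  have trD (c d : E) : (c + d)^T = c^T + d^T by apply/matrixP => k l; rewrite !mxE.
  rewrite trD mulmxDr -mulmxA (ta _ ha) mulmx0 add0r.
  have hb' := ta _ hb; move: hb'; rewrite {1}JE -{1}[b]hsubmxK tr_row_mx mul_row_col => hb'.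
  have trN (c : 'rV[R]_N) : (- c)^T = - c^T by apply/matrixP => k l; rewrite !mxE.
  rewrite /Jmx tr_row_mx {1}JE mul_mx_row mul_row_col trN mulmxN k2.
  have -> : be *m rsubmx J = - (al *m lsubmx J) by rewrite k1 opprK.
  by rewrite mulNmx -opprD addrC -!mulmxA -mulmxDr hb' mulmx0 oppr0.
have beJ : be *m J = 0.
  apply/rowP => k; have := be0 (delta_mx 0 k); rewrite trmx_delta => /matrixP/(_ 0 0).
  by rewrite -colE !mxE.
have be00 : be = 0 by apply: (row_free_inj fJ); rewrite /= beJ mul0mx.
have alJ : al *m J = 0.
  by rewrite JE mul_mx_row k1 -k2 be00 !mul0mx oppr0 row_mx0.
have al00 : al = 0 by apply: (row_free_inj fJ); rewrite /= alJ mul0mx.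
rewrite xE be00 al00; apply/rowP => j; rewrite !mxE RtoC0 mulr0 addr0 //.
Qed.

(** rho = 0 is near 0 a real analytic submanifold of real codimension n,
and it is CR-generic at 0. *)
Record generic_germ : Prop := GenericGerm {
  germ0 : rho 0 = 0;
  germ_an : forall j, real_analytic_at (fun t => RtoC (rho t 0 j)) 0;
  germ_free : row_free (jac 0);
  germ_gen : forall v : E, exists a b : E,
    [/\ a *m (jac 0)^T = 0, b *m (jac 0)^T = 0 & v = a + Jmx b] }.

Lemma germ_ext : generic_germ -> exists P : 'rV[C]_(N + N) -> 'rV[C]_n,
  [/\ AnV P, forall h, P (map_mx Num.conj h) = map_mx Num.conj (P h) &
      near0R (fun t => cx (rho t) = P (cx t))].
Proof.
move=> hr.
have /choice[P hP] j : exists P : 'rV[C]_(N + N) -> C, [/\ An P,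
    near0R (fun t => RtoC (rho t 0 j) = P (cx t)) & forall h, P (map_mx Num.conj h) = Num.conj (P h)].
  have [r [P [r0 aP eP cP]]] := real_analytic_ext_real (germ_an hr j).
  exists P; split=> //; first by exists r.
  by exists r; split=> // t /eP; rewrite add0r.
exists (fun h => \row_j P j h); split.
- by move=> j; have [aj _ _] := hP j; apply: (An_eq aj) => h; rewrite mxE.
- by move=> h; apply/rowP => j; rewrite !mxE; have [_ _ ->] := hP j.
- have hj j : near0R (fun t => RtoC (rho t 0 j) = P j (cx t)) by case: (hP j).
  have := near0R_fin hj; apply: near0R_sub => t h.
  by apply/rowP => j; rewrite !mxE -h.
Qed.

Lemma germ_RA j : generic_germ -> RA (fun t => RtoC (rho t 0 j)).
Proof.
move=> /germ_ext[P [aP _ eP]]; exists (fun h => P h 0 j); split=> //.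
by apply: near0R_sub eP => t <-; rewrite mxE.
Qed.

(** The linear part of the holomorphic extension is the real Jacobian. *)
Lemma germ_lin (P : 'rV[C]_(N + N) -> 'rV[C]_n) : generic_germ -> AnV P ->
  near0R (fun t => cx (rho t) = P (cx t)) ->
  flatV (fun h => P h - h *m map_mx (@RtoC R) (jac 0)^T).
Proof.
move=> hr aP eP j.
have P0 : P 0 = 0 by have := near0R_at0 eP; rewrite (germ0 hr) !cx0 => <-.
have [c [K [[q [q0 hq]] fc]]] := An_taylor2 (aP j).
have cj k : c k = RtoC (jac 0 j k).
  have [r [r0 he]] := eP.
  have hd : hasd (fun t => RtoC (rho t 0 j)) 0 (delta_mx 0 k) (c k).
    rewrite -(sum_delta k (fun k => c k)); apply: (@taylor_hasd R _ _ _ _ `|K| (Num.min q r)) => //.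
      by rewrite lt_min q0.
    move=> d; rewrite le_min => /andP[dq dr].
    rewrite add0r (germ0 hr).
    have E1 : RtoC (rho d 0 j) = P (cx d) 0 j by rewrite -he // mxE.
    rewrite E1 mxE RtoC0 subr0.
    have := hq (cx d) dq; rewrite P0 mxE subr0.
    have -> : \sum_i c i * cx d 0 i = \sum_i RtoC (d 0 i) * c i.
      by apply: eq_bigr => i _; rewrite mxE mulrC.
    by move=> /le_trans; apply; rewrite ler_wpM2r ?exprn_ge0 ?vn_ge0 // ler_norm.
  by rewrite (hasd_real hd) !mxE.
apply: flat_ext fc => h; rewrite P0 !mxE subr0; congr (_ - _).
by apply: eq_bigr => k _; rewrite !mxE cj mxE mulrC.
Qed.

Definition upart (q : 'rV[C]_N) : 'rV[C]_n := 2^-1 *: (rsubmx q + map_mx Num.conj (rsubmx q)).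
Definition vpart (q : 'rV[C]_N) : 'rV[C]_n := (2 * ii)^-1 *: (rsubmx q - map_mx Num.conj (rsubmx q)).
(** The arguments (z, conj z, u) of the graphing function at a point
q = (z, u + i v). *)
Definition hq (q : 'rV[C]_N) : 'rV[C]_(1 + 1 + n) :=
  tri (lsubmx q) (map_mx Num.conj (lsubmx q)) (upart q).

Lemma upart_vpart q : upart q + ii *: vpart q = rsubmx q.
Proof.
rewrite /upart /vpart; move: (rsubmx q) (map_mx Num.conj _) => a b.
apply/rowP => j; rewrite !mxE; field; exact: neq0Ci.
Qed.
Lemma upart_vpart_conj q : upart q - ii *: vpart q = map_mx Num.conj (rsubmx q).
Proof.
rewrite /upart /vpart; move: (rsubmx q) (map_mx Num.conj _) => a b.
apply/rowP => j; rewrite !mxE; field; exact: neq0Ci.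
Qed.
Lemma conj_upart q : map_mx Num.conj (upart q) = upart q.
Proof.
apply/rowP => j; rewrite !mxE rmorphM rmorphD /= conjCK fmorphV rmorph_nat.
by rewrite addrC.
Qed.
Lemma mirror_hq q : mirror (hq q) = hq q.
Proof. by rewrite /mirror /hq tzE tcE tuE map_conjK conj_upart. Qed.
Lemma point_pair_hq q : point_pair (row_mx (hq q) (vpart q)) = row_mx q (map_mx Num.conj q).
Proof.
rewrite /hq point_pairE upart_vpart upart_vpart_conj hsubmxK.
by rewrite -map_row_mx hsubmxK.
Qed.
Lemma vn_upart q : vn (upart q) <= vn q.
Proof.
rewrite (le_trans (vnZ _ _)) // nmV nm_nat ler_pdivrMl ?ltr0n // mulr_natl mulr2n.
rewrite (le_trans (vnD _ _)) // vn_conj; exact: lerD (vn_rsub _) (vn_rsub _).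
Qed.
Lemma vn_vpart q : vn (vpart q) <= vn q.
Proof.
rewrite (le_trans (vnZ _ _)) // nmV nmM nm_i mulr1 nm_nat ler_pdivrMl ?ltr0n // mulr_natl mulr2n.
rewrite (le_trans (vnB _ _)) // vn_conj; exact: lerD (vn_rsub _) (vn_rsub _).
Qed.
Lemma vn_hq q : vn (hq q) <= vn q.
Proof. by apply: vn_tri; rewrite ?vn_conj ?vn_lsub ?vn_upart. Qed.

Lemma near0_cpt (Q : 'rV[C]_N -> Prop) : near0 Q -> near0R (fun t => Q (cpt t)).
Proof.
move=> [r [r0 h]]; exists (r / 2); split; first by lra.
by move=> t ht; apply: h; rewrite (le_trans (vn_cpt t)) // mulrC -ler_pdivlMr.
Qed.
Lemma near0_hq (Q : 'rV[C]_(1 + 1 + n) -> Prop) : near0 Q -> near0 (fun q => Q (hq q)).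
Proof.
by move=> [r [r0 h]]; exists r; split=> // q qr; apply: h; exact: le_trans (vn_hq q) qr.
Qed.
Lemma near0_hq_vpart (Q : 'rV[C]_(1 + 1 + n + n) -> Prop) : near0 Q ->
  near0 (fun q => Q (row_mx (hq q) (vpart q))).
Proof.
move=> [r [r0 h]]; exists r; split=> // q qr; apply: h; apply: vn_row_mx.
  exact: le_trans (vn_hq q) qr.
exact: le_trans (vn_vpart q) qr.
Qed.

Lemma recon_lin (a b : 'rV[C]_N) (J : 'M[R]_(n, N + N)) :
  let D := 2^-1 *: map_mx (@RtoC R) (lsubmx J) + (2 * ii)^-1 *: map_mx (@RtoC R) (rsubmx J) in
  recon (row_mx a b) *m map_mx (@RtoC R) J^T = a *m D^T + b *m map_mx Num.conj D^T.
Proof.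
move=> D; pose A := (map_mx (@RtoC R) (lsubmx J))^T; pose B := (map_mx (@RtoC R) (rsubmx J))^T.
have -> : map_mx (@RtoC R) J^T = col_mx A B.
  by rewrite -{1}[J]hsubmxK tr_row_mx map_col_mx /A /B !map_trmx.
have DE : D^T = 2^-1 *: A + (2 * ii)^-1 *: B by rewrite /D linearD /= !linearZ.
have cDE : map_mx Num.conj D^T = 2^-1 *: A - (2 * ii)^-1 *: B.
  rewrite DE; apply/matrixP => i j; rewrite !mxE rmorphD !rmorphM /= !conj_RtoC.
  rewrite !fmorphV rmorphM !rmorph_nat /= conjCi mulrN invrN mulNr.
  by [].
rewrite cDE DE /recon row_mxKl row_mxKr mul_row_col -!scalemxAl mulmxDl mulmxBl.
rewrite mulmxDr mulmxBr -!scalemxAr.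
move: (a *m A) (a *m B) (b *m A) (b *m B) => x y z w.
by apply/rowP => j; rewrite !mxE; ring.
Qed.

(** Coordinates F, with inverse G, in which rho = 0 is the graph
v = phi (z, conj z, u) with phi (z, 0, u) = phi (0, chi, u) = 0. The last bound
makes the distance to the graph comparable to rho. *)
Record normal_data (F G : 'rV[C]_N -> 'rV[C]_N) (phi : 'rV[C]_(1 + 1 + n) -> 'rV[C]_n) : Prop :=
  NormalData {
  nd_F : AnV F; nd_G : AnV G; nd_F0 : F 0 = 0; nd_G0 : G 0 = 0;
  nd_GF : near0 (fun p => G (F p) = p); nd_FG : near0 (fun q => F (G q) = q);
  nd_phi : AnV phi; nd_flat : flatV phi;
  nd_sym : near0 (fun x => phi (mirror x) = map_mx Num.conj (phi x));
  nd_chi0 : near0 (fun x => phi (tri (tz x) 0 (tu x)) = 0);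
  nd_z0 : near0 (fun x => phi (tri 0 (tc x) (tu x)) = 0);
  nd_eq : near0R (fun t => (rho t = 0 <-> vpart (F (cpt t)) = phi (hq (F (cpt t)))) /\
        vn (vpart (F (cpt t)) - phi (hq (F (cpt t)))) <= 2 * vn (cx (rho t))) }.

(** [normal_coordinates], applied to the holomorphic extension of rho in
linear coordinates adapted to its complex gradient. *)
Theorem normal_form : generic_germ -> exists F G phi, normal_data F G phi.
Proof.
move=> hr; have [P [aP sP eP]] := germ_ext hr.
have lP := germ_lin hr aP eP.
have fD := complex_gradient_free (germ_free hr) (germ_gen hr).
set D := (X in row_free X) in fD.
have [B [S [SB BS BD]]] := adapted_basis fD.
pose Bc := map_mx Num.conj B.
pose lm (y : 'rV[C]_(N + N)) := recon (row_mx (lsubmx y *m B) (rsubmx y *m Bc)).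
have alm : AnV lm.
  have h1 : AnV (fun y : 'rV[C]_(N + N) => lsubmx y *m B).
    by apply: AnV_mul; apply: AnV_lsub; exact: AnV_id.
  have h2 : AnV (fun y : 'rV[C]_(N + N) => rsubmx y *m Bc).
    by apply: AnV_mul; apply: AnV_rsub; exact: AnV_id.
  apply: (AnV_eq (F := fun y => row_mx (2^-1 *: (lsubmx y *m B + rsubmx y *m Bc))
       ((2 * ii)^-1 *: (lsubmx y *m B - rsubmx y *m Bc)))).
    by apply: AnV_row; apply: AnV_scale; [exact: AnV_add|exact: AnV_sub].
  by move=> y; rewrite /lm /recon row_mxKl row_mxKr.
have lm0 : lm 0 = 0.
  by rewrite /lm /recon row_mxKl row_mxKr !linear0 !mul0mx subr0 addr0 !scaler0 row_mx0.
have hP : herm_eq (fun y => P (lm y)).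
  split.
  - exact: AnV_comp.
  - move=> p q; rewrite /lm !row_mxKl !row_mxKr -sP -recon_conj; congr (P (recon (row_mx _ _))).
      by rewrite map_mxM /Bc map_conjK.
    by rewrite map_mxM.
  - have := flatV_comp lP (AnV_Lip alm) lm0 => /flatV_eq; apply=> y.
    congr (_ - _); rewrite /lm recon_lin -/D -mulmxA BD -mulmxA.
    have -> : Bc *m map_mx Num.conj D^T = - ((2 * ii)^-1 *: col_mx 0 1%:M).
      rewrite -map_mxM BD; apply/matrixP => i j; rewrite !mxE.
      case: (fintype.split i) => k; rewrite !mxE ?mulr0 ?rmorph0 ?oppr0 //.
      rewrite rmorphM rmorph_nat fmorphV rmorphM rmorph_nat /= conjCi mulrN invrN.
      by rewrite mulNr.
    have pick (q : 'rV[C]_N) : q *m col_mx 0 1%:M = rsubmx q.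
      by rewrite -{1}[q]hsubmxK mul_row_col mulmx0 add0r mulmx1.
    by rewrite mulmxN -!scalemxAr !pick -scalerBr.
have [G1 [phi [aG1 fG1 aphi fphi [sphi v1 v2 ephi bphi]]]] := normal_coordinates hP.
have [lG1 G10] := LipV_of_flat fG1.
have aQ : AnV (fun q => G1 q - q) by apply: AnV_sub => //; exact: AnV_id.
have [F1 [aF1 fF1 [r [r0 [hF1 hG1]]]]] := inverse_function aQ fG1.
have [lF1 F10] := LipV_of_flat fF1.
have aS : AnV (fun p : 'rV[C]_N => p *m S) by apply: AnV_mul; exact: AnV_id.
have S0 : (0 : 'rV[C]_N) *m S = 0 by rewrite mul0mx.
have GF1 : near0 (fun p => G1 (F1 p) = p).
  by exists r; split=> // p /hF1; rewrite addrC subrK.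
have FG1 : near0 (fun q => F1 (G1 q) = q).
  by exists r; split=> // q /hG1; rewrite addrC subrK.
pose F p := F1 (p *m S); pose G q := G1 q *m B.
have aF : AnV F by exact: AnV_comp.
have F0 : F 0 = 0 by rewrite /F S0.
have GFS := near0_comp GF1 (AnV_Lip aS) S0.
exists F, G, phi; split=> //.
- exact: AnV_mul.
- by rewrite /G G10 mul0mx.
- by apply: near0_sub GFS => p e; rewrite /G e -mulmxA SB mulmx1.
- by apply: near0_sub FG1 => q e; rewrite /F /G -mulmxA BS mulmx1.
have n1 := near0_cpt GFS.
have n2 := near0_cpt (near0_comp (near0_hq ephi) (AnV_Lip aF) F0).
have n3 := near0_cpt (near0_comp (near0_hq_vpart bphi) (AnV_Lip aF) F0).
apply: near0R_sub (near0R_and eP (near0R_and n1 (near0R_and n2 n3))) => t [e0 [e1 [e2 e3]]].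
set q := F (cpt t).
have E : P (lm (double G1 (point_pair (row_mx (hq q) (vpart q))))) = cx (rho t).
  rewrite point_pair_hq /double row_mxKl row_mxKr /conjV map_conjK /lm row_mxKl row_mxKr.
  by rewrite -map_mxM e1 -mulmxA SB mulmx1 recon_cpt e0.
rewrite -/q E row_mxKl row_mxKr in e3; rewrite -/q in e2; split=> //.
split=> [h|h].
  apply/eqP; rewrite -subr_eq0; apply/eqP/vn_eq0.
  by rewrite (le_trans e3) // h cx0 vn0 mulr0.
by rewrite -h E in e2; apply/rowP => j; have /rowP/(_ j) := e2; rewrite !mxE => /RtoC_inj.
Qed.

End NormalForm.

(** * Functions vanishing on the submanifold *)

Section Tangential.
Variables (R : realType) (n : nat).
Local Notation C := (Cplx R).
Local Notation N := (1 + n)%N.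
Local Notation E := 'rV[R]_(N + N).
Local Notation ii := ('i : C).
Variable rho : E -> 'rV[R]_n.

Lemma flat_le m k (phi : 'rV[C]_m -> 'rV[C]_k) : flatV phi -> near0 (fun x => vn (phi x) <= vn x).
Proof.
move=> /flatV_unif[p0 /(_ 1 ltr01)[r [r0 hr]]]; exists r; split=> // x xr.
by have := hr x 0 xr; rewrite vn0 p0 !subr0 mul1r (ltW r0) => /(_ isT).
Qed.

(** Keep z and u and replace v by phi: the displacement is v - phi, which
is bounded by rho. *)
Lemma projection F G phi : normal_data rho F G phi ->
  exists K : R, 0 < K /\ near0R (fun t => exists t', rho t' = 0 /\
    vn (cx (t' - t)) <= K * vn (cx (rho t))).
Proof.
move=> nd.
have [K [g [K0 g0 hG]]] := LipV_unif (AnV_Lip (nd_G nd)).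
have [f [f0 hFG]] := nd_FG nd.
have [e [e0 he]] := nd_eq nd.
have [s [s0 hs]] := near0_hq (nd_sym nd).
have [l [l0 hl]] := near0_hq (flat_le (nd_flat nd)).
have [b [b0 hb]] := LipV_small (AnV_Lip (nd_G nd)) (nd_G0 nd) e0.
pose m := Num.min (Num.min g f) (Num.min b (Num.min s l)).
have m0 : 0 < m by rewrite !lt_min g0 f0 b0 s0.
have [mg mf mb ms ml] : [/\ m <= g, m <= f, m <= b, m <= s & m <= l].
  by rewrite /m !ge_min !lexx !orbT.
have m20 : 0 < m / 2 by lra.
have [q0 [q00 hq0]] := LipV_small (AnV_Lip (nd_F nd)) (nd_F0 nd) m20.
have small := near0_cpt (ex_intro _ q0 (conj q00 hq0)).
have GF := near0_cpt (nd_GF nd).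
exists (2 * K); split; first by rewrite mulr_gt0.
apply: near0R_sub (near0R_and small (near0R_and GF (nd_eq nd))) => t [qs [gf [_ bd]]].
move: qs gf bd; set q := F (cpt t) => qs gf bd.
pose q' := row_mx (lsubmx q) (upart q + ii *: phi (hq q)) : 'rV[C]_N.
have mm : m / 2 <= m by lra.
have ql : vn q <= m by exact: le_trans mm.
have phr : map_mx Num.conj (phi (hq q)) = phi (hq q).
  by have := hs q (le_trans ql ms); rewrite mirror_hq => <-.
have phs : vn (phi (hq q)) <= vn q.
  exact: le_trans (hl q (le_trans ql ml)) (vn_hq q).
have q's : vn q' <= m.
  apply: vn_row_mx; first exact: le_trans (vn_lsub _) ql.
  rewrite (le_trans (vnD _ _)) // (splitr m) lerD //.
    exact: le_trans (vn_upart _) qs.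
  by rewrite (le_trans (vnZ _ _)) // nm_i mul1r (le_trans phs).
have uq' : upart q' = upart q.
  rewrite {1}/upart /q' row_mxKr conj_addi conj_upart phr.
  by apply/rowP => j; rewrite !mxE; field.
have vq' : vpart q' = phi (hq q).
  rewrite {1}/vpart /q' row_mxKr conj_addi conj_upart phr.
  move: (upart q) (phi _) => u v.
  by apply/rowP => j; rewrite !mxE; field; exact: neq0Ci.
have hq' : hq q' = hq q by rewrite /hq uq' /q' row_mxKl.
have FG' : F (G q') = q' by apply: hFG; exact: le_trans mf.
exists (rpt (G q')); split.
  have [] := he (rpt (G q')).
    by apply: le_trans (vn_rpt _) _; apply: hb; exact: le_trans q's mb.
  by rewrite rptK FG' vq' hq' => -[_ ->].
have -> : rpt (G q') - t = rpt (G q' - G q) by rewrite rptB gf cptK.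
apply: le_trans (vn_rpt _) _.
apply: le_trans (hG _ _ (le_trans q's mg) (le_trans ql mg)) _.
rewrite -mulrA mulrCA (ler_pM2l K0); apply: le_trans _ bd.
have -> : q' - q = row_mx 0 (ii *: (phi (hq q) - vpart q)).
  transitivity (q' - row_mx (lsubmx q) (upart q + ii *: vpart q)).
    by rewrite upart_vpart hsubmxK.
  rewrite /q' opp_row_mx add_row_mx subrr scalerBr.
  by congr row_mx; rewrite opprD addrACA subrr add0r.
apply: vn_row_mx; first by rewrite vn0 vn_ge0.
by apply: le_trans (vnZ _ _) _; rewrite nm_i mul1r vnBC.
Qed.

Definition vanishes_on (g : E -> C) := near0R (fun t => rho t = 0 -> g t = 0).

Lemma RA_Lip (g : E -> C) : RA g -> exists K r : R, [/\ 0 < K, 0 < r & forall s t : E,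
  vn (cx s) <= r -> vn (cx t) <= r -> nm (g s - g t) <= K * vn (cx (s - t))].
Proof.
move=> [H [aH [q [q0 hH]]]]; have [K [r [K0 r0 hr]]] := An_Lip aH.
exists K, (Num.min q r); split=> //; first by rewrite lt_min q0.
move=> s t; rewrite !le_min => /andP[s1 s2] /andP[t1 t2].
by rewrite !hH // cxB; exact: hr.
Qed.

(** rho (p + s X) = O (s^2), so p + s X is at distance O (s^2) of the
submanifold by [projection]. As g vanishes there and is Lipschitz,
g (p + s X) = O (s^2). *)
Lemma vanishes_tangent F G phi (g : E -> C) : generic_germ rho -> normal_data rho F G phi ->
  RA g -> vanishes_on g ->
  near0R (fun p => rho p = 0 -> forall X : E, X *m (jac rho p)^T = 0 ->
     \sum_k RtoC (X 0 k) * dpart k g p = 0).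
Proof.
move=> gr nd rg [v [v0 hv]].
have [K [K0 [r1 [r10 hP]]]] := projection nd.
have [Kg [rg' [Kg0 rg'0 hg]]] := RA_Lip rg.
have hrho := near0R_fin (fun j => RA_hasd (germ_RA j gr)).
(* p lies within m / 4 of 0, p + s X within m / 2, and its projection within m *)
pose m := Num.min (Num.min v r1) rg'.
have m0 : 0 < m by rewrite !lt_min v0 r10.
have [mv mr mg] : [/\ m <= v, m <= r1 & m <= rg'] by rewrite /m !ge_min !lexx !orbT.
have near : near0R (fun p : E => vn (cx p) <= m / 4) by exists (m / 4); split=> //; lra.
apply: near0R_sub (near0R_and hrho (near0R_and (RA_hasd rg) near)) => p [h1 [h2 hp]] rp X hX.
apply: (hasd_uniq (h2 X)).
have /choice[KK hKK] j : exists K, hasd (fun t => RtoC (rho t 0 j)) p X 0 /\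
    exists r, 0 < r /\ forall s, `|s| <= r -> nm (RtoC (rho (p + s *: X) 0 j)) <= K * s ^+ 2.
  have hd := h1 j X.
  have z : \sum_k RtoC (X 0 k) * dpart k (fun t => RtoC (rho t 0 j)) p = 0.
    have /matrixP/(_ 0 j) := hX; rewrite !mxE => /(congr1 (@RtoC R)); rewrite RtoC0 RtoC_sum => e0.
    apply: (etrans _ e0).
    by apply: eq_bigr => k _; rewrite dpart_real RtoCM !mxE.
  rewrite z in hd; have [K' [r [r0 hK']]] := hd.
  exists K'; split=> //; exists r; split=> // s hs.
  by have := hK' s hs; rewrite rp mxE RtoC0 mulr0 !subr0.
have [r2 [r20 hr2]] : exists r, 0 < r /\ forall j s, `|s| <= r ->
    nm (RtoC (rho (p + s *: X) 0 j)) <= KK j * s ^+ 2.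
  apply: common_radius => [j r r' rr h s hs|j]; last by case: (hKK j) => _ [r [? ?]]; exists r.
  by apply: h; exact: le_trans rr.
pose S := \sum_j `|KK j|.
have S0 : 0 <= S by rewrite sumr_ge0.
have rs s : `|s| <= r2 -> vn (cx (rho (p + s *: X))) <= S * s ^+ 2.
  move=> hs; apply: vn_le => [|j]; first by rewrite mulr_ge0 // sqr_ge0.
  rewrite mxE (le_trans (hr2 j s hs)) // ler_wpM2r ?sqr_ge0 //.
  by rewrite (le_trans (ler_norm _)) // /S (bigD1 j) //= lerDl sumr_ge0.
have V0 := vn_ge0 (cx X); have V1 : 0 < vn (cx X) + 1 by lra.
pose c1 := m / 4 / (vn (cx X) + 1).
have c10 : 0 < c1 by rewrite divr_gt0 //; lra.
pose c2 := Num.min 1 (m / 4 / (K * S + 1)).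
have KS : 0 <= K * S by rewrite mulr_ge0 // ltW.
have c20 : 0 < c2 by rewrite lt_min ltr01 divr_gt0 //; lra.
exists (Kg * (K * S)), (Num.min r2 (Num.min c1 c2)); split.
  by rewrite lt_min r20 lt_min c10 c20.
move=> s; rewrite !le_min => /andP[sr2 /andP[sc1 /andP[s1 sc2]]].
rewrite mulr0 subr0.
have gp : g p = 0 by apply: hv => //; lra.
rewrite gp subr0.
have ts : vn (cx (p + s *: X)) <= m / 2.
  rewrite cxD (le_trans (vnD _ _)) // cxZ.
  have : vn (RtoC s *: cx X) <= m / 4.
    rewrite (le_trans (vnZ _ _)) // nm_real.
    move: sc1; rewrite /c1 ler_pdivlMr // => /(le_trans _); apply.
    by rewrite ler_wpM2l // lerDl.
  lra.
have [t' [rt' dt']] := hP (p + s *: X) ltac:(lra).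
have dt : vn (cx (t' - (p + s *: X))) <= K * S * s ^+ 2.
  by rewrite (le_trans dt') // -mulrA ler_pM2l // rs.
have dt2 : K * S * s ^+ 2 <= m / 4.
  have : K * S * s ^+ 2 <= (K * S + 1) * `|s|.
    rewrite -[s ^+ 2]real_normK ?num_real // expr2.
    have sn := normr_ge0 s; have : `|s| * `|s| <= `|s| by rewrite ler_piMr.
    by move: (`|s|) sn KS => a; move: (K * S) => b; nra.
  move=> /le_trans; apply; move: sc2; rewrite ler_pdivlMr; last by lra.
  by rewrite mulrC.
have t's : vn (cx t') <= m.
  have -> : t' = (t' - (p + s *: X)) + (p + s *: X) by rewrite subrK.
  rewrite cxD (le_trans (vnD _ _)) //; lra.
have gt' : g t' = 0 by apply: hv => //; exact: le_trans mv.
rewrite -[g _]subr0 -gt' (le_trans (hg _ _ _ _)) //; [lra|lra|].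
rewrite -mulrA ler_pM2l // cxB vnBC -cxB //.
Qed.

End Tangential.

(** * A generator of the vectors of type (1,0) *)

Section Field.
Variables (R : realType) (n : nat).
Local Notation C := (Cplx R).
Local Notation N := (1 + n)%N.
Local Notation E := 'rV[R]_(N + N).
Local Notation ii := ('i : C).
Variable rho : E -> 'rV[R]_n.

Lemma RA_det k (M : E -> 'M[C]_k) : (forall i j, RA (fun t => M t i j)) ->
  RA (fun t => \det (M t)).
Proof.
move=> hM; apply: RA_sum => s; apply: RAM; first exact: RA_cst.
by apply: RA_prod => i; exact: hM.
Qed.

Definition cjac (t : E) : 'M[C]_(n, N + N) := map_mx (@RtoC R) (jac rho t).
Definition gradc (t : E) : 'M[C]_(n, N) := lsubmx (cjac t) - ii *: rsubmx (cjac t).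
Definition frame_mx (e : 'rV[C]_N) (t : E) : 'M[C]_(1 + n) := col_mx e (gradc t).
(** The minors of the complex gradient, as cofactors of a square matrix: a
vector that is orthogonal to the gradient and depends analytically on t. *)
Definition cr_coef (e : 'rV[C]_N) (t : E) : 'rV[C]_N := \row_k cofactor (frame_mx e t) (lshift n 0) k.
(** The field with components l_k along d/dx_k and - i l_k along d/dy_k. *)
Definition cr_field (e : 'rV[C]_N) (t : E) : 'rV[C]_(N + N) := row_mx (cr_coef e t) (- ii *: cr_coef e t).

Lemma cr_coef_kernel e t : cr_coef e t *m (gradc t)^T = 0.
Proof.
apply/rowP => j; rewrite mxE [RHS]mxE.
have /matrixP/(_ (rshift 1 j) (lshift n 0)) := mul_mx_adj (frame_mx e t).
rewrite mxE => h; have e0 : (\det (frame_mx e t))%:M (rshift 1 j) (lshift n 0 : 'I_(1 + n)) = 0.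
  by rewrite mxE eq_rlshift mulr0n.
rewrite e0 in h; rewrite -{}[RHS]h; apply: eq_bigr => k _.
rewrite [(\adj _) _ _]mxE [(cr_coef e t) 0 k]mxE mulrC; congr (_ * _).
by rewrite /frame_mx col_mxEd [in LHS]mxE.
Qed.
Lemma cr_coef_det e t : cr_coef e t *m e^T = (\det (frame_mx e t))%:M.
Proof.
apply/matrixP => i j; rewrite !ord1 mxE [RHS]mxE eqxx mulr1n.
have /matrixP/(_ (lshift n 0) (lshift n 0)) := mul_mx_adj (frame_mx e t).
rewrite [RHS]mxE eqxx mulr1n mxE => h; rewrite -{}[RHS]h; apply: eq_bigr => k _.
rewrite [(\adj _) _ _]mxE [(cr_coef e t) 0 k]mxE mulrC; congr (_ * _).
by rewrite /frame_mx col_mxEu [in LHS]mxE.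
Qed.

(** A vector z orthogonal to the gradient is determined by its product
with e, by Cramer's rule. *)
Lemma kernel_cr_coef e t (z : 'rV[C]_N) : \det (frame_mx e t) != 0 -> z *m (gradc t)^T = 0 ->
  exists c : C, z = c *: cr_coef e t.
Proof.
move=> d0 hz; set A := frame_mx e t in d0.
have Az : A *m z^T = col_mx (e *m z^T) 0.
  rewrite /A /frame_mx mul_col_mx; congr col_mx.
  by rewrite -[gradc t]trmxK -trmx_mul hz trmx0.
exists ((e *m z^T) 0 0 / \det A).
have h : \adj A *m (A *m z^T) = \det A *: z^T by rewrite mulmxA mul_adj_mx mul_scalar_mx.
apply/rowP => k; have /matrixP/(_ k 0) := h; rewrite Az.
rewrite [in X in _ = X -> _]mxE [z^T k 0]mxE mxE big_split_ord big_ord1 /=.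
rewrite [X in _ + X = _ -> _]big1 ?addr0 => [|i _]; last first.
  have z0 : (0 : 'cV[C]_n) i 0 = 0 by rewrite mxE.
  by rewrite col_mxEd z0 mulr0.
rewrite col_mxEu => h1; apply: (mulfI d0); rewrite -h1 mxE.
have eR c : (c *: cr_coef e t) 0 k = c * cofactor A (lshift n 0) k by rewrite 2!mxE.
rewrite eR mulrA [_ * (_ / _)]mulrC divfK // mulrC; congr (_ * _).
Qed.

Lemma cr_field_jac e t : cr_field e t *m (cjac t)^T = 0.
Proof.
rewrite /cr_field -[cjac t]hsubmxK tr_row_mx mul_row_col -scalemxAl.
have := cr_coef_kernel e t; rewrite /gradc linearB /= linearZ /= mulmxBr -scalemxAr => h.
by rewrite scaleNr.
Qed.

Lemma J_eigen (Z : 'rV[C]_(N + N)) : Jmx Z = ii *: Z <-> rsubmx Z = - ii *: lsubmx Z.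
Proof.
have i2 : ii * ii = -1 by rewrite -expr2 sqrCi.
rewrite -[Z]hsubmxK /Jmx !row_mxKl !row_mxKr; move: (lsubmx Z) (rsubmx Z) => a b.
rewrite scale_row_mx; split=> [/eq_row_mx[_ ->]|->].
  by rewrite scalerA mulNr i2 opprK scale1r.
by rewrite scalerA mulrN i2 opprK scale1r -scaleNr opprK.
Qed.

Lemma kernel_cr_field e t (Z : 'rV[C]_(N + N)) : \det (frame_mx e t) != 0 ->
  Z *m (cjac t)^T = 0 -> Jmx Z = ii *: Z -> exists c, Z = c *: cr_field e t.
Proof.
move=> d0 hZ /J_eigen hJ.
have [|c hc] := kernel_cr_coef d0 (z := lsubmx Z).
  move: hZ; rewrite -{1}[Z]hsubmxK -[cjac t]hsubmxK tr_row_mx mul_row_col hJ.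
  rewrite -scalemxAl scaleNr => h; rewrite /gradc.
  by rewrite linearB /= linearZ /= mulmxBr -scalemxAr.
exists c; rewrite -[Z]hsubmxK hJ hc /cr_field scale_row_mx; congr row_mx.
by rewrite !scalerA mulrC.
Qed.

Lemma RA_jac i k : generic_germ rho -> RA (fun t => cjac t i k).
Proof.
move=> gr; apply: (RA_eq (RA_dpart k (germ_RA i gr))) => t.
by rewrite dpart_real !mxE.
Qed.

Lemma RAV_cr_field e : generic_germ rho -> RAV (cr_field e).
Proof.
move=> gr.
have rg j k : RA (fun t => gradc t j k).
  apply: (RA_eq (RAB (RA_jac j (lshift N k) gr) (RAZ ii (RA_jac j (rshift N k) gr)))) => t.
  by rewrite !mxE.
have rf i j : RA (fun t => frame_mx e t i j).
  have [k ->|k ->] := split_ordP i.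
    by apply: (RA_eq (RA_cst _ (e k j))) => t; rewrite /frame_mx col_mxEu.
  by apply: (RA_eq (rg k j)) => t; rewrite /frame_mx col_mxEd.
have re k : RA (fun t => cr_coef e t 0 k).
  have := RAZ ((-1) ^+ (lshift n (0 : 'I_1) + k)) (RA_det (M := fun t => row' (lshift n 0) (col' k (frame_mx e t))) _).
  move=> h; apply: RA_eq (h _) _ => [i j|t]; last by rewrite mxE.
  by apply: (RA_eq (rf (lift (lshift n 0) i) (lift k j))) => t; rewrite !mxE.
move=> k; have [j ->|j ->] := split_ordP k.
  by apply: (RA_eq (re j)) => t; rewrite /cr_field row_mxEl.
by apply: (RA_eq (RAZ (- ii) (re j))) => t; rewrite /cr_field row_mxEr [RHS]mxE.
Qed.

Lemma RA_neq0 f : RA f -> f 0 != 0 -> near0R (fun t : E => f t != 0).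
Proof.
move=> /RA_Lip[K [r [K0 r0 h]]] f0.
have n0 : 0 < nm (f 0) by rewrite lt_def nm_ge0 andbT nm_eq0.
pose q := Num.min r (nm (f 0) / (2 * K)).
exists q; split; first by rewrite lt_min r0 divr_gt0 // mulr_gt0.
move=> t; rewrite le_min => /andP[tr tq]; apply: contraTneq n0 => ft.
have := h 0 t; rewrite ft subr0 cx0 vn0 sub0r cxN vnN => /(_ (ltW r0) tr) h1.
move: tq; rewrite ler_pdivlMr ?mulr_gt0 // => h2; rewrite -leNgt.
by move: h1 h2; move: (nm _) (vn _) => a b; lra.
Qed.

(** The field must be analytic in a whole ball and not only at 0, so it is
replaced by the restriction of one holomorphic extension. *)
Theorem field_exists : generic_germ rho -> exists L : E -> 'rV[C]_(N + N),
  [/\ RAV L, exists r : R, 0 < r /\ forall p, vn (cx p) < r -> forall k, real_analytic_at (fun t => L t 0 k) p,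
      near0R (fun p => L p *m (cjac p)^T = 0 /\ rsubmx (L p) = - ii *: lsubmx (L p)) &
      near0R (fun p => L p <> 0 /\ forall Z, Z *m (cjac p)^T = 0 -> Jmx Z = ii *: Z ->
         exists c, Z = c *: L p)].
Proof.
move=> gr.
have fD := complex_gradient_free (germ_free gr) (germ_gen gr).
have fG : row_free (gradc 0).
  have i0 : ii != 0 by exact: neq0Ci.
  have -> : gradc 0 = 2 *: (2^-1 *: map_mx (@RtoC R) (lsubmx (jac rho 0)) +
      (2 * ii)^-1 *: map_mx (@RtoC R) (rsubmx (jac rho 0))).
    have iv : ii^-1 = - ii.
      by apply: (mulfI i0); rewrite mulfV // mulrN -expr2 sqrCi opprK.
    rewrite scalerDr !scalerA invfM iv mulfV ?pnatr_eq0 // scale1r mulrA mulfV ?pnatr_eq0 //.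
    by rewrite mul1r scaleNr /gradc /cjac -!map_lsubmx -!map_rsubmx.
  by rewrite /row_free mxrank_scale_nz // pnatr_eq0.
have [e ue] := complete_basis fG.
have [G [aG eG]] := RAV_ext (RAV_cr_field e gr).
have rd : RA (fun t => \det (frame_mx e t)).
  apply: RA_det => i j; have [k ->|k ->] := split_ordP i.
    by apply: (RA_eq (RA_cst _ (e k j))) => t; rewrite /frame_mx col_mxEu.
  apply: (RA_eq (RAB (RA_jac k (lshift N j) gr) (RAZ ii (RA_jac k (rshift N j) gr)))) => t.
  by rewrite /frame_mx col_mxEd !mxE.
have d0 : \det (frame_mx e 0) != 0 by rewrite -unitfE -unitmxE.
have nd := RA_neq0 rd d0.
exists (fun t => G (cx t)); split.
- by move=> k; apply: RA_ext (RAV_cr_field e gr k) _; apply: near0R_sub eG => t ->.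
- have [r [r0 hr]] := AnV_apx aG; exists r; split=> // p pr k.
  have [a ha] := An_ps (An_shift pr (hr k)).
  exists a; move/near0P: ha => [q [q0 hq]]; apply/near0RP; exists q; split=> // t tq.
  by rewrite cxD; exact: hq.
- apply: near0R_sub eG => p <-; split; first exact: cr_field_jac.
  by rewrite /cr_field row_mxKl row_mxKr.
- apply: near0R_sub (near0R_and eG nd) => p [<- dp]; split; last by move=> Z; exact: kernel_cr_field.
  move=> /eqP f0; have l0 : cr_coef e p = 0.
    by move/eqP: f0 => /(congr1 lsubmx); rewrite /cr_field row_mxKl linear0.
  have := cr_coef_det e p; rewrite l0 mul0mx => /matrixP/(_ 0 0); rewrite !mxE eqxx mulr1n => h.
  by rewrite -h eqxx in dp.
Qed.

End Field.

(** * Weights with respect to a pair of vector fields *)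

Section Weights.
Variables (R : realType) (m : nat).
Local Notation C := (Cplx R).
Local Notation E := 'rV[R]_m.
Variables A B : E -> 'rV[C]_m.
Hypotheses (rA : RAV A) (rB : RAV B).

(** Membership in level k: the derivatives of f along A and B, in any order
and fewer than k in number, vanish at 0. *)
Fixpoint weight (k : nat) (f : E -> C) : Prop :=
  RA f /\ if k is k'.+1 then [/\ f 0 = 0, weight k' (dvf A f) & weight k' (dvf B f)] else True.

Lemma weight_RA k f : weight k f -> RA f. Proof. by case: k => [|k] []. Qed.
Lemma weightS k f : weight k.+1 f <-> [/\ RA f, f 0 = 0, weight k (dvf A f) & weight k (dvf B f)].
Proof. by split=> [[rf []]|[]]. Qed.
Lemma weight_at0 k f : weight k.+1 f -> f 0 = 0. Proof. by case=> _ []. Qed.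
Lemma weight0 f : RA f -> weight 0 f. Proof. by []. Qed.
Lemma weight1 f : RA f -> f 0 = 0 -> weight 1 f.
Proof. by move=> rf f0; split=> //; split=> //; apply: weight0; exact: RA_dvf. Qed.
Lemma weight_prev k f : weight k.+1 f -> weight k f.
Proof.
elim: k f => [|k IH] f [rf [f0 hA hB]]; first exact: weight0.
by split=> //; split=> //; exact: IH.
Qed.
Lemma weight_le k l f : (k <= l)%N -> weight l f -> weight k f.
Proof.
move=> /subnK <-; elim: (l - k)%N => // j IH hf.
by apply: IH; exact: weight_prev.
Qed.
Lemma weight_ext k f g : weight k f -> near0R (fun t => f t = g t) -> weight k g.
Proof.
elim: k f g => [|k IH] f g [rf hf] e; first by apply: weight0; exact: RA_ext e.
split; first exact: RA_ext e.
case: hf => f0 hA hB; split; first by rewrite -(near0R_at0 e).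
  by apply: IH hA _; exact: dvf_ext.
by apply: IH hB _; exact: dvf_ext.
Qed.
Lemma weight_eq k f g : weight k f -> f =1 g -> weight k g.
Proof. by move=> hf e; apply: weight_ext hf _; exact: near0R_all. Qed.
Lemma near0R_sym (f g : E -> C) : near0R (fun t => f t = g t) -> near0R (fun t => g t = f t).
Proof. by apply: near0R_sub => t. Qed.
Lemma weightD k f g : weight k f -> weight k g -> weight k (fun t => f t + g t).
Proof.
elim: k f g => [|k IH] f g [rf hf] [rg hg]; first by apply: weight0; exact: RAD.
case: hf hg => f0 fA fB [g0 gA gB].
split; first exact: RAD.
split; first by rewrite f0 g0 addr0.
  by apply: weight_ext (IH _ _ fA gA) _; apply: near0R_sym; exact: dvfD.
by apply: weight_ext (IH _ _ fB gB) _; apply: near0R_sym; exact: dvfD.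
Qed.
Lemma weight_zero k : weight k (fun=> 0).
Proof.
elim: k => [|k IH]; first by apply: weight0; exact: RA_cst.
split; first exact: RA_cst.
by split=> //; apply: (weight_eq IH) => t; rewrite dvf_cst.
Qed.
Lemma weight_sum k (I : Type) (s : seq I) (F : I -> E -> C) :
  (forall i, weight k (F i)) -> weight k (fun t => \sum_(i <- s) F i t).
Proof.
move=> hF; elim: s => [|i s IH].
  by apply: (weight_eq (weight_zero k)) => t; rewrite big_nil.
by apply: (weight_eq (weightD (hF i) IH)) => t; rewrite big_cons.
Qed.
(** Each derivative falls on one of the factors and lowers its weight by at
most 1. *)
Lemma weightM k l f g : weight k f -> weight l g -> weight (k + l) (fun t => f t * g t).
Proof.
move: {2}(k + l)%N (erefl (k + l)%N) => d.
elim: d k l f g => [|d IH] k l f g e hf hg.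
  by rewrite e; apply: weight0; apply: RAM; [exact: weight_RA hf|exact: weight_RA hg].
rewrite e; split; first by apply: RAM; [exact: weight_RA hf|exact: weight_RA hg].
have drop (X : E -> 'rV[C]_m) : RAV X -> (forall j h, weight j.+1 h -> weight j (dvf X h)) ->
    weight d (dvf X (fun t => f t * g t)).
  move=> rX hX.
  apply: weight_ext (near0R_sym (dvfM X (weight_RA hf) (weight_RA hg))); apply: weightD.
    case: k e hf => [|k] e hf.
      move: e hg; rewrite add0n => -> hg; rewrite -[d]add0n; apply: IH => //.
        by apply: weight0; apply: RA_dvf => //; exact: weight_RA hf.
      exact: weight_prev.
    by move: e; rewrite addSn => -[e]; rewrite -e; apply: IH => //; exact: hX.
  case: l e hg => [|l] e hg.
    move: e hf; rewrite addn0 => -> hf; rewrite -[d]addn0; apply: IH; rewrite ?addn0 //.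
      exact: weight_prev.
    by apply: weight0; apply: RA_dvf => //; exact: weight_RA hg.
  by move: e; rewrite addnS => -[e]; rewrite -e; apply: IH => //; exact: hX.
split.
- case: k e hf => [|k] e hf; last by rewrite (weight_at0 hf) mul0r.
  by move: e hg; rewrite add0n => -> hg; rewrite (weight_at0 hg) mulr0.
- by apply: drop => // j h [_ []].
- by apply: drop => // j h [_ []].
Qed.
Lemma weightZ k c f : weight k f -> weight k (fun t => c * f t).
Proof. by move=> hf; rewrite -[k]add0n; apply: weightM hf; apply: weight0; exact: RA_cst. Qed.

Lemma quadratic_dpart (k : 'I_m) (f : E -> C) (K : R) :
  near0R (fun t => nm (f t) <= K * vn (cx t) ^+ 2) -> f 0 = 0 /\ dpart k f 0 = 0.
Proof.
move=> h.
have f0 : f 0 = 0.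
  apply/eqP; rewrite -nm_eq0 eq_le nm_ge0 andbT.
  by have := near0R_at0 h; rewrite cx0 vn0 expr0n mulr0.
split=> //; apply: dpartE; have [r [r0 hr]] := h; exists `|K|, r; split=> // s sr.
have v1 : vn (cx (s *: delta_mx 0 k : E)) <= `|s|.
  apply: vn_le => // j; rewrite !mxE nm_real eqxx /= normrM ler_piMr //.
  by case: (j == k); rewrite ?normr1 ?normr0.
rewrite add0r f0 mulr0 !subr0 (le_trans (hr _ (le_trans v1 sr))) //.
apply: (@le_trans _ _ (`|K| * vn (cx (s *: delta_mx 0 k : E)) ^+ 2)).
  by rewrite ler_wpM2r ?exprn_ge0 ?vn_ge0 // ler_norm.
rewrite ler_wpM2l // -[s ^+ 2]real_normK ?num_real // lerXn2r ?nnegrE ?vn_ge0 //.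
Qed.
Lemma weight2_quadratic f (K : R) : RA f -> near0R (fun t => nm (f t) <= K * vn (cx t) ^+ 2) -> weight 2 f.
Proof.
move=> rf h.
have z X : dvf X f 0 = 0.
  by apply: big1 => k _; have [_ ->] := quadratic_dpart k h; rewrite mulr0.
have f0 : f 0 = 0.
  apply/eqP; rewrite -nm_eq0 eq_le nm_ge0 andbT.
  by have := near0R_at0 h; rewrite cx0 vn0 expr0n mulr0.
by split=> //; split=> //; apply: weight1 => //; exact: RA_dvf.
Qed.

Definition lowers (c : nat) (X : E -> 'rV[C]_m) := RAV X /\
  forall k f, weight (k + c) f -> weight k (dvf X f).
Lemma lowers_A : lowers 1 A. Proof. by split=> // k f; rewrite addn1 => -[_ []]. Qed.
Lemma lowers_B : lowers 1 B. Proof. by split=> // k f; rewrite addn1 => -[_ []]. Qed.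
Lemma lowers_bracket c d X Y : lowers c X -> lowers d Y -> lowers (c + d) (bracket X Y).
Proof.
move=> [rX hX] [rY hY]; split; first exact: RAV_bracket.
move=> k f hf; apply: weight_ext (near0R_sym (dvf_bracket rX rY (weight_RA hf))).
have h1 : weight k (dvf X (dvf Y f)) by apply: hX; apply: hY; rewrite -addnA.
have h2 : weight k (dvf Y (dvf X f)) by apply: hY; apply: hX; rewrite -addnA [(d + c)%N]addnC.
by apply: (weight_eq (weightD h1 (weightZ (-1) h2))) => t; rewrite mulN1r.
Qed.

Hypothesis conjAB : forall p, B p = map_mx Num.conj (A p).
Lemma dvf_conj f : RA f -> near0R (fun t => dvf A (fun t => Num.conj (f t)) t = Num.conj (dvf B f t)
   /\ dvf B (fun t => Num.conj (f t)) t = Num.conj (dvf A f t)).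
Proof.
move=> rf; apply: near0R_sub (near0R_fin (fun k => dpart_conj k rf)) => t h; split.
  rewrite /dvf rmorph_sum; apply: eq_bigr => k _; rewrite h rmorphM /= conjAB mxE conjCK.
  by [].
by rewrite /dvf rmorph_sum; apply: eq_bigr => k _; rewrite h rmorphM /= conjAB mxE.
Qed.
Lemma weight_conj k f : weight k f -> weight k (fun t => Num.conj (f t)).
Proof.
elim: k f => [|k IH] f [rf hf]; first by apply: weight0; exact: RA_conj.
case: hf => f0 hA hB; split; first exact: RA_conj.
split; first by rewrite f0 rmorph0.
  by apply: weight_ext (IH _ hB) _; apply: near0R_sub (dvf_conj rf) => t [->].
by apply: weight_ext (IH _ hA) _; apply: near0R_sub (dvf_conj rf) => t [_ ->].
Qed.

End Weights.

(* kept folded: each level of the recursion doubles the number of conditions *)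
Opaque weight.

(** * Independence of the coefficients of order at most 3 *)

Section Independence.
Variables (R : realType) (n : nat).
Local Notation C := (Cplx R).
Local Notation N := (1 + n)%N.
Local Notation E := 'rV[R]_(N + N).
Local Notation ii := ('i : C).

Lemma cpt_delta_l (k : 'I_N) : cpt (delta_mx 0 (lshift N k) : E) = delta_mx 0 k.
Proof.
rewrite cptE; apply/rowP => j; rewrite !mxE eq_lshift eq_rlshift RtoC0 mulr0 addr0 /=.
by case: (j == k); rewrite ?RtoC1 ?RtoC0.
Qed.
Lemma cpt_delta_r (k : 'I_N) : cpt (delta_mx 0 (rshift N k) : E) = ii *: delta_mx 0 k.
Proof.
rewrite cptE; apply/rowP => j; rewrite !mxE eq_rshift eq_lrshift RtoC0 add0r /=.
by case: (j == k); rewrite ?RtoC1 ?RtoC0.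
Qed.
Lemma cpt_coord (t : E) j : cpt t 0 j = RtoC (t 0 (lshift N j)) + ii * RtoC (t 0 (rshift N j)).
Proof. by rewrite cptE !mxE. Qed.
Lemma cptD (s t : E) : cpt (s + t) = cpt s + cpt t.
Proof.
apply/rowP => j; rewrite [RHS]mxE !cpt_coord !(mxE, RtoCD) mulrDr addrACA.
by [].
Qed.
Lemma cptZ (s : R) (t : E) : cpt (s *: t) = RtoC s *: cpt t.
Proof.
apply/rowP => j; rewrite [RHS]mxE !cpt_coord !(mxE, RtoCM) mulrDr mulrCA.
by [].
Qed.

Lemma RAV_cpt : RAV (fun t : E => cpt t).
Proof.
move=> j; have h k : RA (fun t : E => cx t 0 k) by exists (fun h => h 0 k); split; [exact: An_X|exact: near0R_all].
apply: (RA_eq (RAD (h (lshift N j)) (RAZ ii (h (rshift N j))))) => t.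
by rewrite cptE !mxE.
Qed.

Lemma cauchy_riemann (W : 'rV[C]_N -> C) : An W ->
  near0R (fun p : E => forall k, dpart (rshift N k) (fun t => W (cpt t)) p =
     ii * dpart (lshift N k) (fun t => W (cpt t)) p).
Proof.
move=> /An_taylor_at[g [ag [K [r [K0 r0 hr]]]]].
exists (r / 2); split; first by lra.
move=> p pr; have hd v : hasd (fun t => W (cpt t)) p v (\sum_i cpt v 0 i * g i (cpt p)).
  have V0 := vn_ge0 (cpt v); have V1 : 0 < vn (cpt v) + 1 by lra.
  exists (K * vn (cpt v) ^+ 2), (r / (vn (cpt v) + 1)); split; first by rewrite divr_gt0.
  move=> s; rewrite ler_pdivlMr // => sr.
  rewrite cptD cptZ.
  have cpr : vn (cpt p) <= r by apply: le_trans (vn_cpt p) _; rewrite mulrC -ler_pdivlMr.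
  have sv : vn (RtoC s *: cpt v) <= `|s| * vn (cpt v) by apply: le_trans (vnZ _ _) _; rewrite nm_real.
  have svr : vn (RtoC s *: cpt v) <= r.
    by apply: le_trans sv (le_trans _ sr); rewrite ler_wpM2l // lerDl.
  have := hr _ _ cpr svr.
  have -> : \sum_i (RtoC s *: cpt v) 0 i * g i (cpt p) = RtoC s * \sum_i cpt v 0 i * g i (cpt p).
    by rewrite mulr_sumr; apply: eq_bigr => i _; rewrite mxE mulrA.
  move=> /le_trans; apply; rewrite -mulrA ler_wpM2l //.
  rewrite -[s ^+ 2]real_normK ?num_real // mulrC -exprMn.
  by rewrite lerXn2r ?nnegrE ?vn_ge0 // mulr_ge0.
move=> k; rewrite (dpartE (hd _)) (dpartE (hd _)) cpt_delta_l cpt_delta_r mulr_sumr.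
by apply: eq_bigr => i _; rewrite mxE mulrA.
Qed.

Lemma RA_cpt (W : 'rV[C]_N -> C) : An W -> RA (fun t : E => W (cpt t)).
Proof. by move=> aW; apply: (RA_comp aW RAV_cpt); rewrite cpt0. Qed.

(** A field of type (0,1) kills holomorphic functions. *)
Lemma dvf_CR (X : E -> 'rV[C]_(N + N)) (W : 'rV[C]_N -> C) : An W ->
  near0R (fun p => rsubmx (X p) = ii *: lsubmx (X p)) ->
  near0R (fun p => dvf X (fun t => W (cpt t)) p = 0).
Proof.
move=> /cauchy_riemann cr hX; apply: near0R_sub (near0R_and cr hX) => p [h hx].
rewrite /dvf big_split_ord /= -big_split big1 // => k _ /=.
have := congr1 (fun M : 'rV[C]_N => M 0 k) hx; rewrite !mxE => ->.
rewrite h; move: (X p 0 _) (dpart _ _ _) => a b.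
have -> : a * b + ii * a * (ii * b) = a * b * (1 + ii ^+ 2) by ring.
by rewrite sqrCi subrr mulr0.
Qed.

(** The differential of a holomorphic function is complex linear. *)
Lemma CR_Jmx (y : E) (d : 'I_(N + N) -> C) : (forall k, d (rshift N k) = ii * d (lshift N k)) ->
  ii * (\sum_k RtoC (y 0 k) * d k) = \sum_k RtoC (Jmx y 0 k) * d k.
Proof.
move=> cr; rewrite [X in ii * X]big_split_ord [RHS]big_split_ord /= -[RHS]big_split /=.
rewrite -[X in ii * X]big_split mulr_sumr; apply: eq_bigr => k _ /=.
rewrite /Jmx row_mxEl row_mxEr [in RHS]mxE [lsubmx y 0 k]mxE [rsubmx y 0 k]mxE RtoCN cr.
move: (RtoC _) (RtoC _) (d _) => p q e.
have -> : ii * (q * e + p * (ii * e)) = ii * (q * e) + ii ^+ 2 * (p * e) by ring.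
rewrite sqrCi; ring.
Qed.

Lemma linear_quadratic (s S Q : R) : 0 < s -> 0 <= Q -> S <= Q * s -> s * (2 * (Q + 1)) <= S -> False.
Proof. nra. Qed.

Variable rho : E -> 'rV[R]_n.

Lemma cx_cjac p (V : E) : cx V *m (cjac rho p)^T = cx (V *m (jac rho p)^T).
Proof.
apply/rowP => j; rewrite !mxE RtoC_sum; apply: eq_bigr => k _.
by rewrite !mxE RtoCM.
Qed.
Lemma real_tangent p (Z : 'rV[C]_(N + N)) : Z *m (cjac rho p)^T = 0 ->
  exists X Y : E, [/\ X *m (jac rho p)^T = 0, Y *m (jac rho p)^T = 0 & Z = cx X + ii *: cx Y].
Proof.
move=> hZ; exists (map_mx (@ReC R) Z), (map_mx (@ImC R) Z).
have ZE : Z = cx (map_mx (@ReC R) Z) + ii *: cx (map_mx (@ImC R) Z).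
  by apply/rowP => j; rewrite !mxE {1}[Z 0 j]CE.
move: (map_mx (@ReC R) Z) (map_mx (@ImC R) Z) ZE => X Y ZE.
rewrite ZE mulmxDl -scalemxAl !cx_cjac in hZ.
have hj j : (X *m (jac rho p)^T) 0 j = 0 /\ (Y *m (jac rho p)^T) 0 j = 0.
  move: (X *m _) (Y *m _) hZ => P Q /(congr1 (fun M : 'rV[C]_n => M 0 j)); rewrite !mxE.
  move: (P 0 j) (Q 0 j) => a b; rewrite iE => /(congr1 (fun z : C => (ReC z, ImC z))).
  by rewrite /ReC /ImC /RtoC /= => -[]; lra.
by split=> //; apply/rowP => j; rewrite [RHS]mxE; case: (hj j).
Qed.

Variables (F G : 'rV[C]_N -> 'rV[C]_N) (phi : 'rV[C]_(1 + 1 + n) -> 'rV[C]_n).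
Hypotheses (gr : generic_germ rho) (nd : normal_data rho F G phi).

Lemma vanishes_dvf (X : E -> 'rV[C]_(N + N)) g : RA g -> vanishes_on rho g ->
  near0R (fun p => X p *m (cjac rho p)^T = 0) -> vanishes_on rho (dvf X g).
Proof.
move=> rg vg hX; apply: near0R_sub (near0R_and (vanishes_tangent gr nd rg vg) hX) => p [h hx] rp.
have [Y [Z [hY hZ e]]] := real_tangent hx.
have : \sum_k RtoC (Y 0 k) * dpart k g p + ii * \sum_k RtoC (Z 0 k) * dpart k g p = 0.
  by rewrite (h rp Y hY) (h rp Z hZ) mulr0 addr0.
move=> e0; apply: (etrans _ e0); rewrite mulr_sumr -big_split; apply: eq_bigr => k _ /=.
by rewrite e !mxE; ring.
Qed.

(** Tangent fields preserve the functions vanishing on the submanifold, so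
these have all weights. *)
Lemma weight_vanishes (X Y : E -> 'rV[C]_(N + N)) : RAV X -> RAV Y ->
  near0R (fun p => X p *m (cjac rho p)^T = 0) -> near0R (fun p => Y p *m (cjac rho p)^T = 0) ->
  forall k g, RA g -> vanishes_on rho g -> weight X Y k g.
Proof.
move=> rX rY hX hY; elim=> [|k IH] g rg vg; first exact: weight0.
apply/weightS; split; first exact: rg.
- by apply: (near0R_at0 vg); exact: germ0 gr.
- by apply: IH; [exact: RA_dvf|exact: vanishes_dvf].
- by apply: IH; [exact: RA_dvf|exact: vanishes_dvf].
Qed.

Variable L : E -> 'rV[C]_(N + N).
Hypotheses (rL : RAV L)
  (hL : near0R (fun p => L p *m (cjac rho p)^T = 0 /\ rsubmx (L p) = - ii *: lsubmx (L p))).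
Local Notation Lb := (conj_field L).
Local Notation O := (weight L Lb).

Let rLb : RAV Lb.
Proof. by move=> k; apply: (RA_eq (RA_conj (rL k))) => t; rewrite !mxE. Qed.
Let tanL : near0R (fun p => L p *m (cjac rho p)^T = 0).
Proof. by apply: near0R_sub hL => p []. Qed.
Let tanLb : near0R (fun p => Lb p *m (cjac rho p)^T = 0).
Proof.
apply: near0R_sub tanL => p h.
have -> : (cjac rho p)^T = map_mx Num.conj (cjac rho p)^T.
  by apply/matrixP => i j; rewrite !mxE conj_RtoC.
by rewrite /conj_field -map_mxM h map_mx0.
Qed.
Let crLb : near0R (fun p => rsubmx (Lb p) = ii *: lsubmx (Lb p)).
Proof.
apply: near0R_sub hL => p [_ h]; apply/rowP => k.
have := congr1 (fun M : 'rV[C]_N => M 0 k) h; rewrite !mxE => ->.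
by rewrite rmorphM rmorphN /= conjCi opprK.
Qed.

(** The derivative of W along conj L is 0, and along L it is that of
W - conj W, because L kills conj W. *)
Lemma skew_weight k (W : 'rV[C]_N -> C) : An W -> W 0 = 0 ->
  O k.+1 (fun t => W (cpt t) - Num.conj (W (cpt t))) -> O k.+1 (fun t => W (cpt t)).
Proof.
move=> aW W0 /weightS[_ _ hA _]; have rf := RA_cpt aW; have cr := dvf_CR aW crLb.
apply/weightS; split; [exact: rf|by rewrite cpt0| |].
  have cj : forall p, Lb p = map_mx Num.conj (L p) by [].
  apply: weight_ext hA _.
  apply: near0R_sub (near0R_and (dvfD L rf (RAZ (-1) (RA_conj rf)))
    (near0R_and (dvfZ L (-1) (RA_conj rf)) (near0R_and (dvf_conj cj rf) cr))) => p [e1 [e2 [[e3 _] e4]]].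
  rewrite e2 e3 e4 rmorph0 mulr0 addr0 in e1; rewrite -e1.
  by congr (dvf L _ p); apply/funext => t; rewrite mulN1r.
by apply: weight_ext (weight_zero _ _ _) _; apply: near0R_sub cr => p ->.
Qed.

Let h t := hq (F (cpt t)).
Let h0 : h 0 = 0.
Proof.
have /eqP : vn (h 0) <= 0.
  by rewrite (le_trans (vn_hq _)) // cpt0 (nd_F0 nd) vn0.
by rewrite -/(_ <= _) => /eqP/vn_eq0.
Qed.
Let RAh : RAV h.
Proof.
have rq k : RA (fun t => F (cpt t) 0 k) := RA_cpt (nd_F nd k).
move=> i; have [j ->|j ->] := split_ordP i.
  have [k ->|k ->] := split_ordP j.
    by apply: (RA_eq (rq (lshift n k))) => t; rewrite /h /hq /tri !row_mxEl mxE.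
  by apply: (RA_eq (RA_conj (rq (lshift n k)))) => t; rewrite /h /hq /tri row_mxEl row_mxEr !mxE.
apply: (RA_eq (RAZ 2^-1 (RAD (rq (rshift 1 j)) (RA_conj (rq (rshift 1 j)))))) => t.
by rewrite /h /hq /tri row_mxEr !mxE.
Qed.

Variables (H : 'I_n -> 'rV[C]_(1 + 1 + n) -> C) (a b g : 'I_n -> C)
  (A : 'I_n -> 'rV[C]_(1 + 1) -> C) (B : 'I_n -> 'I_n -> 'rV[C]_(1 + 1 + n) -> C).
Hypothesis ex : forall j, expansion (fun x => phi x 0 j) (H j) (a j) (b j) (g j) (A j) (B j).

Local Notation w j := (fun t => F (cpt t) 0 (rshift 1 j)).
Local Notation r j := (fun t => vpart (F (cpt t)) 0 j - phi (h t) 0 j).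

Let RAphi j : RA (fun t => phi (h t) 0 j).
Proof. by apply: (RA_comp (nd_phi nd j) RAh h0). Qed.
Let RAw j : RA (w j). Proof. exact: RA_cpt (nd_F nd _). Qed.

Lemma imag_part j t : F (cpt t) 0 (rshift 1 j) - Num.conj (F (cpt t) 0 (rshift 1 j)) =
  2 * ii * vpart (F (cpt t)) 0 j.
Proof. by rewrite /vpart !mxE mulrA mulfV ?i2_neq0 // mul1r. Qed.

Lemma weight_residual k j : O k (r j).
Proof.
apply: (weight_vanishes rL rLb tanL tanLb).
  apply: RAB => //.
  apply: (RA_eq (RAZ (2 * ii)^-1 (RAB (RAw j) (RA_conj (RAw j))))) => t.
  by rewrite imag_part mulrA mulVf ?i2_neq0 // mul1r.
apply: near0R_sub (nd_eq nd) => t [e _] /e.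
by move=> /(congr1 (fun M : 'rV[C]_n => M 0 j)) ->; rewrite subrr.
Qed.

Let o1 i : O 1 (fun t => h t 0 i).
Proof. by apply: weight1 => //; rewrite h0 mxE. Qed.
Let ozz : O 2 (fun t => tz (h t) 0 0 * tc (h t) 0 0).
Proof.
apply: (weight_eq (weightM rL rLb (o1 (lshift n (lshift 1 0))) (o1 (lshift n (rshift 1 0))))) => t.
by rewrite !mxE.
Qed.

(** By the equation of the graph, w - conj w is 2 i z conj z H plus a function
vanishing on the submanifold. *)
Lemma weight2_w j : O 2 (w j).
Proof.
apply: (skew_weight (W := fun x => F x 0 (rshift 1 j))); first exact: nd_F nd _.
  by rewrite (nd_F0 nd) mxE.
have [aH _ _ _ e] := ex j.
have e' : near0R (fun t => phi (h t) 0 j = tz (h t) 0 0 * tc (h t) 0 0 * H j (h t)).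
  have := near0_cpt (near0_comp (near0_hq e) (AnV_Lip (nd_F nd)) (nd_F0 nd)).
  by apply: near0R_sub => t [].
have oP : O 2 (fun t => phi (h t) 0 j).
  apply: weight_ext (near0R_sym e'); rewrite -[2%N]addn0; apply: (weightM rL rLb ozz).
  by apply: weight0; apply: (RA_comp aH RAh h0).
apply: (weight_eq (weightZ rL rLb (2 * ii) (weightD oP (weight_residual 2 j)))) => t.
by rewrite imag_part addrC subrK.
Qed.

(** The u_k have weight 2 because the w_k do. *)
Lemma weight2_remainder j : O 2 (fun t => A j (lsubmx (h t)) + \sum_k tu (h t) 0 k * B j k (h t)).
Proof.
have [aH aA [K hK] aB _] := ex j; apply: weightD.
  have rA : RA (fun t => A j (lsubmx (h t))).
    apply: (RA_comp aA); last by rewrite h0 linear0.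
    by move=> i; apply: (RA_eq (RAh (lshift n i))) => t; rewrite [RHS]mxE.
  have [K' [q [K'0 q0 hq']]] := LipV_unif (AnV_Lip (nd_F nd)).
  have bF : near0R (fun t => vn (h t) <= 2 * K' * vn (cx t)).
    exists (q / 2); split; first by lra.
    move=> t tq; have c := vn_cpt t.
    have cq : vn (cpt t) <= q by lra.
    have := hq' (cpt t) 0 cq; rewrite vn0 (nd_F0 nd) !subr0 => /(_ (ltW q0)) e1.
    apply: le_trans (vn_hq _) (le_trans e1 _).
    by rewrite [2 * _]mulrC -mulrA ler_wpM2l // ltW.
  apply: (@weight2_quadratic _ _ _ _ rL rLb _ (`|K| * (2 * K') ^+ 2) rA).
  have hK' : near0 (fun x : 'rV[C]_(1 + 1 + n) => nm (A j (lsubmx x)) <= K * vn (lsubmx x) ^+ 2).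
    have [s [s0 hs]] := hK; exists s; split=> // x xs.
    by apply: hs; exact: le_trans (vn_lsub _) xs.
  have := near0_cpt (near0_comp (near0_hq hK') (AnV_Lip (nd_F nd)) (nd_F0 nd)).
  move=> bA; apply: near0R_sub (near0R_and bA bF) => t [e1 e2].
  rewrite (le_trans e1) // (le_trans (ler_wpM2r _ (ler_norm K))) ?exprn_ge0 ?vn_ge0 //.
  rewrite -mulrA ler_wpM2l // -exprMn lerXn2r ?nnegrE ?vn_ge0 //.
    by rewrite mulr_ge0 ?vn_ge0 // mulr_ge0 // ltW.
  exact: le_trans (vn_lsub _) e2.
apply: weight_sum => k; rewrite -[2%N]addn0; apply: (weightM rL rLb); last first.
  by apply: weight0; apply: (RA_comp (aB k) RAh h0).
have cj : forall p, Lb p = map_mx Num.conj (L p) by [].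
have ow := weight2_w k.
apply: (weight_eq (weightZ rL rLb 2^-1 (weightD ow (weight_conj cj ow)))) => t.
by rewrite /h /hq tuE !mxE.
Qed.

Lemma lie_bracketE (X Y : E -> 'rV[C]_(N + N)) : lie_bracket X Y = bracket X Y.
Proof.
apply/funext => p; apply/rowP => j; rewrite !mxE /dvf -sumrB.
by apply: eq_bigr.
Qed.

(** Each of the five fields lowers weights by at most 3. *)
Lemma fields_annihilate f (Z : 'rV[C]_(N + N)) : O 4 f -> (Z <= class_III1_fields L 0)%MS ->
  \sum_k Z 0 k * dpart k f 0 = 0.
Proof.
move=> of4 /submxP[D ->].
have low c X : (c <= 3)%N -> lowers L Lb c X -> \sum_k X 0 0 k * dpart k f 0 = 0.
  move=> c3 [rX hX]; have hf : O (1 + c) f by apply: weight_le of4.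
  exact: weight_at0 (hX 1%N f hf).
have lA : lowers L Lb 1 L by exact: lowers_A.
have lB : lowers L Lb 1 Lb by exact: lowers_B.
have lT := lowers_bracket rL rLb lA lB.
have row (i : 'I_5) : \sum_k class_III1_fields L 0 i k * dpart k f 0 = 0.
  transitivity (\sum_k ([:: L 0; Lb 0; lie_bracket L Lb 0; lie_bracket L (lie_bracket L Lb) 0;
      lie_bracket Lb (lie_bracket L Lb) 0]`_i : 'rV[C]_(N + N)) 0 k * dpart k f 0).
    by apply: eq_bigr => k _; rewrite mxE.
  rewrite !lie_bracketE; case: i => -[|[|[|[|[|i]]]]] //= _.
  - exact: low lA.
  - exact: low lB.
  - exact: low lT.
  - by apply: low (lowers_bracket rL rLb lA lT).
  - by apply: low (lowers_bracket rL rLb lB lT).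
transitivity (\sum_i D 0 i * \sum_k class_III1_fields L 0 i k * dpart k f 0).
  under [RHS]eq_bigr do rewrite mulr_sumr.
  rewrite exchange_big; apply: eq_bigr => k _ /=.
  by rewrite [X in X * _]mxE mulr_suml; apply: eq_bigr => i _; rewrite mulrA.
by apply: big1 => i _; rewrite row mulr0.
Qed.

Variable lam : 'I_n -> R.
Hypotheses (la : \sum_j RtoC (lam j) * a j = 0) (lb : \sum_j RtoC (lam j) * b j = 0)
  (lg : \sum_j RtoC (lam j) * g j = 0).
Let W (x : 'rV[C]_N) : C := \sum_j RtoC (lam j) * F x 0 (rshift 1 j).
Let aW : An W.
Proof. by apply: An_sum => j _; apply: AnZ; exact: nd_F nd _. Qed.

(** The relations on lam leave z conj z times a combination of the
remainders, of weight 2 + 2. *)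
Lemma weight4_combination : O 4 (fun t => W (cpt t)).
Proof.
apply: (skew_weight (W := W)); first exact: aW.
  by apply: big1 => j _; rewrite (nd_F0 nd) mxE mulr0.
have oS := weight_sum (index_enum 'I_n) (fun j => weightZ rL rLb (RtoC (lam j)) (weight2_remainder j)).
have oR := weight_sum (index_enum 'I_n) (fun j => weightZ rL rLb (RtoC (lam j)) (weight_residual 4 j)).
apply: weight_ext (weightZ rL rLb (2 * ii) (weightD (weightM rL rLb ozz oS) oR)) _.
have e j : near0R (fun t => phi (h t) 0 j = tz (h t) 0 0 * tc (h t) 0 0 * (a j + b j * tz (h t) 0 0
    + g j * tc (h t) 0 0 + (A j (lsubmx (h t)) + \sum_k tu (h t) 0 k * B j k (h t)))).
  have [_ _ _ _ e] := ex j.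
  have := near0_cpt (near0_comp (near0_hq e) (AnV_Lip (nd_F nd)) (nd_F0 nd)).
  by apply: near0R_sub => t [-> ->]; rewrite -addrA.
apply: near0R_sub (near0R_fin e) => t {}e.
transitivity (2 * ii * \sum_j RtoC (lam j) * vpart (F (cpt t)) 0 j); last first.
  rewrite /W rmorph_sum -sumrB mulr_sumr; apply: eq_bigr => j _.
  by rewrite rmorphM /= conj_RtoC -mulrBr imag_part mulrCA.
congr (_ * _).
transitivity (\sum_j RtoC (lam j) * phi (h t) 0 j + \sum_j RtoC (lam j) * r j t); last first.
  by rewrite -big_split; apply: eq_bigr => j _ /=; rewrite -mulrDr addrC subrK.
congr (_ + _).
under [RHS]eq_bigr do rewrite e.
move: (tz (h t) 0 0) (tc (h t) 0 0) => z c.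
pose rem j := A j (lsubmx (h t)) + \sum_k tu (h t) 0 k * B j k (h t).
(* the first three sums vanish by la, lb and lg *)
transitivity (z * c * (\sum_j RtoC (lam j) * a j + (\sum_j RtoC (lam j) * b j) * z
   + (\sum_j RtoC (lam j) * g j) * c + \sum_j RtoC (lam j) * rem j)).
  by rewrite la lb lg !mul0r !add0r.
rewrite !mulr_suml -!big_split mulr_sumr; apply: eq_bigr => j _ /=.
rewrite -/(rem j); move: (rem j) => x; ring.
Qed.

Hypothesis hspan : forall Z : 'rV[C]_(N + N), Z *m (cjac rho 0)^T = 0 -> (Z <= class_III1_fields L 0)%MS.

(** f = sum lam_j w_j has weight 4, so its differential at 0 kills the
fields and hence the tangent space, and then all of C^N because f is
holomorphic. Thus f is quadratically small, whereas it is s sum lam_j^2 at the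
point (0, s lam) of the new coordinates. *)
Theorem coefficients_independent j : lam j = 0.
Proof.
pose f (t : E) := W (cpt t).
have rf : RA f by exact: RA_cpt.
have fT (Z : 'rV[C]_(N + N)) : Z *m (cjac rho 0)^T = 0 -> \sum_k Z 0 k * dpart k f 0 = 0.
  by move=> /hspan; apply: fields_annihilate; exact: weight4_combination.
have tanR (v : E) : v *m (jac rho 0)^T = 0 -> \sum_k RtoC (v 0 k) * dpart k f 0 = 0.
  move=> hv; have : cx v *m (cjac rho 0)^T = 0.
    by rewrite cx_cjac hv cx0.
  by move=> /fT e; apply: (etrans _ e); apply: eq_bigr => k _; rewrite mxE.
have cr := near0R_at0 (cauchy_riemann aW).
have all0 (v : E) : \sum_k RtoC (v 0 k) * dpart k f 0 = 0.
  have [x [y [hx hy ->]]] := germ_gen gr v.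
  transitivity (\sum_k RtoC (x 0 k) * dpart k f 0 + ii * \sum_k RtoC (y 0 k) * dpart k f 0).
    rewrite (CR_Jmx y cr).
    by rewrite -big_split; apply: eq_bigr => k _; rewrite mxE RtoCD mulrDl.
  by rewrite (tanR x hx) (tanR y hy) mulr0 addr0.
have [dp [_ [K [q [K0 q0 hq']]]]] := RA_taylor rf.
have dE k : dp k 0 = 0.
  have hd : hasd f 0 (delta_mx 0 k) (dp k 0).
    rewrite -(sum_delta k (fun k => dp k 0)); apply: (taylor_hasd K0 q0) => d dq.
    by apply: hq' => //; rewrite cx0 vn0 ltW.
  by rewrite -(dpartE hd) -(sum_delta k (fun k => dpart k f 0)) all0.
have bf (d : E) : vn (cx d) <= q -> nm (f d) <= K * vn (cx d) ^+ 2.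
  move=> dq; have := hq' 0 d; rewrite cx0 vn0 => /(_ (ltW q0) dq).
  have f0 : f 0 = 0 by apply: big1 => i _; rewrite cpt0 (nd_F0 nd) mxE mulr0.
  by rewrite f0 add0r subr0 big1 ?subr0 // => i _; rewrite dE mulr0.
(* the direction (0, lam), along which f is linear *)
pose la2 : 'rV[C]_N := row_mx 0 (\row_j RtoC (lam j)).
pose S := \sum_j lam j ^+ 2.
have [KG [g0 [KG0 g00 hG]]] := LipV_unif (AnV_Lip (nd_G nd)).
have [s0 [s00 hFG]] := nd_FG nd.
have V0 := vn_ge0 la2.
pose T := KG * vn la2.
have T0 : 0 <= T by rewrite mulr_ge0 // ltW.
pose V1 := vn la2 + 1; pose T1 := T + 1.
have V10 : 0 < V1 by rewrite /V1; lra.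
have T10 : 0 < T1 by rewrite /T1; lra.
have main s : 0 < s -> s <= Num.min (Num.min (g0 / V1) (s0 / V1)) (q / T1) ->
    s * S <= K * T ^+ 2 * s ^+ 2.
  move=> sp; rewrite !le_min => /andP[/andP[s1 s2] s3].
  have vs : vn (RtoC s *: la2) <= s * vn la2.
    by apply: le_trans (vnZ _ _) _; rewrite nm_real gtr0_norm.
  have vb x : s <= x / V1 -> vn (RtoC s *: la2) <= x.
    rewrite ler_pdivlMr // => sx; apply: le_trans vs (le_trans _ sx).
    by rewrite ler_wpM2l ?ltW // /V1; lra.
  pose d := rpt (G (RtoC s *: la2)).
  have dT : vn (cx d) <= T * s.
    apply: le_trans (vn_rpt _) _.
    have := hG (RtoC s *: la2) 0 (vb _ s1); rewrite vn0 (nd_G0 nd) !subr0 => /(_ (ltW g00)) e.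
    by apply: le_trans e _; rewrite /T -mulrA ler_wpM2l ?(ltW KG0) // mulrC.
  have dq : vn (cx d) <= q.
    apply: le_trans dT _; move: s3; rewrite ler_pdivlMr // => s3; apply: le_trans _ s3.
    by rewrite mulrC ler_wpM2l ?ltW // /T1; lra.
  have fd : f d = RtoC (s * S).
    rewrite /f /d rptK /W hFG; last exact: vb.
    rewrite /S mulr_sumr RtoC_sum; apply: eq_bigr => i _.
    by rewrite mxE /la2 row_mxEr mxE -!RtoCM; congr RtoC; rewrite mulrCA expr2.
  have := bf d dq; rewrite fd nm_real => e.
  apply: le_trans (ler_norm _) (le_trans e _); rewrite -mulrA -exprMn ler_wpM2l //.
  by rewrite lerXn2r ?nnegrE ?vn_ge0 // mulr_ge0 // ltW.
have S0 : S = 0.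
  have Sn : 0 <= S by apply: sumr_ge0 => i _; exact: sqr_ge0.
  apply/eqP; rewrite eq_le Sn andbT leNgt; apply/negP => Sp.
  pose Q := K * T ^+ 2.
  have Q0 : 0 <= Q by rewrite mulr_ge0 // sqr_ge0.
  pose s := Num.min (Num.min (Num.min (g0 / V1) (s0 / V1)) (q / T1)) (S / (2 * (Q + 1))).
  have sp : 0 < s by rewrite !lt_min !divr_gt0 // mulr_gt0 //; lra.
  have := main s sp; rewrite {1}/s ge_min lexx => /(_ isT).
  rewrite -/Q expr2 mulrCA ler_pM2l // => e.
  have : s <= S / (2 * (Q + 1)) by rewrite /s ge_min lexx orbT.
  rewrite ler_pdivlMr; last by rewrite mulr_gt0 //; lra.
  exact: linear_quadratic sp Q0 e.
have : lam j ^+ 2 <= 0.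
  by rewrite -S0 /S (bigD1 j) //= lerDl sumr_ge0 // => i _; exact: sqr_ge0.
by rewrite le_eqVlt ltNge sqr_ge0 orbF sqrf_eq0 => /eqP.
Qed.

End Independence.

(** * Real linear changes of w *)

Section LinearChange.
Variables (R : realType) (n : nat).
Local Notation C := (Cplx R).
Local Notation N := (1 + n)%N.
Local Notation toC := (map_mx (@RtoC R)).

(** The linear change of w by a real matrix; it acts on rows, hence by
multiplication on the right. *)
Definition chg (P : 'M[R]_n) (q : 'rV[C]_N) : 'rV[C]_N :=
  row_mx (lsubmx q) (rsubmx q *m toC P).

Lemma toC_mul k (P Q : 'M[R]_k) : toC P *m toC Q = toC (P *m Q).
Proof.
apply/matrixP => i j; rewrite !mxE RtoC_sum; apply: eq_bigr => l _.
by rewrite !mxE RtoCM.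
Qed.
Lemma toC1 k : toC (1%:M : 'M[R]_k) = 1%:M.
Proof. by apply/matrixP => i j; rewrite !mxE; case: (i == j). Qed.
Lemma toCK (P Q : 'M[R]_n) (u : 'rV[C]_n) : P *m Q = 1%:M -> u *m toC P *m toC Q = u.
Proof. by move=> PQ; rewrite -mulmxA toC_mul PQ toC1 mulmx1. Qed.
Lemma chgK P Q q : P *m Q = 1%:M -> chg Q (chg P q) = q.
Proof. by move=> PQ; rewrite /chg row_mxKl row_mxKr toCK // hsubmxK. Qed.
Lemma chg0 P : chg P 0 = 0.
Proof. by rewrite /chg !linear0 mul0mx row_mx0. Qed.
Lemma conj_toC (P : 'M[R]_n) (u : 'rV[C]_n) :
  map_mx Num.conj (u *m toC P) = map_mx Num.conj u *m toC P.
Proof.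
rewrite map_mxM; congr (_ *m _); apply/matrixP => i j.
by rewrite !mxE /= conj_RtoC.
Qed.
Lemma upart_chg P q : upart (chg P q) = upart q *m toC P.
Proof. by rewrite /upart /chg row_mxKr conj_toC -mulmxDl -scalemxAl. Qed.
Lemma vpart_chg P q : vpart (chg P q) = vpart q *m toC P.
Proof. by rewrite /vpart /chg row_mxKr conj_toC -mulmxBl -scalemxAl. Qed.
Lemma hq_chg P q : hq (chg P q) = tri (lsubmx q) (map_mx Num.conj (lsubmx q)) (upart q *m toC P).
Proof. by rewrite /hq upart_chg /chg row_mxKl. Qed.
Lemma AnV_chg m P (F : 'rV[C]_m -> 'rV[C]_N) : AnV F -> AnV (fun x => chg P (F x)).
Proof.
by move=> aF; apply: AnV_row; [exact: AnV_lsub|apply: AnV_mul; exact: AnV_rsub].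
Qed.

Definition chg_tri (Q : 'M[R]_n) (x : 'rV[C]_(1 + 1 + n)) := tri (tz x) (tc x) (tu x *m toC Q).
Lemma AnV_chg_tri Q : AnV (chg_tri Q).
Proof.
apply: AnV_tri; [apply: AnV_tz|apply: AnV_tc|apply: AnV_mul; apply: AnV_tu]; exact: AnV_id.
Qed.
Lemma chg_tri0 Q : chg_tri Q 0 = 0.
Proof. by rewrite /chg_tri /tz /tc /tu !linear0 mul0mx tri0. Qed.

(** Combining the components of phi with coefficients P combines their
expansions; in the arguments u is replaced by u Q, which mixes the quotients by
the u_k. *)
Lemma expansion_change (phi : 'rV[C]_(1 + 1 + n) -> 'rV[C]_n) (H : 'I_n -> 'rV[C]_(1 + 1 + n) -> C)
    (a b g : 'I_n -> C) (A : 'I_n -> 'rV[C]_(1 + 1) -> C)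
    (B : 'I_n -> 'I_n -> 'rV[C]_(1 + 1 + n) -> C) (P Q : 'M[R]_n) :
  (forall j, expansion (fun x => phi x 0 j) (H j) (a j) (b j) (g j) (A j) (B j)) ->
  exists (A' : 'I_n -> 'rV[C]_(1 + 1) -> C) (B' : 'I_n -> 'I_n -> 'rV[C]_(1 + 1 + n) -> C),
  [/\ forall j, An (A' j), forall j, exists K : R, near0 (fun y => nm (A' j y) <= K * vn y ^+ 2),
      forall j k, An (B' j k) &
      near0 (fun x => forall j, (phi (chg_tri Q x) *m toC P) 0 j =
        tz x 0 0 * tc x 0 0 * (\sum_k RtoC (P k j) * a k + (\sum_k RtoC (P k j) * b k) * tz x 0 0
          + (\sum_k RtoC (P k j) * g k) * tc x 0 0 + A' j (lsubmx x)
          + \sum_k tu x 0 k * B' j k x))].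
Proof.
move=> ex.
exists (fun j y => \sum_k RtoC (P k j) * A k y).
exists (fun j m x => \sum_k \sum_l RtoC (P k j) * RtoC (Q m l) * B k l (chg_tri Q x)).
split.
- by move=> j; apply: An_sum => k _; apply: AnZ; have [] := ex k.
- move=> j; have /choice[K hK] k : exists K : R, near0 (fun y => nm (A k y) <= K * vn y ^+ 2).
    by have [] := ex k.
  have [r [r0 hr]] : exists r, 0 < r /\ forall k y, vn y <= r -> nm (A k y) <= K k * vn y ^+ 2.
    by apply: common_radius => // k r r' rr h y yr; apply: h; exact: le_trans rr.
  exists (\sum_k `|P k j| * K k), r; split=> // y yr.
  rewrite (le_trans (nm_sum _ _ _)) // mulr_suml; apply: ler_sum => k _.
  by rewrite nmM nm_real -mulrA ler_wpM2l // hr.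
- move=> j m; apply: An_sum => k _; apply: An_sum => l _; apply: AnZ.
  have [_ _ _ aB _] := ex k.
  by apply: An_comp (aB l) (AnV_chg_tri Q) (chg_tri0 Q).
have [r [r0 hr]] : exists r, 0 < r /\ forall k x, vn x <= r -> phi x 0 k = tz x 0 0 * tc x 0 0 *
    (a k + b k * tz x 0 0 + g k * tc x 0 0 + A k (lsubmx x) + \sum_l tu x 0 l * B k l x).
  apply: common_radius => [k r r' rr h x xr|k]; first by apply: h; exact: le_trans rr.
  by have [_ _ _ _ [r [r0 h]]] := ex k; exists r; split=> // x /h[-> ->].
have e : near0 (fun x => forall k, phi (chg_tri Q x) 0 k = tz x 0 0 * tc x 0 0 *
    (a k + b k * tz x 0 0 + g k * tc x 0 0 + A k (lsubmx x)
      + \sum_l (tu x *m toC Q) 0 l * B k l (chg_tri Q x))).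
  have := near0_comp (ex_intro _ r (conj r0 (fun x xr k => hr k x xr))) (AnV_Lip (AnV_chg_tri Q)) (chg_tri0 Q).
  apply: near0_sub => x h k; rewrite h /chg_tri tzE tcE tuE.
  by congr (_ * (_ + A k _ + _)); rewrite /tri row_mxKl /tz /tc hsubmxK.
apply: near0_sub e => x e j; rewrite mxE.
have S k : \sum_l (tu x *m toC Q) 0 l * B k l (chg_tri Q x) =
    \sum_m tu x 0 m * \sum_l RtoC (Q m l) * B k l (chg_tri Q x).
  under eq_bigr do rewrite mxE mulr_suml.
  rewrite exchange_big; apply: eq_bigr => m _; rewrite mulr_sumr; apply: eq_bigr => l _.
  by rewrite [toC Q m l]mxE mulrA.
under eq_bigr do rewrite e S [toC P _ _]mxE.
have S2 : \sum_k tu x 0 k * (\sum_k0 \sum_l RtoC (P k0 j) * RtoC (Q k l) * B k0 l (chg_tri Q x)) =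
   \sum_k RtoC (P k j) * \sum_m tu x 0 m * \sum_l RtoC (Q m l) * B k l (chg_tri Q x).
  under eq_bigr do rewrite mulr_sumr.
  rewrite exchange_big; apply: eq_bigr => k _; rewrite mulr_sumr; apply: eq_bigr => m _.
  rewrite mulrCA; congr (_ * _); rewrite mulr_sumr; apply: eq_bigr => l _.
  by rewrite mulrA.
rewrite S2 !mulr_suml -!big_split mulr_sumr; apply: eq_bigr => k _ /=.
move: (\sum_m _) (A k _) (tz x 0 0) (tc x 0 0) (RtoC _) => s y z c p.
by ring.
Qed.

End LinearChange.

(** * Normalized graphing functions *)

Section NormalizedGraph.
Variable R : realType.
Local Notation C := (Cplx R).
Local Notation N := (1 + 3)%N.
Local Notation E := 'rV[R]_(N + N).
Local Notation ii := ('i : C).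
Local Notation toC := (map_mx (@RtoC R)).

Lemma leading_partE (j : 'I_3) (z : C) : leading_part j z = z * z^* *
  (RtoC ((1%:M : 'M[R]_3) j 0) + (RtoC ((1%:M : 'M[R]_3) j 1) + ii * RtoC ((1%:M : 'M[R]_3) j 2)) * z
   + (RtoC ((1%:M : 'M[R]_3) j 1) - ii * RtoC ((1%:M : 'M[R]_3) j 2)) * z^*).
Proof.
rewrite !mxE /leading_part; case: j => -[|[|[|j]]] //= _; rewrite !(RtoC0, RtoC1).
all: move: (z^*) => c; ring.
Qed.

(** [graph_rhs] in terms of [hq] and [upart]. *)
Definition graph_value (j : 'I_3) (A : 'rV[C]_(1 + 1) -> C) (B : 'I_3 -> 'rV[C]_(1 + 1 + 3) -> C)
    (q : 'rV[C]_N) : C :=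
  let z := lsubmx q 0 0 in
  leading_part j z + z * z^* * A (lsubmx (hq q))
  + \sum_(k < 3) z * z^* * (upart q 0 k * B k (hq q)).

Variables (rho : E -> 'rV[R]_3) (L : E -> 'rV[C]_(N + N)).
Hypotheses (gr : generic_germ rho) (rL : RAV L)
  (hL : near0R (fun p => L p *m (cjac rho p)^T = 0 /\ rsubmx (L p) = - ii *: lsubmx (L p)))
  (hspan : forall Z : 'rV[C]_(N + N), Z *m (cjac rho 0)^T = 0 -> (Z <= class_III1_fields L 0)%MS).

(** The matrix with rows (a_j, Re b_j, Im b_j) is invertible by
[coefficients_independent], and its inverse, acting on w, turns these rows into
the standard basis. *)
Theorem normalized_graph : exists (F : 'rV[C]_N -> 'rV[C]_N) (A : 'I_3 -> 'rV[C]_(1 + 1) -> C)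
    (B : 'I_3 -> 'I_3 -> 'rV[C]_(1 + 1 + 3) -> C),
  [/\ local_holomorphic_coordinates F,
      forall j, An (A j) /\ exists K : R, near0 (fun y => nm (A j y) <= K * vn y ^+ 2),
      forall j k, An (B j k),
      near0 (fun q => forall j, Num.conj (graph_value j (A j) (B j) q) = graph_value j (A j) (B j) q) &
      near0R (fun p => rho p = 0 <->
        forall j, vpart (F (cpt p)) 0 j = graph_value j (A j) (B j) (F (cpt p)))].
Proof.
have [F [G [phi nd]]] := normal_form gr.
have /choice[H /choice[a /choice[b /choice[g /choice[A0 /choice[B0 ex]]]]]] j :
    exists H a b g A B, expansion (fun x => phi x 0 j) H a b g A B.
  apply: quotient_expansion; first exact: nd_phi nd j.
    by apply: near0_sub (nd_z0 nd) => x ->; rewrite mxE.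
  by apply: near0_sub (nd_chi0 nd) => x ->; rewrite mxE.
have re j : ImC (a j) = 0 /\ g j = Num.conj (b j).
  apply: expansion_real (ex j).
  by apply: near0_sub (nd_sym nd) => x ->; rewrite mxE.
pose M : 'M[R]_3 := \matrix_(j, l) [:: ReC (a j); ReC (b j); ImC (b j)]`_l.
have fM : row_free M.
  rewrite -kermx_eq0; apply/rowV0P => lam /sub_kermxP h.
  have col (l : 'I_3) : \sum_j lam 0 j * [:: ReC (a j); ReC (b j); ImC (b j)]`_l = 0.
    have := congr1 (fun v : 'rV[R]_3 => v 0 l) h; rewrite !mxE => e; apply: (etrans _ e).
    by apply: eq_bigr => j _; rewrite mxE.
  have sC (f : 'I_3 -> R) : \sum_j RtoC (lam 0 j) * RtoC (f j) = RtoC (\sum_j lam 0 j * f j).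
    by rewrite RtoC_sum; apply: eq_bigr => j _; rewrite RtoCM.
  have e0 := col 0; have e1 := col 1; have e2 := col 2; rewrite /= in e0 e1 e2.
  have s0 : \sum_j RtoC (lam 0 j) * a j = 0.
    transitivity (\sum_j RtoC (lam 0 j) * RtoC (ReC (a j))); last by rewrite sC e0 RtoC0.
    by apply: eq_bigr => j _; rewrite {1}[a j]CE (re j).1 RtoC0 mulr0 addr0.
  have s1 : \sum_j RtoC (lam 0 j) * b j = 0.
    transitivity (\sum_j RtoC (lam 0 j) * RtoC (ReC (b j))
        + ii * \sum_j RtoC (lam 0 j) * RtoC (ImC (b j))); last first.
      by rewrite !sC e1 e2 RtoC0 mulr0 addr0.
    rewrite mulr_sumr -big_split; apply: eq_bigr => j _ /=.
    by rewrite {1}[b j]CE mulrDr mulrCA.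
  have s2 : \sum_j RtoC (lam 0 j) * g j = 0.
    transitivity (Num.conj (\sum_j RtoC (lam 0 j) * b j)); last by rewrite s1 rmorph0.
    by rewrite rmorph_sum; apply: eq_bigr => j _; rewrite rmorphM /= conj_RtoC (re j).2.
  by apply/rowP => j; rewrite (coefficients_independent gr nd rL hL ex s0 s1 s2 hspan j) mxE.
have uM : M \in unitmx by rewrite -row_free_unit.
pose P := (invmx M)^T; pose Q := M^T.
have PQ : P *m Q = 1%:M by rewrite /P /Q -trmx_mul mulmxV // trmx1.
have QP : Q *m P = 1%:M by rewrite /P /Q -trmx_mul mulVmx // trmx1.
have [A [B [aA bA aB e]]] := expansion_change P Q ex.
have inv j l : \sum_k RtoC (P k j) * RtoC (M k l) = RtoC ((1%:M : 'M[R]_3) j l).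
  rewrite -(mulVmx uM) mxE RtoC_sum; apply: eq_bigr => k _.
  by rewrite RtoCM mxE.
have cA j : \sum_k RtoC (P k j) * a k = RtoC ((1%:M : 'M[R]_3) j 0).
  rewrite -inv; apply: eq_bigr => k _; congr (_ * _).
  by rewrite [M k 0]mxE /= {1}[a k]CE (re k).1 RtoC0 mulr0 addr0.
have cB j : \sum_k RtoC (P k j) * b k =
    RtoC ((1%:M : 'M[R]_3) j 1) + ii * RtoC ((1%:M : 'M[R]_3) j 2).
  rewrite -!inv mulr_sumr -big_split; apply: eq_bigr => k _ /=.
  by rewrite [M k 1]mxE [M k 2]mxE /= {1}[b k]CE mulrDr mulrCA.
have cG j : \sum_k RtoC (P k j) * g k =
    RtoC ((1%:M : 'M[R]_3) j 1) - ii * RtoC ((1%:M : 'M[R]_3) j 2).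
  transitivity (Num.conj (\sum_k RtoC (P k j) * b k)).
    by rewrite rmorph_sum; apply: eq_bigr => k _; rewrite rmorphM /= conj_RtoC (re k).2.
  by rewrite cB rmorphD rmorphM /= !conj_RtoC conjCi mulNr.
pose F' x := chg P (F x); pose G' q := G (chg Q q).
have aC (S : 'M[R]_3) : AnV (chg S) by apply: AnV_chg; exact: AnV_id.
have rhsE : near0 (fun q => forall j, graph_value j (A j) (B j) q = (phi (hq (chg Q q)) *m toC P) 0 j).
  apply: near0_sub (near0_hq e) => q h j.
  have z1 : tz (hq q) = lsubmx q by rewrite /hq tzE.
  have z2 : tc (hq q) 0 0 = Num.conj (lsubmx q 0 0) by rewrite /hq tcE [LHS]mxE.
  have z3 : tu (hq q) = upart q by rewrite /hq tuE.
  have -> : hq (chg Q q) = chg_tri Q (hq q) by rewrite hq_chg /chg_tri z1 z3 /hq tcE.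
  rewrite h z1 z2 z3 cA cB cG /graph_value leading_partE -mulr_sumr -!mulrDr.
  by [].
exists F', A, B; split=> //.
- apply: (local_coords (G := G')).
  + by apply: AnV_chg; exact: nd_F nd.
  + exact: (AnV_comp (nd_G nd) (aC Q) (chg0 Q)).
  + by rewrite /F' (nd_F0 nd) chg0.
  + by rewrite /G' chg0 (nd_G0 nd).
  + by apply: near0_sub (nd_GF nd) => p h; rewrite /G' /F' chgK.
  + have := near0_comp (nd_FG nd) (AnV_Lip (aC Q)) (chg0 Q).
    by apply: near0_sub => q h; rewrite /G' /F' h chgK.
- have := near0_comp (near0_hq (nd_sym nd)) (AnV_Lip (aC Q)) (chg0 Q).
  move=> sy; apply: near0_sub (near0_and rhsE sy) => q [r s] j; rewrite r.
  rewrite mirror_hq in s; have := congr1 (fun v => (v *m toC P) 0 j) s => /= {}s.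
  by rewrite [RHS]s -conj_toC [RHS]mxE.
have F'0 : F' 0 = 0 by rewrite /F' (nd_F0 nd) chg0.
have rF := near0_cpt (near0_comp rhsE (AnV_Lip (AnV_chg P (nd_F nd))) F'0).
apply: near0R_sub (near0R_and (nd_eq nd) rF) => p [[ep _] r].
rewrite ep; rewrite -/(F' _) in r.
have r' j : graph_value j (A j) (B j) (F' (cpt p)) = (phi (hq (F (cpt p))) *m toC P) 0 j.
  by rewrite r /F' chgK.
split=> [v j|v]; first by rewrite r' /F' vpart_chg v.
rewrite -(toCK (vpart _) PQ) -(toCK (phi _) PQ); congr (_ *m _).
by apply/rowP => j; rewrite -vpart_chg -/(F' _) v r'.
Qed.

End NormalizedGraph.

(** * The germ of a submanifold of the given class *)

Section Submanifold.
Variables (R : realType) (M : local_submanifold R 4 5).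
Local Notation C := (Cplx R).
Local Notation N := (1 + 3)%N.
Local Notation E := 'rV[R]_(N + N).
Local Notation CE := 'rV[C]_(N + N).
Local Notation ii := ('i : C).

Definition rhoM (t : E) : 'rV[R]_3 := \row_(j < 3) def_fun M j t.
Lemma rhoME (j : 'I_3) : (fun t => rhoM t 0 j) = def_fun M j.
Proof. by apply/funext => t; rewrite mxE. Qed.

Lemma analytic_RA m (f : 'rV[R]_m -> C) : real_analytic_at f 0 -> RA f.
Proof.
move=> /real_analytic_ext[r [P [r0 aP eP]]]; exists P; split; first by exists r.
by exists r; split=> // t /eP; rewrite add0r.
Qed.

Hypotheses (h0 : points M 0) (hgen : CR_generic M) (hIII : class_III1 M).

Lemma rhoM_analytic j : real_analytic_at (fun t => RtoC (rhoM t 0 j)) 0.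
Proof.
have e : (fun t : E => RtoC (rhoM t 0 j)) = (fun t => RtoC (def_fun M j t)).
  by apply/funext => t; rewrite mxE.
by rewrite e; exact: (@def_fun_analytic R 4 5 M j 0 h0.1).
Qed.

Lemma tangent_jac : near0R (fun p : E => forall v, tangent M p v <-> v *m (jac rhoM p)^T = 0).
Proof.
have hd := near0R_fin (fun j => RA_hasd (analytic_RA (rhoM_analytic j))).
apply: near0R_sub hd => p h v; have e := derive_jac v h; rewrite -e; split=> [hv|hv j].
  by apply/rowP => j; rewrite mxE rhoME [RHS]mxE; exact: hv.
by have := congr1 (fun u : 'rV[R]_3 => u 0 j) hv; rewrite mxE rhoME [RHS]mxE.
Qed.

Lemma rhoM_generic : generic_germ rhoM.
Proof.
have tj := near0R_at0 tangent_jac.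
split.
- by apply/rowP => j; rewrite !mxE; exact: h0.2.
- exact: rhoM_analytic.
- have := def_fun_submersion h0.1 h0.2; congr (row_free _).
  by apply/matrixP => j k; rewrite [LHS]mxE [RHS]mxE rhoME.
- move=> v; have [a [b [ha hb e]]] := hgen h0 v.
  by exists a, b; split=> //; exact/tj.
Qed.

Lemma chart_near : near0R (fun p : E => chart_dom M p).
Proof. by apply/near0RP; have := @chart_dom_open R 4 5 M; rewrite openE => /(_ _ h0.1). Qed.

Lemma points_rho : near0R (fun p : E => points M p <-> rhoM p = 0).
Proof.
apply: near0R_sub chart_near => p cp; split=> [[_ h]|h].
  by apply/rowP => j; rewrite !mxE; exact: h.
by split=> // j; have := congr1 (fun u : 'rV[R]_3 => u 0 j) h; rewrite !mxE.
Qed.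

Lemma ctangent_cjac p : (forall v, tangent M p v <-> v *m (jac rhoM p)^T = 0) ->
  forall Z : CE, ctangent M p Z <-> Z *m (cjac rhoM p)^T = 0.
Proof.
move=> tj Z; split=> [[X [Y [/tj hX /tj hY ->]]]|/real_tangent[X [Y [hX hY e]]]]; last first.
  by exists X, Y; split=> //; exact/tj.
by rewrite mulmxDl -scalemxAl !cx_cjac hX hY !cx0 scaler0 addr0.
Qed.

(** The hypothesis on brackets is used at the origin only, for the field
of [field_exists] in a small ball. *)
Lemma class_III1_germ : exists L : E -> CE, [/\ RAV L,
  near0R (fun p => L p *m (cjac rhoM p)^T = 0 /\ rsubmx (L p) = - ii *: lsubmx (L p)) &
  forall Z : CE, Z *m (cjac rhoM 0)^T = 0 -> (Z <= class_III1_fields L 0)%MS].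
Proof.
have [L [rL [r1 [r10 aL]] hL gL]] := field_exists rhoM_generic.
exists L; split=> //.
have [r2 [r20 hr2]] := near0R_and hL (near0R_and gL (near0R_and tangent_jac chart_near)).
pose r := Num.min r1 r2.
have r0 : 0 < r by rewrite lt_min r10.
pose V : set E := [set p | vn (cx p) < r].
have oV : open V.
  rewrite openE => p /= pr; apply/nbhsR; exists ((r - vn (cx p)) / 2).
    by rewrite divr_gt0 // subr_gt0.
  move=> q hq; rewrite /V /=; have -> : q = (q - p) + p by rewrite subrK.
  rewrite cxD (le_lt_trans (vnD _ _)) // -ltrBrDr (le_lt_trans hq) //.
  by rewrite ltr_pdivrMr // ltr_pMr ?subr_gt0 // ltr1n.
have near p : V p -> vn (cx p) < r1 /\ vn (cx p) <= r2.
  by rewrite /V /= lt_min => /andP[-> /ltW ->].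
have gen : T10_generator M V L.
  split=> p /near[p1 /hr2[[k1 k2] [[n0 gLp] [tj _]]]]; first exact: aL.
  move=> _; split=> // Z; split=> [[/(ctangent_cjac tj) hZ hJ]|[c ->]]; first exact: gLp.
  split; first by apply/(ctangent_cjac tj); rewrite -scalemxAl k1 scaler0.
  by apply/J_eigen; rewrite !linearZ /= k2 !scalerA mulrC.
have V0 : V 0 by rewrite /V /= cx0 vn0.
have VM : V `<=` chart_dom M by move=> p /near[_ /hr2[_ [_ []]]].
have [_ sp] := hIII oV VM gen V0 h0.
move=> Z hZ; apply/sp; apply/(ctangent_cjac _ Z) => //.
exact: near0R_at0 tangent_jac.
Qed.

End Submanifold.

(** * The coordinates z, w_1, w_2, w_3 *)

Section Translation.
Variable R : realType.
Local Notation C := (Cplx R).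
Implicit Type q : 'rV[C]_4.

Lemma zcE q : zc q = lsubmx (q : 'rV[C]_(1 + 3)) 0 0.
Proof. by rewrite mxE /zc; congr (q 0 _); apply: val_inj. Qed.
Lemma wcE q (j : 'I_3) : q 0 (lift 0 j) = rsubmx (q : 'rV[C]_(1 + 3)) 0 j.
Proof. by rewrite mxE; congr (q 0 _); apply: val_inj. Qed.
Lemma ucE q j : RtoC (uc j q) = upart (n := 3) q 0 j.
Proof.
rewrite /uc wcE /upart; move: (rsubmx _) => w; rewrite !mxE; move: (w 0 j) => x.
rewrite [in RHS](CE x) rmorphD rmorphM /= !conj_RtoC conjCi.
by move: (RtoC _) (RtoC _) => a b; field.
Qed.
Lemma vcE q j : RtoC (vc j q) = vpart (n := 3) q 0 j.
Proof.
rewrite /vc wcE /vpart; move: (rsubmx _) => w; rewrite !mxE; move: (w 0 j) => x.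
rewrite [in RHS](CE x) rmorphD rmorphM /= !conj_RtoC conjCi.
by move: (RtoC _) (RtoC _) => a b; field; exact: neq0Ci.
Qed.
Lemma zzbarE q : zzbar q = lsubmx (hq (n := 3) q).
Proof.
rewrite /hq /tri row_mxKl; apply/rowP => k; rewrite mxE zcE.
have [i ->|i ->] := split_ordP (k : 'I_(1 + 1)).
  by apply: etrans (esym (row_mxEl _ _ _ _)); rewrite ord1.
by apply: etrans (esym (row_mxEr _ _ _ _)); rewrite [RHS]mxE ord1.
Qed.
Lemma zzbaruE q : zzbaru q = hq (n := 3) q.
Proof.
rewrite -[RHS]hsubmxK -zzbarE; apply/rowP => k.
have [i ->|i ->] := split_ordP (k : 'I_(1 + 1 + 3)).
  apply: etrans (esym (row_mxEl _ _ _ _)); rewrite !mxE; case: i => -[|[|i]] //.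
apply: etrans (esym (row_mxEr _ _ _ _)); rewrite /hq /tri row_mxKr -ucE mxE.
by case: i => -[|[|[|i]]] //= hi; congr (RtoC (uc _ q)); apply: val_inj.
Qed.
Lemma graph_rhsE j (A : 'rV[C]_(1 + 1) -> C) (B : 'I_3 -> 'rV[C]_(1 + 1 + 3) -> C) q :
  graph_rhs j A B q = graph_value j A B q.
Proof.
rewrite /graph_rhs /graph_value zcE zzbarE zzbaruE.
congr (_ + _ + _); apply: eq_bigr => k _; by rewrite ucE.
Qed.

End Translation.

(** * The normalized equations *)

Theorem mainTheorem3 (R : realType) (M : local_submanifold R 4 5)
    (h0 : points M 0) (hgen : CR_generic M) (hIII : class_III1 M) :
  exists (F : 'rV[Cplx R]_4 -> 'rV[Cplx R]_4)
         (A : 'I_3 -> 'rV[Cplx R]_2 -> Cplx R)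
         (B : 'I_3 -> 'I_3 -> 'rV[Cplx R]_5 -> Cplx R),
    [/\ local_holomorphic_coordinates F,
        (forall j, bigO_series 2 (A j)),
        (forall j k, bigO_series 0 (B j k)),
        (\forall q \near (0 : 'rV[Cplx R]_4), forall j,
           graph_rhs j (A j) (B j) q \is Num.real) &
        (\forall p \near (0 : 'rV[R]_(4 + 4)), points M p <->
           forall j, RtoC (vc j (F (complex_point p)))
                     = graph_rhs j (A j) (B j) (F (complex_point p)))].
Proof.
have [L [rL hL hspan]] := class_III1_germ h0 hgen hIII.
have [F [A [B [cF aA aB real eq]]]] :=
  normalized_graph (rhoM_generic h0 hgen) rL hL hspan.
exists F, A, B; split.
- exact: cF.
- by move=> j; have [a [K b]] := aA j; apply: An_bigO => //; exists K.
- by move=> j k; apply: An_bigO => //; exact: An_bounded.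
- by apply/near0P; apply: near0_sub real => q h j; rewrite graph_rhsE CrealE h.
- apply/near0RP; apply: near0R_sub (near0R_and (points_rho h0) eq) => p [-> ->].
  by split=> h j; have := h j; rewrite vcE graph_rhsE.
Qed.
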